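(* Let $\phi=\tilde p/p$ be a degree $(n,1)$ rational inner function as in the context and let $\alpha\in\mathbb{T}$ be an exceptional value with, after reordering, $\phi^*(\tau_k,\lambda_k)=\alpha$ exactly for $k=1,\dots,\ell$. Write $B_\alpha=b_\alpha^1/b_\alpha^2$ with coprime polynomials $b_\alpha^1,b_\alpha^2$ of degree $n-\ell$. For $j=1,\dots,\ell$ put $$R_j(z)=d_j^\alpha\bigl(b_\alpha^2(z_1)-z_2b_\alpha^1(z_1)\bigr)\prod_{1\le k\le\ell,\,k\ne j}(z_1-\tau_k),$$ where $d_j^\alpha>0$ is chosen so that $c_j^\alpha\,\|(R_j/p)(\tau_j,\cdot)\|^2_{H^2(\mathbb{D})}=1$ (this is possible since $(R_j/p)(\tau_j,\cdot)$ is a nonzero element of $H^2(\mathbb{D})$ when $d_j^\alpha=1$). Then there exist polynomials $R_{\ell+1},\dots,R_n,Q\in\mathbb{C}[z_1,z_2]$ with $\deg Q\le(n,0)$ and $\deg R_j\le(n-1,1)$ for all $j$, such that for all $z,w\in\mathbb{C}^2$ $$p(z)\overline{p(w)}-\tilde p(z)\overline{\tilde p(w)}=(1-z_1\bar w_1)\sum_{j=1}^nR_j(z)\overline{R_j(w)}+(1-z_2\bar w_2)Q(z)\overline{Q(w)}.$$ Moreover $R_1/p,\dots,R_\ell/p$ form an orthonormal set in $K_\phi$.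
   Context: $\mathbb{D}$ is the open unit disk, $\mathbb{T}$ the unit circle. Fix $n\ge1$. Let $p\in\mathbb{C}[z_1,z_2]$ have no zeros on $\mathbb{D}^2$, degree at most $n$ in $z_1$ and at most $1$ in $z_2$; write $p(z)=p_1(z_1)+z_2p_2(z_1)$. Set $\tilde p(z)=z_1^nz_2\overline{p(1/\bar z_1,1/\bar z_2)}=z_2\tilde p_1(z_1)+\tilde p_2(z_1)$ with $\tilde p_i(z)=z^n\overline{p_i(1/\bar z)}$. Assume $\tilde p$ has degree exactly $(n,1)$ and $p,\tilde p$ have no common factor, so $\phi=\tilde p/p$ is a degree $(n,1)$ rational inner function. The zeros of $p$ on $\mathbb{T}^2$ are distinct points $(\tau_1,\lambda_1),\dots,(\tau_m,\lambda_m)$; $\phi^*$ (non-tangential limit) exists and is unimodular on $\mathbb{T}^2$; $\alpha$ is exceptional if $\phi^*(\tau_k,\lambda_k)=\alpha$ for some $k$. $B_\alpha$ is $\frac{\tilde p_1-\alpha p_2}{\alpha p_1-\tilde p_2}$ with common factors cancelled (a finite Blaschke product, of degree $n-\ell$ in the situation of the claim). For $\phi^*(\tau_j,\lambda_j)=\alpha$, $z_2\mapsto\partial_{z_1}\phi(\tau_j,z_2)$ is a nonzero constant on $\overline{\mathbb{D}}\setminus\{\lambda_j\}$ and $c_j^\alpha$ is the reciprocal of its modulus (equivalently, the weight of $\delta_{\tau_j}\otimes m$ in the Clark measure $\sigma_\alpha$). $K_\phi=H^2(\mathbb{D}^2)\ominus\phi H^2(\mathbb{D}^2)$ is the model space.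 *)

(* Defs.v *)
(* complex numbers are R[i] (mathcomp-real-closed) over an
   arbitrary realType R; everything is stated with explicit epsilon-N limits. *)
From HB Require Import structures.
From mathcomp Require Import all_boot all_order all_algebra.
From mathcomp Require Import complex reals.
Set Implicit Arguments. Unset Strict Implicit. Unset Printing Implicit Defensive.
Import Order.TTheory GRing.Theory Num.Theory ComplexField.
Local Open Scope ring_scope.
Local Open Scope complex_scope.

(* Bivariate polynomials: {poly {poly R[i]}}, the OUTER variable is z2 and the
   inner one is z1; so P = P`_0 + z2 * P`_1 + ... with P`_i in C[z1]. *)
Definition eval2 {R : realType} (P : {poly {poly R[i]}}) (z1 z2 : R[i]) : R[i] :=
  (map_poly (fun q : {poly R[i]} => q.[z1]) P).[z2].

(* degree at most a in z1 and at most b in z2 *)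
Definition bideg_le {R : realType} (a b : nat) (P : {poly {poly R[i]}}) : Prop :=
  leq (size P) b.+1 /\ forall i, leq (size P`_i) a.+1.

(* f~(z) = z^n conj(f(1/conj z)) for a one-variable polynomial of degree <= n *)
Definition recip1 {R : realType} (n : nat) (f : {poly R[i]}) : {poly R[i]} :=
  \poly_(i < n.+1) (f`_(n - i))^*.

(* p~(z) = z1^n z2 conj(p(1/conj z1, 1/conj z2)) for p of degree <= (n,1):
   p~ = z2 * p1~ + p2~  where p = p1 + z2 p2. *)
Definition ptilde {R : realType} (n : nat) (P : {poly {poly R[i]}}) : {poly {poly R[i]}} :=
  \poly_(k < 2) recip1 n (P`_(1 - k)).

(* partial derivative in z1 *)
Definition dz1 {R : realType} (P : {poly {poly R[i]}}) : {poly {poly R[i]}} :=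
  map_poly (fun q : {poly R[i]} => q^`()) P.

(* the rational function phi = p~/p and its z1-partial derivative (quotient rule) *)
Definition rif {R : realType} (n : nat) (P : {poly {poly R[i]}}) (z1 z2 : R[i]) : R[i] :=
  eval2 (ptilde n P) z1 z2 / eval2 P z1 z2.

Definition drif_dz1 {R : realType} (n : nat) (P : {poly {poly R[i]}}) (z1 z2 : R[i]) : R[i] :=
  (eval2 (dz1 (ptilde n P)) z1 z2 * eval2 P z1 z2
     - eval2 (ptilde n P) z1 z2 * eval2 (dz1 P) z1 z2) / (eval2 P z1 z2) ^+ 2.

(* convergence of a complex sequence *)
Definition cvgC {R : realType} (u : nat -> R[i]) (l : R[i]) : Prop :=
  forall e : R, 0 < e -> exists N : nat, forall k, (N <= k)%N -> `|u k - l| < e%:C.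

(* non-tangential limit of f at (t1,t2) in T^2 equal to L *)
Definition nt_limit {R : realType} (f : R[i] -> R[i] -> R[i]) (t1 t2 L : R[i]) : Prop :=
  forall c : R, 0 < c -> forall e : R, 0 < e -> exists2 dl : R, 0 < dl &
    forall z1 z2 : R[i], `|z1| < 1 -> `|z2| < 1 ->
      `|z1 - t1| <= c%:C * (1 - `|z1|) -> `|z2 - t2| <= c%:C * (1 - `|z2|) ->
      `|z1 - t1| < dl%:C -> `|z2 - t2| < dl%:C -> `|f z1 z2 - L| < e%:C.

(* H^2(D): a is the (square summable) Taylor coefficient sequence of g on D *)
Definition H2D_coef {R : realType} (g : R[i] -> R[i]) (a : nat -> R[i]) : Prop :=
  (exists M : R, forall N, \sum_(k < N) `|a k| ^+ 2 <= M%:C) /\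
  forall z : R[i], `|z| < 1 -> cvgC (fun N => \sum_(k < N) a k * z ^+ k) (g z).

(* g is in H^2(D) and ||g||^2 = s *)
Definition H2D_normsq {R : realType} (g : R[i] -> R[i]) (s : R[i]) : Prop :=
  exists a, H2D_coef g a /\ cvgC (fun N => \sum_(k < N) `|a k| ^+ 2) s.

(* H^2(D^2): a is the square summable Taylor coefficient array of f on D^2 *)
Definition H2_coef {R : realType} (f : R[i] -> R[i] -> R[i]) (a : nat -> nat -> R[i]) : Prop :=
  (exists M : R, forall N, \sum_(i < N) \sum_(k < N) `|a i k| ^+ 2 <= M%:C) /\
  forall z1 z2 : R[i], `|z1| < 1 -> `|z2| < 1 ->
    cvgC (fun N => \sum_(i < N) \sum_(k < N) a i k * z1 ^+ i * z2 ^+ k) (f z1 z2).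

Definition inH2 {R : realType} (f : R[i] -> R[i] -> R[i]) : Prop := exists a, H2_coef f a.

(* <f, g>_{H^2(D^2)} = s  (coefficients are unique, so "for all" is harmless) *)
Definition H2_inner_is {R : realType} (f g : R[i] -> R[i] -> R[i]) (s : R[i]) : Prop :=
  forall a b, H2_coef f a -> H2_coef g b ->
    cvgC (fun N => \sum_(i < N) \sum_(k < N) a i k * (b i k)^*) s.

(* f in K_phi = H^2(D^2) minus phi H^2(D^2) *)
Definition in_model_space {R : realType} (phi f : R[i] -> R[i] -> R[i]) : Prop :=
  inH2 f /\ forall h, inH2 h -> H2_inner_is f (fun z1 z2 => phi z1 z2 * h z1 z2) 0.

(* prod_{k < l, k <> j} (z1 - tau_k) *)
Definition Pj {R : realType} (tau : nat -> R[i]) (l j : nat) : {poly R[i]} :=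
  \prod_(k < l | k != j :> nat) ('X - (tau k)%:P).

(* (b2(z1) - z2 b1(z1)) * prod_{k<l, k<>j} (z1 - tau_k)  (i.e. R_j with d_j = 1) *)
Definition R0j {R : realType} (b1 b2 : {poly R[i]}) (tau : nat -> R[i]) (l j : nat)
  : {poly {poly R[i]}} :=
  (b2%:P - 'X * b1%:P) * (Pj tau l j)%:P.

(* Main.v *)
(* Fix a unimodular la different from all lambda_k.  Then P = p(., la) has no
   zero on the closed disk, and p~(., la) - alpha P has n simple zeros rho, all
   on the circle, with positive angular derivatives; a zero at which
   p~ - alpha p vanishes identically in z2 is, by Julia's inequality, a point
   where phi* = alpha, so that these zeros are tau_1, ..., tau_l.  The Clark
   basis at the points rho, extended to polynomials of degree 1 in z2 by means of
   the Fejer-Riesz factor Q of |p_1|^2 - |p_2|^2, gives the sum of squares; the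
   terms attached to tau_1, ..., tau_l are multiples of
   (p~ - alpha p) / (z1 - tau_j), and the normalisation fixes the multiple.
   In H^2, the decomposition gives a Bessel inequality for the functions R_j / p
   and z1^i z2^k phi.  The relation (z1 - tau_j) R_j = e (p~ - alpha p) yields
   ||R_j / p|| = 1 for j <= l, so testing the inequality against R_j / p
   leaves no room for inner products with the other functions. *)
Require Import Defs.
From HB Require Import structures.
From mathcomp Require Import all_boot all_order all_algebra.
From mathcomp Require Import classical_sets complex reals.
From mathcomp Require Import zify ring lra.
Set Implicit Arguments.
Unset Strict Implicit.
Unset Printing Implicit Defensive.
Import Order.TTheory GRing.Theory Num.Theory ComplexField.

(** * Polynomials over a closed field with conjugation *)

Section Basics.
Local Open Scope ring_scope.
Variable C : numClosedFieldType.
Implicit Types (f g : {poly C}) (z w a : C).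

(** Clark theory needs a denominator without zeros on the closed disk, and [p] may vanish on the
    torus; the slice z2 = la restores this. The identity sought is expanded in u = z2 - la and v =
    conj(w2 - la). Each coefficient is a kernel of degree at most n in conj w1, so its values at the
    n Clark points and at 1/conj z1 determine it. The coefficient of u v escapes this test and is
    deduced from the others with a further identity, for the two coefficients of p~ - alpha p. For
    H^2 no boundary function is formed: everything happens on Taylor coefficients in the square i, k
    < N. An equality of Hermitian sums of squares of polynomials is preserved by any linear
    functional, such as u -> <u/p, x> restricted to the square. Telescoping over monomials yields a
    Bessel equality for every N, which already shows that R_j/p lies in H^2. That phi has norm one
    comes from the same device applied to coefficient functionals. Completeness enters only as the
    fact that bounded increasing sequences are Cauchy, so the argument runs over a
    [numClosedFieldType] and is specialised to R[i] at the end. *)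

Lemma conjM z w : (z * w)^* = z^* * w^*. Proof. exact: rmorphM. Qed.
Lemma conjD z w : (z + w)^* = z^* + w^*. Proof. exact: rmorphD. Qed.
Lemma conjB z w : (z - w)^* = z^* - w^*. Proof. exact: rmorphB. Qed.
Lemma conjN z : (- z)^* = - z^*. Proof. exact: rmorphN. Qed.
Lemma conjX z k : (z ^+ k)^* = z^* ^+ k. Proof. exact: rmorphXn. Qed.
Lemma conjV z : (z^-1)^* = z^*^-1. Proof. exact: fmorphV. Qed.
Lemma conj0 : 0^* = 0 :> C. Proof. exact: rmorph0. Qed.
Lemma conj1 : 1^* = 1 :> C. Proof. exact: rmorph1. Qed.
Lemma conj_sum (I : Type) (r : seq I) (P : pred I) (F : I -> C) :
  (\sum_(i <- r | P i) F i)^* = \sum_(i <- r | P i) (F i)^*.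
Proof. exact: rmorph_sum. Qed.

Definition conjE := (conjM, conjB, conjD, conjN, conjX, conjV, @conjCK C, conj0, conj1).

Lemma horner_one z : (1 : {poly C}).[z] = 1. Proof. by rewrite -polyC1 hornerC. Qed.

Definition hornE := (@hornerD C, @hornerN C, @hornerM C, @hornerZ C, @hornerX C,
  @hornerXn C, horner_one, @horner0 C, @hornerC C).

Lemma leq_size_polyM k l (f g : {poly C}) : (size f <= k.+1)%N -> (size g <= l.+1)%N ->
  (size (f * g)%R <= (k + l).+1)%N.
Proof.
move=> sf sg; apply: leq_trans (size_polyMleq _ _) _.
by move: sf sg; move: (size f) (size g) => x y; lia.
Qed.

Lemma size_one_sub_scaleX (c : C) : (size (1 - c *: 'X)%R <= 2)%N.
Proof.
rewrite (leq_trans (size_polyD _ _)) // geq_max size_poly1 /=.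
by rewrite size_polyN (leq_trans (size_scale_leq _ _)) // size_polyX.
Qed.

Lemma unit_mulconj z : `|z| = 1 -> z * z^* = 1.
Proof. by move=> z1; rewrite -normCK z1 expr1n. Qed.
Lemma mulconj_unit z : z * z^* = 1 -> `|z| = 1.
Proof.
rewrite -normCK => /eqP; rewrite sqrf_eq1 => /orP[/eqP //|/eqP zN].
by have := normr_ge0 z; rewrite zN ler0N1.
Qed.
Lemma unit_neq0 z : `|z| = 1 -> z != 0.
Proof. by move=> z1; rewrite -normr_eq0 z1 oner_eq0. Qed.
Lemma unit_conj z : `|z| = 1 -> z^* = z^-1.
Proof.
move=> z1; apply: (mulfI (unit_neq0 z1)).
by rewrite unit_mulconj // divff // unit_neq0.
Qed.
Lemma unit_mul_unit z w : `|z| = 1 -> `|w| = 1 -> `|z * w| = 1.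
Proof. by move=> z1 w1; rewrite normrM z1 w1 mulr1. Qed.

Lemma poly_zero_cofinite f (s : seq C) :
  (forall z, z \notin s -> f.[z] = 0) -> f = 0.
Proof.
move=> f0; set h := \prod_(z <- s) ('X - z%:P).
have fh0 z : (f * h).[z] = 0.
  rewrite hornerM; have [zs|/f0->] := boolP (z \in s); last by rewrite mul0r.
  have /rootP -> : root h z by rewrite root_prod_XsubC.
  by rewrite mulr0.
have : f * h = 0.
  apply: (@roots_geq_poly_eq0 _ _ [seq k%:R | k <- iota 0 (size (f * h))]).
  - by apply/allP => x _; apply/rootP.
  - rewrite map_inj_uniq ?iota_uniq // => i j /eqP.
    by rewrite eqr_nat => /eqP.
  - by rewrite size_map size_iota.
move/eqP; rewrite mulf_eq0 => /orP[/eqP //|h0].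
by have := monic_prod_XsubC s predT id; rewrite -/h (eqP h0) monicE lead_coef0 eq_sym oner_eq0.
Qed.

Lemma poly_zero f : (forall z, f.[z] = 0) -> f = 0.
Proof. by move=> f0; apply: (@poly_zero_cofinite _ [::]) => z _. Qed.

(** The Cayley map of the real line onto the circle without -1: an algebraic supply of unimodular
    points, and later the coordinate in which a sign condition on the circle becomes one on the
    line. *)
Definition circle_pt (x : C) : C := (1 + 'i * x) / (1 - 'i * x).

Lemma i_real_neq0 (x : C) : x \is Num.real -> 1 - 'i * x != 0.
Proof.
move=> xr; rewrite subr_eq0; apply/eqP => e.
have e1 : -1 * x ^+ 2 = 1 by rewrite -(sqrCi C) -exprMn -e expr1n.
have e2 : x ^+ 2 = -1 by rewrite -e1 mulN1r opprK.
by have := real_exprn_even_ge0 xr (isT : ~~ odd 2); rewrite e2 ler0N1.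
Qed.

Lemma circle_ptP (x : C) : x \is Num.real -> `|circle_pt x| = 1.
Proof.
move=> xr; apply: mulconj_unit.
have h1 := i_real_neq0 xr.
have h2 : 1 + 'i * x != 0.
  by have := @i_real_neq0 (- x); rewrite mulrN opprK; apply; rewrite rpredN.
rewrite /circle_pt !conjE conjCi (conj_Creal xr) mulNr opprK.
by field; rewrite h1 h2.
Qed.

Lemma circle_pt_inj (x y : C) : x \is Num.real -> y \is Num.real ->
  circle_pt x = circle_pt y -> x = y.
Proof.
move=> xr yr; rewrite /circle_pt => /eqP.
have h1 := i_real_neq0 xr; have h2 := i_real_neq0 yr.
rewrite eqr_div // => /eqP e.
have i0 : ('i : C) != 0 := neq0Ci _.
have : 'i * 2%:R * (x - y) = (1 + 'i * x) * (1 - 'i * y) - (1 + 'i * y) * (1 - 'i * x).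
  by ring.
rewrite e subrr => /eqP; rewrite !mulf_eq0 (negPf i0) pnatr_eq0 /= subr_eq0.
by move/eqP.
Qed.

Lemma circle_infinite (s : seq C) : exists2 z, `|z| = 1 & z \notin s.
Proof.
set u := [seq circle_pt k%:R | k <- iota 0 (size s).+1].
have un : uniq u.
  rewrite map_inj_uniq ?iota_uniq // => i j /circle_pt_inj e.
  by have /eqP := e (realn _ _) (realn _ _); rewrite eqr_nat => /eqP.
have [sub|/allPn[z zu zs]] := boolP (all (mem s) u).
  have := uniq_leq_size un (allP sub).
  by rewrite size_map size_iota ltnn.
exists z => //; case/mapP: zu => k _ ->; exact: circle_ptP (realn _ _).
Qed.

Lemma poly_zero_circle f (s : seq C) :
  (forall z, `|z| = 1 -> z \notin s -> f.[z] = 0) -> f = 0.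
Proof.
move=> f0.
have [m] := ubnP (size f); elim: m f s f0 => // m IH f s f0 sf.
have [z z1 zs] := circle_infinite s.
have [->//|fn0] := eqVneq f 0.
have /factor_theorem [g fg] : root f z by apply/rootP/f0.
have g0 : g = 0.
  apply: (IH g (z :: s)) => [w w1|].
    rewrite inE negb_or => /andP[wz ws].
    have := f0 w w1 ws; rewrite fg hornerM !hornerE => /eqP.
    by rewrite mulf_eq0 subr_eq0 (negPf wz) orbF => /eqP.
  have gn0 : g != 0 by apply: contraNneq fn0 => g0; rewrite fg g0 mul0r.
  by move: sf; rewrite fg size_Mmonic ?monicXsubC // size_XsubC; lia.
by rewrite fg g0 mul0r.
Qed.

Lemma poly_lipschitz f (b : C) : 0 <= b ->
  exists2 K, 0 < K & forall z w, `|z| <= b -> `|w| <= b ->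
    `|f.[z] - f.[w]| <= K * `|z - w|.
Proof.
move=> b0; elim/poly_ind: f => [|f c [K K0 IH]].
  by exists 1 => // z w _ _; rewrite !horner0 subrr normr0 mul1r normr_ge0.
have [M hM] := poly_disk_bound f b.
exists (K * b + `|M| + 1) => [|z w zb wb].
  by rewrite ltr_wpDl // addr_ge0 ?normr_ge0 // mulr_ge0 // ltW.
rewrite !hornerE.
have -> : f.[z] * z + c - (f.[w] * w + c) = (f.[z] - f.[w]) * z + f.[w] * (z - w).
  by ring.
apply: le_trans (ler_normD _ _) _; rewrite !normrM.
have h1 : `|f.[z] - f.[w]| * `|z| <= K * `|z - w| * b.
  by apply: ler_pM => //; exact: IH.
have h2 : `|f.[w]| * `|z - w| <= `|M| * `|z - w|.
  apply: ler_wpM2r => //; have fM := hM w wb.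
  have M0 : 0 <= M := le_trans (normr_ge0 _) fM.
  by rewrite (ger0_norm M0).
apply: le_trans (lerD h1 h2) _.
rewrite !mulrDl mul1r mulrAC lerDl normr_ge0 //.
Qed.

(** Carries inequalities from the open disk to its boundary: at r = 1 - t the two Lipschitz errors
    are t K |z| and t L |z|. *)
Lemma radial_le f g z (d : C) : 0 < d -> d <= 1 ->
  (forall r : C, 1 - d < r -> r < 1 -> `|f.[r * z]| <= `|g.[r * z]|) ->
  `|f.[z]| <= `|g.[z]|.
Proof.
move=> d0 d1 fg.
have [K K0 hK] := poly_lipschitz f (normr_ge0 z).
have [L L0 hL] := poly_lipschitz g (normr_ge0 z).
apply/ler_addgt0Pr => e e0.
set M := (K + L) * `|z| + 1.
have M0 : 0 < M by rewrite ltr_wpDl // mulr_ge0 // ltW // addr_gt0.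
have eM0 : 0 < e / M by rewrite divr_gt0.
(* The order of [C] is partial, so t comes from comparing the real numbers d and e / M rather than
   from a minimum. *)
have [t [t0 td te]] : exists t : C, [/\ 0 < t, t < d & t <= e / M].
  have /orP[h|h] := real_leVge (gtr0_real eM0) (gtr0_real d0).
    exists (e / M / 2%:R); split; first by rewrite divr_gt0.
      apply: lt_le_trans h; rewrite ltr_pdivrMr //.
      by rewrite ltr_pMr // ltr1n.
    by rewrite ler_pdivrMr // ler_pMr // ler1n.
  exists (d / 2%:R); split; first by rewrite divr_gt0.
    by rewrite ltr_pdivrMr // ltr_pMr // ltr1n.
  by apply: le_trans h; rewrite ler_pdivrMr // ler_pMr // ler1n.
have t1 : t < 1 by apply: lt_le_trans d1.
have r1 : 1 - t < 1 by rewrite gtrBl.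
have r0 : 0 < 1 - t by rewrite subr_gt0.
have rz : `|(1 - t) * z| <= `|z|.
  by rewrite normrM (gtr0_norm r0) ler_piMl // ltW.
have dz : `|z - (1 - t) * z| = t * `|z|.
  have -> : z - (1 - t) * z = t * z by ring.
  by rewrite normrM (gtr0_norm t0).
have f1 := hK _ _ (lexx `|z|) rz.
have g1 := hL _ _ (lexx `|z|) rz.
rewrite dz in f1; rewrite dz distrC in g1.
have m1 : `|f.[(1 - t) * z]| <= `|g.[(1 - t) * z]|.
  by apply: fg => //; rewrite ltrD2l ltrN2.
have a1 : `|f.[z]| <= `|f.[z] - f.[(1 - t) * z]| + `|f.[(1 - t) * z]|.
  by apply: le_trans (ler_normD _ _); rewrite subrK.
have a2 : `|g.[(1 - t) * z]| <= `|g.[(1 - t) * z] - g.[z]| + `|g.[z]|.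
  by apply: le_trans (ler_normD _ _); rewrite subrK.
have b1 : `|f.[z]| <= K * (t * `|z|) + (L * (t * `|z|) + `|g.[z]|).
  apply: le_trans a1 _; apply: lerD => //; apply: le_trans m1 _.
  by apply: le_trans a2 _; rewrite lerD2r.
apply: le_trans b1 _; rewrite addrA addrC lerD2l.
have -> : K * (t * `|z|) + L * (t * `|z|) = t * (M - 1) by rewrite /M; ring.
apply: (@le_trans _ _ (t * M)); first by rewrite ler_pM2l // gerBl.
by rewrite -ler_pdivlMr.
Qed.

(* The reflection z^k f*(1/z); [recip1] of the statement is this polynomial
   over R[i]. *)
Definition recip (k : nat) f : {poly C} := \poly_(i < k.+1) (f`_(k - i))^*.

Lemma size_recip k f : (size (recip k f) <= k.+1)%N.
Proof. exact: size_poly. Qed.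

(** The companion point w is 1/conj z, which is z itself on the circle. The form z conj(w) = 1 is
    also the one in which kernels are tested off the circle. *)
Lemma horner_recip k f z w : (size f <= k.+1)%N -> z * w^* = 1 ->
  (recip k f).[z] = z ^+ k * (f.[w])^*.
Proof.
move=> sf zw; rewrite horner_poly (horner_coef_wide _ sf) conj_sum mulr_sumr.
rewrite (reindex_inj rev_ord_inj).
have term (i : 'I_k.+1) : (f`_(k - rev_ord i))^* * z ^+ rev_ord i =
    z ^+ k * (f`_i * w ^+ i)^*.
  have e : (i <= k)%N by rewrite -ltnS.
  rewrite /= subSS subKn // conjM conjX.
  have -> : z ^+ k = z ^+ (k - i) * z ^+ i by rewrite -exprD subnK.
  rewrite (_ : z ^+ (k - i) * z ^+ i * _ =
    (f`_i)^* * z ^+ (k - i) * (z ^+ i * (w^*) ^+ i)); last by ring.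
  by rewrite -exprMn zw expr1n mulr1.
by apply: eq_bigr => i _; exact: term.
Qed.

Lemma recipD k f g : recip k (f + g) = recip k f + recip k g.
Proof.
apply/polyP => i; rewrite coefD !coef_poly; case: ifP => _; last by rewrite addr0.
by rewrite coefD conjD.
Qed.

Lemma recipZ k c f : recip k (c *: f) = c^* *: recip k f.
Proof.
apply/polyP => i; rewrite coefZ !coef_poly; case: ifP => _; last by rewrite mulr0.
by rewrite coefZ conjM.
Qed.

End Basics.

(** * The one-variable Takenaka and Clark decompositions *)

Section Takenaka.
Local Open Scope ring_scope.
Variable C : numClosedFieldType.
Implicit Types (f g P : {poly C}) (z w a b : C).

Lemma recip_factor k (a : C) P : (size P <= k.+1)%N ->
  recip k.+1 ((1 - a^* *: 'X) * P) = ('X - a%:P) * recip k P.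
Proof.
move=> sP; apply/eqP; rewrite -subr_eq0; apply/eqP.
apply: (@poly_zero_cofinite _ _ [:: 0]) => z; rewrite inE => z0.
have zw : z * ((z^*)^-1)^* = 1 by rewrite conjV conjCK divff.
have sP2 : (size ((1 - a^* *: 'X) * P)%R <= k.+2)%N.
  by rewrite -add1n (leq_size_polyM (size_one_sub_scaleX _)).
rewrite hornerD hornerN hornerM (horner_recip sP zw) (horner_recip sP2 zw).
rewrite !hornE !conjE exprS.
by field.
Qed.

Lemma split_factor k P : (size P <= k.+2)%N ->
  (forall z, `|z| <= 1 -> P.[z] != 0) ->
  exists a P', [/\ `|a| < 1, P = (1 - a^* *: 'X) * P', (size P' <= k.+1)%N
    & forall z, `|z| <= 1 -> P'.[z] != 0].
Proof.
move=> sP P0; have [sP'|sP'] := leqP (size P) k.+1.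
  (* Degree defect: the factor with a = 0 is 1, while the reflection gains a factor 'X. *)
  exists 0, P; split => //; first by rewrite normr0.
  by rewrite conj0 scale0r subr0 mul1r.
have [b rb] : exists b, root P b.
  apply/closed_rootP; apply: contraTneq sP' => ->; by rewrite -ltnNge.
have b1 : 1 < `|b|.
  rewrite real_ltNge ?real1 ?normr_real //; apply: contraL rb => /P0.
  by rewrite /root.
have b0 : b != 0 by rewrite -normr_gt0 (lt_trans ltr01).
have [G PG] := factor_theorem P b rb.
have G0 : G != 0.
  apply: contraTneq sP' => g0; by rewrite PG g0 mul0r size_poly0.
exists (b^-1)^*, (- b *: G); split.
- by rewrite norm_conjC normfV invf_lt1 // (lt_trans ltr01).
- rewrite conjCK PG -!mul_polyC polyCN.
  have bb : b%:P * b^-1%:P = 1 by rewrite -polyCM divff.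
  rewrite [RHS](_ : _ = (b%:P * b^-1%:P) * 'X * G - b%:P * G); last by ring.
  by rewrite bb; ring.
- move: sP; rewrite PG size_Mmonic ?monicXsubC // size_XsubC addn2 /= => sP.
  by rewrite (leq_trans (size_scale_leq _ _)).
- move=> z z1; have := P0 z z1; rewrite PG !hornE mulf_eq0 negb_or.
  by case/andP => g0 _; rewrite mulf_neq0 // oppr_eq0.
Qed.

(* Takenaka-Malmquist basis: one factor (1 - a* z) is peeled off at a time. *)
Lemma takenaka k P : (size P <= k.+1)%N ->
  (forall z, `|z| <= 1 -> P.[z] != 0) ->
  exists Es : seq {poly C},
    (forall z w, P.[z] * (P.[w])^* - (recip k P).[z] * ((recip k P).[w])^* =
       (1 - z * w^*) * \sum_(E <- Es) E.[z] * (E.[w])^*) /\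
    ((0 < k)%N -> forall z, 0 < \sum_(E <- Es) E.[z] * (E.[z])^*).
Proof.
elim: k P => [|k IH] P sP P0.
  exists [::]; split => // z w.
  rewrite big_nil mulr0 (size1_polyC sP) !hornE; set c := P`_0.
  have -> : recip 0 c%:P = (c^*)%:P.
    by apply/polyP => -[|i]; rewrite coef_poly !coefC.
  by rewrite !hornE conjCK; ring.
have [a [P' [a1 PE sP' P'0]]] := split_factor sP P0.
have [Es [Es1 Es2]] := IH P' sP' P'0.
have aa : 0 < 1 - a * a^* by rewrite -normCK subr_gt0 expr_lt1.
(* The induction rests on (1 - conj(a) z)(1 - a conj(w)) - (z - a) conj(w - a) = (1 - |a|^2)(1 - z
   conj(w)). *)
set s := sqrtC (1 - a * a^*).
have ss : s * s^* = 1 - a * a^*.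
  by rewrite conj_Creal ?ger0_real ?sqrtC_ge0 ?ltW // -expr2 sqrtCK.
exists ((s *: P') :: [seq ('X - a%:P) * E | E <- Es]); split.
  move=> z w; rewrite PE recip_factor // !hornE !conjE.
  rewrite big_cons big_map !hornE !conjE.
  have -> : \sum_(E <- Es) (('X - a%:P) * E).[z] * ((('X - a%:P) * E).[w])^* =
    (z - a) * (w - a)^* * \sum_(E <- Es) E.[z] * (E.[w])^*.
    by rewrite mulr_sumr; apply: eq_bigr => E _; rewrite !hornE !conjE; ring.
  rewrite !conjE; transitivity ((1 - z * w^*) * ((s * s^*) * (P'.[z] * (P'.[w])^*)) +
    (z - a) * (w^* - a^*) * ((1 - z * w^*) * \sum_(E <- Es) E.[z] * (E.[w])^*)).
    by rewrite ss -Es1; ring.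
  by ring.
move=> _ z; rewrite big_cons big_map !hornE.
have sum0 : 0 <= \sum_(E <- Es) (('X - a%:P) * E).[z] * ((('X - a%:P) * E).[z])^*.
  by apply: sumr_ge0 => E _; exact: mul_conjC_ge0.
have s0 : s != 0 by rewrite sqrtC_eq0 gt_eqF.
(* If the new term vanishes at z, then |z| > 1 > |a|, so the factor z - a is nonzero and the
   positivity of the old sum is used. *)
have [P'z|P'z] := eqVneq P'.[z] 0; last first.
  by apply: ltr_pwDl => //; rewrite mul_conjC_gt0 mulf_neq0.
rewrite P'z mulr0 mul0r add0r.
have z1 : 1 < `|z|.
  rewrite real_ltNge ?real1 ?normr_real //.
  by apply/negP => /P'0; rewrite P'z eqxx.
have za : z - a != 0.
  by rewrite subr_eq0; apply: contraTneq a1 => <-; rewrite -real_leNgt ?real1 ?normr_real // ltW.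
have k0 : (0 < k)%N.
  case: (k) sP' => // /size1_polyC PC.
  have := P'0 0; rewrite normr0 ler01 => /(_ isT).
  by move: P'z; rewrite PC !hornerC => ->; rewrite eqxx.
have -> : \sum_(E <- Es) (('X - a%:P) * E).[z] * ((('X - a%:P) * E).[z])^* =
    ((z - a) * (z - a)^*) * \sum_(E <- Es) E.[z] * (E.[z])^*.
  by rewrite mulr_sumr; apply: eq_bigr => E _; rewrite !hornE !conjE; ring.
by rewrite mulr_gt0 ?mul_conjC_gt0 // Es2.
Qed.

Lemma uniq_simple_roots (rs : seq C) :
  (forall r, r \in rs -> (\prod_(x <- rs) ('X - x%:P))^`().[r] != 0) -> uniq rs.
Proof.
elim: rs => //= x s IH rs'.
have D r : (\prod_(y <- x :: s) ('X - y%:P))^`().[r] =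
    (\prod_(y <- s) ('X - y%:P)).[r] + (r - x) * (\prod_(y <- s) ('X - y%:P))^`().[r].
  by rewrite big_cons derivM !hornE derivB derivX derivC !hornE subr0 mul1r.
apply/andP; split.
  apply/negP => xs; have := rs' x (mem_head _ _); rewrite D subrr mul0r addr0.
  by have /rootP -> : root (\prod_(y <- s) ('X - y%:P)) x; rewrite ?root_prod_XsubC ?eqxx.
apply: IH => r rs1.
have := rs' r; rewrite inE rs1 orbT => /(_ isT); rewrite D.
have /rootP -> : root (\prod_(y <- s) ('X - y%:P)) r by rewrite root_prod_XsubC.
by rewrite add0r mulf_eq0 negb_or => /andP[].
Qed.

(** * Clark points of a finite Blaschke product: the solutions of recip P = beta P *)

Section Clark.
Variables (k : nat) (P : {poly C}) (beta : C).
Hypotheses (k0 : (0 < k)%N) (sP : (size P <= k.+1)%N).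
Hypothesis P0 : forall z, `|z| <= 1 -> P.[z] != 0.
Hypothesis beta1 : `|beta| = 1.
Let W := recip k P - beta *: P.

(** At a root |recip P| = |P|, so the diagonal of the Takenaka identity reads 0 = (1 - |r|^2) times
    a positive sum. *)
Lemma clark_root_unit r : root W r -> `|r| = 1.
Proof.
move/rootP; rewrite /W !hornE => /eqP; rewrite subr_eq0 => /eqP e.
have [Es [Es1 Es2]] := takenaka sP P0.
have := Es1 r r; rewrite e -!normCK normrM beta1 mul1r subrr => /esym/eqP.
rewrite mulf_eq0 [X in _ || X]gt_eqF ?orbF; last exact: Es2.
by rewrite subr_eq0 => /eqP e1; apply: mulconj_unit; rewrite -normCK.
Qed.

(** This is the angular derivative of recip P / P at r, multiplied by |P(r)|^2. The Takenaka
    identity with w = r expresses a multiple of W as (1 - conj(r) z) G(z), and differentiation at r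
    leaves G(r) > 0. *)
Lemma clark_root_positive r : root W r -> 0 < W^`().[r] * (P.[r])^* * beta^* * r.
Proof.
move=> rW; have r1 := clark_root_unit rW.
move/rootP: rW => rW; have := rW; rewrite /W !hornE => /eqP; rewrite subr_eq0 => /eqP e.
have [Es [Es1 Es2]] := takenaka sP P0.
set G : {poly C} := \sum_(E <- Es) (E.[r])^* *: E.
have WG : - beta^* * (P.[r])^* *: W = (1 - r^* *: 'X) * G.
  apply/eqP; rewrite -subr_eq0; apply/eqP; apply: poly_zero => z.
  rewrite !hornE /G horner_sum.
  under eq_bigr do rewrite hornerZ mulrC.
  rewrite [1 - r^* * z](_ : _ = 1 - z * r^*); last by ring.
  rewrite -Es1 ?/W e conjM.
  rewrite [LHS](_ : _ = (beta * beta^* - 1) * (P.[z] * (P.[r])^*)); last by ring.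
  by rewrite unit_mulconj // subrr mul0r.
have d1 : (1 - r^* *: 'X)^`() = - (r^*)%:P.
  by rewrite derivB derivZ derivX -polyC1 derivC sub0r alg_polyC.
have := congr1 (fun p : {poly C} => p^`().[r]) WG.
rewrite derivZ derivM d1 hornerZ hornerD !hornerM.
rewrite [(1 - _).[r]]hornerD !hornE (mulrC r^*) unit_mulconj // subrr mul0r addr0 => e2.
have -> : W^`().[r] * (P.[r])^* * beta^* * r =
   - (- beta^* * (P.[r])^* * W^`().[r]) * r by ring.
rewrite e2 [X in 0 < X](_ : _ = (r * r^*) * G.[r]); last by ring.
rewrite unit_mulconj // mul1r /G horner_sum.
under eq_bigr do rewrite hornerZ mulrC.
exact: Es2.
Qed.

Lemma clark_roots : exists rs : seq C,
  [/\ uniq rs, size rs = k & W = lead_coef W *: \prod_(x <- rs) ('X - x%:P)].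
Proof.
have [rs WE] := closed_field_poly_normal W.
(* A vanishing top coefficient would give |P_0| = |P_k|, and the identity at (0, 0) would make a
   positive sum zero. So W has degree k and, by positivity of the derivative, k distinct roots. *)
have Wk : W`_k != 0.
  rewrite /W coefB coefZ coef_poly ltnSn subnn; apply/negP; rewrite subr_eq0 => /eqP e.
  have [Es [Es1 Es2]] := takenaka sP P0.
  have := Es1 0 0; rewrite mul0r subr0 mul1r !horner_coef0 coef_poly subn0 /= conjCK.
  have n0 : P`_0 * (P`_0)^* = (P`_k)^* * P`_k.
    rewrite -{1}[P`_0]conjCK e conjM [LHS](_ : _ = beta * beta^* * ((P`_k)^* * P`_k)).
      by rewrite unit_mulconj // mul1r.
    by ring.
  rewrite n0 subrr => e0.
  by have := Es2 k0 0; rewrite -e0 ltxx.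
have sW : size W = k.+1.
  apply/eqP; rewrite eqn_leq; apply/andP; split.
    rewrite /W (leq_trans (size_polyD _ _)) // geq_max size_recip size_polyN.
    exact: leq_trans (size_scale_leq _ _) sP.
  by rewrite ltnNge; apply: contra Wk => sW; rewrite nth_default.
have W0 : lead_coef W != 0 by rewrite lead_coef_eq0 -size_poly_eq0 sW.
exists rs; split => //; last first.
  by move: sW; rewrite WE size_scale // size_prod_XsubC => -[].
apply: uniq_simple_roots => r rrs.
have rW : root W r by rewrite WE rootZ // root_prod_XsubC.
have := clark_root_positive rW; rewrite {1}WE derivZ hornerZ.
by apply: contraTneq => ->; rewrite mulr0 !mul0r ltxx.
Qed.

End Clark.
End Takenaka.

(** * The Fejer-Riesz factorisation *)

Section FejerRiesz.
Local Open Scope ring_scope.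
Variable C : numClosedFieldType.
Implicit Types (f g L G P : {poly C}) (z w a b x : C) (s : seq C).

Lemma small_avoid s (d : C) : 0 < d ->
  exists x, [/\ 0 < x, x < d, x \notin s & - x \notin s].
Proof.
move=> d0; set t := s ++ [seq - y | y <- s].
set u := [seq d / (k.+2)%:R | k <- iota 0 (size t).+1].
have un : uniq u.
  rewrite map_inj_uniq ?iota_uniq // => i j /(mulfI (lt0r_neq0 d0)) /invr_inj /eqP.
  by rewrite eqr_nat => /eqP[].
have [sub|/allPn[z zu zs]] := boolP (all (mem t) u).
  have := uniq_leq_size un (allP sub).
  by rewrite size_map size_iota ltnn.
exists z; move: zs; rewrite inE mem_cat negb_or => /andP[zs1 zs2].
case/mapP: zu => k _ zE; split=> //.
- by rewrite zE divr_gt0.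
- by rewrite zE ltr_pdivrMr ?ltr0n // ltr_pMr // ltr1n.
- by apply: contra zs2 => h; apply/mapP; exists (- z); rewrite ?opprK.
Qed.

(** f changes sign at 0 along the real line. The points x and -x must both avoid the finite set
    where the sign is unknown. *)
Lemma odd_sign_root f s :
  (forall x, x \is Num.real -> x \notin s -> 0 <= x * f.[x]) -> f.[0] = 0.
Proof.
move=> f0; apply/eqP; rewrite -normr_eq0 eq_le normr_ge0 andbT.
have [K K0 hK] := poly_lipschitz f (ler01 : 0 <= 1 :> C).
apply/ler_addgt0Pr => e e0; rewrite add0r.
(* The 3 K is K + 2 K: |f(0) - f(x)| <= K x, and |f(x)| <= |f(x) - f(-x)| <= 2 K x. *)
have d0 : 0 < e / (e + 3%:R * K) by rewrite divr_gt0 // addr_gt0 // mulr_gt0.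
have [x [x0 xd xs xNs]] := small_avoid s d0.
have xr : x \is Num.real := gtr0_real x0.
have eK : 0 < e + 3%:R * K by rewrite addr_gt0 // mulr_gt0.
have x1 : x <= 1.
  by apply: ltW; apply: lt_le_trans xd _; rewrite ler_pdivrMr // mul1r lerDl mulr_ge0 // ltW.
have fx : 0 <= f.[x] by have := f0 x xr xs; rewrite pmulr_rge0.
have fNx : f.[- x] <= 0.
  by have := f0 (- x); rewrite rpredN => /(_ xr xNs); rewrite mulNr oppr_ge0 pmulr_rle0.
have nx : `|x| <= 1 by rewrite gtr0_norm.
have h1 := hK x (- x); rewrite normrN in h1; have {}h1 := h1 nx nx.
have h2 := hK 0 x; rewrite normr0 in h2; have {}h2 := h2 ler01 nx.
rewrite opprK -mulr2n normrMn (gtr0_norm x0) in h1.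
rewrite sub0r normrN (gtr0_norm x0) in h2.
have h3 : `|f.[x]| <= K * (x *+ 2).
  rewrite ger0_norm //; apply: le_trans h1; apply: le_trans (real_ler_norm _).
    by rewrite lerDl oppr_ge0.
  by apply: rpredB; [exact: ger0_real | exact: ler0_real].
have h4 : `|f.[0]| <= K * x + K * (x *+ 2).
  have -> : f.[0] = f.[0] - f.[x] + f.[x] by rewrite subrK.
  by apply: le_trans (ler_normD _ _) _; exact: lerD.
apply: le_trans h4 _.
have -> : K * x + K * (x *+ 2) = x * (3%:R * K) by ring.
apply: (@le_trans _ _ (x * (e + 3%:R * K))).
  by rewrite ler_pM2l // lerDr ltW.
by rewrite -ler_pdivlMr // ltW.
Qed.

(** The numerator of G(a [circle_pt] x) as a polynomial in x, cleared by (1 - i x)^N; x = 0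
    corresponds to the point a. *)
Definition cayley (N : nat) a G : {poly C} :=
  \sum_(j < N.+1) (G`_j * a ^+ j) *: ((1 + 'i *: 'X) ^+ j * (1 - 'i *: 'X) ^+ (N - j)).

Lemma cayleyE N a G x : (size G <= N.+1)%N -> x \is Num.real ->
  (cayley N a G).[x] = (1 - 'i * x) ^+ N * G.[a * circle_pt x].
Proof.
move=> sG xr; rewrite /cayley horner_sum (horner_coef_wide _ sG) mulr_sumr.
have h := i_real_neq0 xr.
apply: eq_bigr => j _; rewrite !hornE !horner_exp !hornE /circle_pt.
have jN : (j <= N)%N by rewrite -ltnS.
have -> : (1 - 'i * x) ^+ N = (1 - 'i * x) ^+ (N - j) * (1 - 'i * x) ^+ j.
  by rewrite -exprD subnK.
rewrite exprMn expr_div_n.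
by field; rewrite expf_neq0.
Qed.

(** L encodes the trigonometric polynomial z^-k L(z). The list s collects the points at which a
    factor |z - a|^2 has been divided out. *)
Definition nonneg_circle k L s := forall z, `|z| = 1 -> z \notin s -> 0 <= z^* ^+ k * L.[z].

(** A simple zero of a trigonometric polynomial on the circle would be a change of sign. The Cayley
    coordinate centred at a reduces this to [odd_sign_root]. *)
Lemma nonneg_double_root k G a s : `|a| = 1 -> (size G <= k.*2.+2)%N ->
  nonneg_circle k.+1 (('X - a%:P) * G) s -> G.[a] = 0.
Proof.
move=> a1 sG L0.
(* Since z - a = 2 i a x / (1 - i x), this constant makes x m(x) equal to (1 + x^2)^(k+1) times the
   nonnegative quantity on the circle. *)
pose c := 'i *+ 2 * a * a^* ^+ k.+1.
pose m := c *: cayley k.*2.+1 a G.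
have c0 : c != 0.
  have i2 : ('i : C) *+ 2 != 0 by rewrite mulrn_eq0 negb_or /= neq0Ci.
  have a0 := unit_neq0 a1.
  by apply: mulf_neq0; [exact: mulf_neq0 | apply: expf_neq0; rewrite conjC_eq0].
suff: m.[0] = 0.
  rewrite /m hornerZ cayleyE ?real0 // /circle_pt mulr0 subr0 addr0 divr1 expr1n mul1r mulr1.
  by move/eqP; rewrite mulf_eq0 (negPf c0) => /eqP.
(* These are the parameters of the excluded points; z = -a, which has none, contributes the default
   value 0. *)
apply: (@odd_sign_root _ [seq (z / a - 1) / ('i * (z / a + 1)) | z <- s]) => x xr xs.
have h := i_real_neq0 xr.
have h' : 1 + 'i * x != 0.
  by have := @i_real_neq0 _ (- x); rewrite mulrN opprK; apply; rewrite rpredN.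
have a0 := unit_neq0 a1.
have i0 : ('i : C) != 0 := neq0Ci _.
set z := a * circle_pt x.
have z1 : `|z| = 1 by rewrite unit_mul_unit // circle_ptP.
have zs : z \notin s.
  apply: contra xs => zs; apply/mapP; exists z => //.
  rewrite /z /circle_pt (mulrC a) mulfK //.
  have -> : (1 + 'i * x) / (1 - 'i * x) + 1 = 2%:R / (1 - 'i * x) by field.
  by field; rewrite h i0.
have := L0 z z1 zs; rewrite hornerM hornerD hornerN hornerX hornerC => L1.
rewrite /m hornerZ cayleyE // -/z.
have zc : z^* = a^* * (1 - 'i * x) / (1 + 'i * x).
  by rewrite /z /circle_pt !conjE conjCi (conj_Creal xr) mulNr opprK mulrA.
have D : 0 < ((1 - 'i * x) * (1 + 'i * x)).
  have -> : (1 - 'i * x) * (1 + 'i * x) = 1 + x ^+ 2.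
    have -> : (1 - 'i * x) * (1 + 'i * x) = 1 - 'i ^+ 2 * x ^+ 2 by ring.
    by rewrite sqrCi mulN1r opprK.
  by rewrite ltr_wpDr // real_exprn_even_ge0.
have -> : x * (c * ((1 - 'i * x) ^+ k.*2.+1 * G.[z])) =
   ((1 - 'i * x) * (1 + 'i * x)) ^+ k.+1 * (z^* ^+ k.+1 * ((z - a) * G.[z])).
  rewrite zc /c expr_div_n !exprMn.
  have -> : z - a = a * ('i *+ 2 * x) / (1 - 'i * x) by rewrite /z /circle_pt; field.
  have -> : (1 - 'i * x) ^+ k.*2.+1 = (1 - 'i * x) ^+ k.+1 * (1 - 'i * x) ^+ k.
    by rewrite -exprD addSn addnn.
  rewrite [(1 - 'i * x) ^+ k.+1]exprS.
  by field; rewrite h expf_neq0.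
by rewrite mulr_ge0 // exprn_ge0 // ltW.
Qed.

Lemma nonneg_self_recip k L s : (size L <= k.*2.+1)%N -> nonneg_circle k L s ->
  recip k.*2 L = L.
Proof.
move=> sL L0; apply/eqP; rewrite -subr_eq0; apply/eqP.
apply: (@poly_zero_circle _ _ s) => z z1 zs.
rewrite hornerD hornerN (horner_recip sL (unit_mulconj z1)).
have := conj_Creal (ger0_real (L0 z z1 zs)); rewrite !conjE => e.
have zz : z ^+ k * z^* ^+ k = 1 by rewrite -exprMn unit_mulconj // expr1n.
rewrite -addnn exprD -mulrA e mulrA zz mul1r subrr //.
Qed.

(* The roots of a self-reciprocal L come in pairs (a, 1/a^* ), a unimodular
   root being double by the sign condition; each pair contributes one root of Q. *)
Lemma fejer_riesz k L s : (size L <= k.*2.+1)%N -> nonneg_circle k L s ->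
  exists2 Q : {poly C}, (size Q <= k.+1)%N & L = Q * recip k Q.
Proof.
elim: k L s => [|k IH] L s sL L0.
  have [z z1 zs] := circle_infinite s.
  have := L0 z z1 zs; rewrite mul1r (size1_polyC sL) hornerC; set c := L`_0 => c0.
  exists (sqrtC c)%:P; first by rewrite size_polyC; case: (_ != 0).
  have -> : recip 0 (sqrtC c)%:P = (sqrtC c)%:P.
    apply/polyP => -[|i]; rewrite coef_poly !coefC //=.
    by rewrite conj_Creal // ger0_real // sqrtC_ge0.
  by rewrite -polyCM -expr2 sqrtCK.
have [->|Ln0] := eqVneq L 0.
  exists 0; first by rewrite size_poly0.
  by rewrite mul0r.
have LR := nonneg_self_recip sL L0.
have L0top : L`_0 = (L`_(k.+1).*2)^* by rewrite -{1}LR coef_poly subn0.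
(* On the circle ('X - a)(1 - conj(a) 'X) equals z |z - a|^2, so dividing by it lowers k by one and
   keeps the sign everywhere except at a. *)
suff [a [L' [LE sL' L'0]]] : exists a L', [/\ L = ('X - a%:P) * (1 - a^* *: 'X) * L',
    (size L' <= k.*2.+1)%N & nonneg_circle k L' (a :: s)].
  have [Q sQ QE] := IH _ _ sL' L'0.
  exists ((1 - a^* *: 'X) * Q).
    by rewrite -add1n (leq_size_polyM (size_one_sub_scaleX _)).
  by rewrite recip_factor // LE QE; ring.
have nonneg a L' : L = ('X - a%:P) * (1 - a^* *: 'X) * L' -> nonneg_circle k L' (a :: s).
  move=> LE z z1; rewrite inE negb_or => /andP[za zs].
  have := L0 z z1 zs; rewrite LE !hornE.
  have zz := unit_mulconj z1.
  have -> : z^* ^+ k.+1 * ((z - a) * (1 - a^* * z) * L'.[z]) =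
    ((z - a) * (z - a)^*) * (z^* ^+ k * L'.[z]).
    rewrite exprS conjB.
    rewrite [LHS](_ : _ = (z - a) * (z^* - a^* * (z * z^*)) * (z^* ^+ k * L'.[z])); last by ring.
    by rewrite zz mulr1.
  by rewrite pmulr_rge0 // mul_conjC_gt0 subr_eq0.
(* A constant L has zero coefficient in degree 2(k+1), and self-reciprocity then makes the constant
   coefficient zero too. *)
have [r rL] : exists r, root L r.
  apply/closed_rootP; apply/negP => /eqP s1.
  have L00 : L`_0 = 0.
    by rewrite L0top [L`__]nth_default ?conj0 // s1 doubleS.
  by move: Ln0; rewrite (size1_polyC (eq_leq s1)) L00 polyC0 eqxx.
(* The root 0 is paired with infinity: by self-reciprocity the top coefficient vanishes as well, so
   removing 'X alone gives the required size. *)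
have [r0|r0] := eqVneq r 0.
  have [G LG] := factor_theorem L r rL.
  have LE : L = ('X - 0%:P) * (1 - 0^* *: 'X) * G.
    by rewrite conj0 scale0r LG r0; ring.
  exists 0, G; split => //; last exact: nonneg.
  have G0 : G != 0 by apply: contraNneq Ln0 => g0; rewrite LG g0 mul0r.
  have sLG : size L = (size G).+1.
    by rewrite LG size_Mmonic ?monicXsubC // size_XsubC addn2.
  have sL2 : (size L <= (k.+1).*2)%N.
    rewrite leqNgt; apply/negP => sL3.
    have sLe : size L = (k.+1).*2.+1 by apply/eqP; rewrite eqn_leq sL sL3.
    have : lead_coef L = 0.
      rewrite lead_coefE sLe /= -[LHS]conjCK -L0top -horner_coef0.
      by move/rootP: rL; rewrite r0 => ->; rewrite conj0.
    by move/eqP; rewrite lead_coef_eq0 (negPf Ln0).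
  by move: sL2; rewrite sLG doubleS ltnS.
have [G LG] := factor_theorem L r rL.
have G0 : G != 0 by apply: contraNneq Ln0 => g0; rewrite LG g0 mul0r.
have sLG : size L = (size G).+1.
  by rewrite LG size_Mmonic ?monicXsubC // size_XsubC addn2.
pose b := (r^*)^-1.
have Gb : root G b.
  have [r1|r1] := eqVneq `|r| 1.
    have -> : b = r by rewrite /b unit_conj // invrK.
    apply/rootP; apply: (@nonneg_double_root k _ _ s) => //.
      by move: sL; rewrite sLG doubleS.
    by rewrite mulrC -LG.
  have Lb : L.[b] = 0.
    have br : b * r^* = 1 by rewrite mulVf // conjC_eq0.
    rewrite -LR (horner_recip sL br).
    by move/rootP: rL => ->; rewrite conj0 mulr0.
  apply/rootP; move/eqP: Lb; rewrite LG !hornE mulf_eq0 => /orP[/eqP //|].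
  rewrite subr_eq0 => /eqP br; case/eqP: r1; apply: mulconj_unit.
  by rewrite -{1}br mulVf // conjC_eq0.
have [H GH] := factor_theorem G b Gb.
have H0 : H != 0 by apply: contraNneq G0 => g0; rewrite GH g0 mul0r.
have LE : L = ('X - r%:P) * (1 - r^* *: 'X) * (- b *: H).
  rewrite LG GH -!mul_polyC polyCN.
  have bb : b%:P * (r^*)%:P = 1 by rewrite -polyCM mulVf // conjC_eq0.
  rewrite [RHS](_ : _ = ('X - r%:P) * ((b%:P * (r^*)%:P) * 'X - b%:P) * H); last by ring.
  by rewrite bb; ring.
exists r, (- b *: H); split => //; last exact: nonneg.
rewrite (leq_trans (size_scale_leq _ _)) //.
have : size G = (size H).+1.
  by rewrite GH size_Mmonic ?monicXsubC // size_XsubC addn2.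
by move: sL; rewrite sLG doubleS => h1 h2; rewrite h2 in h1.
Qed.

End FejerRiesz.

(** * The decomposition attached to the zeros of p~ - alpha p *)

Section Sesquilinear.
Local Open Scope ring_scope.
Variable C : numClosedFieldType.
Implicit Types (f g : {poly C}) (z w : C) (k : C -> C -> C).

(** Polynomial kernels in z and conj w. Only the degree in conj w is bounded; the polynomial
    dependence on z carries a zero from cofinitely many z to all z. *)
Definition sesqui (m : nat) k :=
  (forall z, exists2 h : {poly C}, (size h <= m)%N & forall w, k z w = (h.[w])^*) /\
  (forall w, exists h : {poly C}, forall z, k z w = h.[z]).

Lemma sesqui_rank1 m f g : (size g <= m)%N ->
  sesqui m (fun z w => f.[z] * (g.[w])^*).
Proof.
move=> sg; split=> [z|w].
  exists ((f.[z])^* *: g) => [|w]; first exact: leq_trans (size_scale_leq _ _) sg.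
  by rewrite hornerZ conjM conjCK.
by exists ((g.[w])^* *: f) => z; rewrite hornerZ mulrC.
Qed.

Lemma sesquiD m k1 k2 : sesqui m k1 -> sesqui m k2 ->
  sesqui m (fun z w => k1 z w + k2 z w).
Proof.
move=> [a1 b1] [a2 b2]; split=> [z|w].
  have [h1 s1 e1] := a1 z; have [h2 s2 e2] := a2 z; exists (h1 + h2) => [|w].
    by rewrite (leq_trans (size_polyD _ _)) // geq_max s1 s2.
  by rewrite hornerD conjD e1 e2.
have [h1 e1] := b1 w; have [h2 e2] := b2 w; exists (h1 + h2) => z.
by rewrite hornerD e1 e2.
Qed.

Lemma sesquiN m k1 : sesqui m k1 -> sesqui m (fun z w => - k1 z w).
Proof.
move=> [a1 b1]; split=> [z|w].
  have [h1 s1 e1] := a1 z; exists (- h1) => [|w]; first by rewrite size_polyN.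
  by rewrite hornerN conjN e1.
by have [h1 e1] := b1 w; exists (- h1) => z; rewrite hornerN e1.
Qed.

Lemma sesqui_sum m (I : Type) (r : seq I) (k : I -> C -> C -> C) :
  (forall i, sesqui m (k i)) -> sesqui m (fun z w => \sum_(i <- r) k i z w).
Proof.
move=> ks; elim: r => [|i r [a b]].
  split=> [z|w]; first by exists 0 => [|w]; rewrite ?size_poly0 // big_nil horner0 conj0.
  by exists 0 => z; rewrite big_nil horner0.
have [a' b'] := sesquiD (ks i) (conj a b).
split=> [z|w].
  by have [h sh e] := a' z; exists h => // w; rewrite big_cons e.
by have [h e] := b' w; exists h => z; rewrite big_cons e.
Qed.

Lemma sesqui_szego m k : sesqui m k -> sesqui m.+1 (fun z w => (1 - z * w^*) * k z w).
Proof.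
move=> [a b]; split=> [z|w].
  have [h sh e] := a z; exists ((1 - z^* *: 'X) * h) => [|w].
    case: m sh {a} => [|m] sh; last first.
      by rewrite -add1n (leq_size_polyM (size_one_sub_scaleX _)).
    by move: sh; rewrite leqn0 size_poly_eq0 => /eqP ->; rewrite mulr0 size_poly0.
  by rewrite !hornE !conjE e.
have [h e] := b w; exists ((1 - w^* *: 'X) * h) => z.
by rewrite !hornE e (mulrC w^*).
Qed.

(** For fixed z the kernel has degree at most n = [size rs] in conj w, and it vanishes at the n
    points of [rs] and at 1/conj z. The latter is a new point unless z lies in [rs], because those
    points are unimodular. *)
Lemma sesqui_zero k (rs : seq C) : sesqui (size rs).+1 k -> uniq rs ->
  (forall r, r \in rs -> `|r| = 1) ->
  (forall z w, z * w^* = 1 -> k z w = 0) ->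
  (forall z r, r \in rs -> k z r = 0) ->
  forall z w, k z w = 0.
Proof.
move=> [a b] urs rs1 k1 k0 z w.
have [h e] := b w; rewrite e.
suff -> : h = 0 by rewrite horner0.
apply: (@poly_zero_cofinite _ _ (0 :: rs)) => {}z.
rewrite inE negb_or => /andP[z0 zrs]; rewrite -e.
have [g sg e'] := a z; rewrite e'.
have zc : z^* != 0 by rewrite conjC_eq0.
suff -> : g = 0 by rewrite horner0 conj0.
apply: (@roots_geq_poly_eq0 _ _ ((z^*)^-1 :: rs)) => //.
- apply/allP => r; rewrite inE => /orP[/eqP ->|rrs]; apply/rootP; apply: (inv_inj (@conjCK C)).
    by rewrite -e' conj0 k1 // conjV conjCK divff.
  by rewrite -e' conj0 k0.
- rewrite /= urs andbT; apply: contra zrs => zr.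
  have := rs1 _ zr; rewrite normfV norm_conjC => /eqP; rewrite invr_eq1 => /eqP z1.
  by rewrite -[z]invrK -(unit_conj z1).
Qed.

End Sesquilinear.

(** * The sum of squares over the Clark points of the slice z2 = la *)

Section ClarkAgler.
Local Open Scope ring_scope.
Variable C : numClosedFieldType.
Implicit Types (f g : {poly C}) (z w r : C).
Variables (n : nat) (p1 p2 Q q0 q1 P W A B : {poly C}) (al la : C).
Hypothesis n0 : (0 < n)%N.
Hypotheses (sp1 : (size p1 <= n.+1)%N) (sp2 : (size p2 <= n.+1)%N).
Hypothesis sQ : (size Q <= n.+1)%N.
Hypotheses (q0E : q0 = recip n p2) (q1E : q1 = recip n p1).
Hypothesis QE : p1 * q1 - p2 * q0 = Q * recip n Q.
Hypotheses (al1 : `|al| = 1) (la1 : `|la| = 1).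
Hypotheses (PE : P = p1 + la *: p2) (WE : W = q0 + la *: q1 - al *: P).
Hypotheses (AE : A = q1 - al *: p2) (BE : B = al *: p1 - q0).
Variables (rs : seq C) (s : C -> C).
Hypotheses (urs : uniq rs) (srs : size rs = n).
Hypothesis Wrs : forall r, r \in rs -> root W r.
Hypothesis rs1 : forall r, r \in rs -> `|r| = 1.
Hypothesis Pr : forall r, r \in rs -> P.[r] != 0.
Hypothesis W'r : forall r, r \in rs -> W^`().[r] != 0.
Hypothesis sE : forall r, r \in rs -> s r * (s r)^* * W^`().[r] = al * r^* * P.[r].

Let q0z z w : z * w^* = 1 -> q0.[z] = z ^+ n * (p2.[w])^*.
Proof. by move=> zw; rewrite q0E (horner_recip sp2 zw). Qed.
Let q1z z w : z * w^* = 1 -> q1.[z] = z ^+ n * (p1.[w])^*.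
Proof. by move=> zw; rewrite q1E (horner_recip sp1 zw). Qed.
Let q0w z w : z * w^* = 1 -> (q0.[w])^* = (w^*) ^+ n * p2.[z].
Proof.
move=> zw; have wz : w * z^* = 1 by rewrite -[w]conjCK -conjM mulrC zw conj1.
by rewrite (q0z wz) conjM conjX conjCK.
Qed.
Let q1w z w : z * w^* = 1 -> (q1.[w])^* = (w^*) ^+ n * p1.[z].
Proof.
move=> zw; have wz : w * z^* = 1 by rewrite -[w]conjCK -conjM mulrC zw conj1.
by rewrite (q1z wz) conjM conjX conjCK.
Qed.
Let zwn z w : z * w^* = 1 -> z ^+ n * w^* ^+ n = 1.
Proof. by move=> zw; rewrite -exprMn zw expr1n. Qed.

Let QQ z w : z * w^* = 1 ->
  p1.[z] * (p1.[w])^* - p2.[z] * (p2.[w])^* = Q.[z] * (Q.[w])^*.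
Proof.
move=> zw; have zn : z ^+ n != 0.
  by apply: expf_neq0; apply: contra_eq_neq zw => ->; rewrite mul0r eq_sym oner_eq0.
apply: (mulfI zn); have := congr1 (fun f : {poly C} => f.[z]) QE.
rewrite hornerD hornerN !hornerM (q0z zw) (q1z zw) (horner_recip sQ zw) => e.
by rewrite mulrBr mulrCA (mulrCA _ p2.[z]) e; ring.
Qed.

Let Wroot r : r \in rs -> q0.[r] + la * q1.[r] = al * (p1.[r] + la * p2.[r]).
Proof.
by move/Wrs/rootP; rewrite WE PE !hornE => /eqP; rewrite subr_eq0 => /eqP.
Qed.

Let BAr r : r \in rs -> B.[r] = la * A.[r].
Proof.
move=> rr; rewrite AE BE !hornE.
rewrite [RHS](_ : _ = q0.[r] + la * q1.[r] - q0.[r] - al * la * p2.[r]); last by ring.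
by rewrite Wroot //; ring.
Qed.

(** At a Clark point the left side reduces to al (|p1|^2 - |p2|^2). Consequently Q vanishes wherever
    B does, which frees the exceptional terms from Q. *)
Let BPr r : r \in rs -> B.[r] * (P.[r])^* = al * (Q.[r] * (Q.[r])^*).
Proof.
move=> rr; have rr1 := unit_mulconj (rs1 rr); rewrite -(QQ rr1).
have lala := unit_mulconj la1.
have e := Wroot rr; rewrite (q0z rr1) (q1z rr1) in e.
rewrite BE PE !hornE !conjE (q0z rr1).
set u1 := p1.[r] in e *; set u2 := p2.[r] in e *; set rn := r ^+ n in e *.
have e' : rn * u2^* * (u1^* + la^* * u2^*) = la^* * u2^* * (al * (u1 + la * u2)).
  rewrite -e [RHS](_ : _ = rn * u2^* * ((la * la^*) * u1^* + la^* * u2^*)); last by ring.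
  by rewrite lala mul1r.
rewrite mulrBl e' [LHS](_ : _ = al * (u1 * u1^* - (la * la^*) * (u2 * u2^*))); last by ring.
by rewrite lala mul1r.
Qed.

Let s0 r : r \in rs -> s r != 0.
Proof.
move=> rr; apply/eqP => s0; have := sE rr; rewrite s0 !mul0r => /esym/eqP.
by rewrite !mulf_eq0 conjC_eq0 (negPf (unit_neq0 al1)) (negPf (unit_neq0 (rs1 rr))) (negPf (Pr rr)).
Qed.

Let sE' r : r \in rs -> s r * (s r)^* * (W^`().[r])^* = al^* * r * (P.[r])^*.
Proof.
by move=> rr; have := congr1 Num.conj (sE rr); rewrite !conjE => <-; ring.
Qed.

Section Identity.
Variable x : C -> C.
Hypothesis xW : forall r, r \in rs ->
  x r * (s r)^* * (W^`().[r])^* = la^* * r * (Q.[r])^*.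

(** Makes s A - x Q divisible by 'X - r, so that Y r can be a polynomial. It follows from B = la A
    and from [BPr] at the Clark point. *)
Lemma clark_factor_root r : r \in rs -> s r * A.[r] = x r * Q.[r].
Proof.
move=> rr; have c0 : (s r)^* * (W^`().[r])^* != 0.
  by rewrite mulf_neq0 // conjC_eq0 ?s0 ?W'r.
have lala := unit_mulconj la1; have alal := unit_mulconj al1.
apply: (mulIf c0).
transitivity ((s r * (s r)^* * (W^`().[r])^*) * A.[r]); first by ring.
rewrite sE' //.
transitivity ((x r * (s r)^* * (W^`().[r])^*) * Q.[r]); last by ring.
rewrite xW //.
transitivity (al^* * r * (P.[r])^* * ((la * la^*) * A.[r])); first by rewrite lala mul1r.
transitivity (al^* * r * la^* * ((la * A.[r]) * (P.[r])^*)); first by ring.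
rewrite -BAr // BPr //.
transitivity ((al * al^*) * (la^* * r * (Q.[r])^* * Q.[r])); first by ring.
by rewrite alal mul1r.
Qed.

Let xxW r : r \in rs -> r^* * (x r * (x r)^*) * (W^`().[r])^* = (B.[r])^*.
Proof.
move=> rr; have rr1 := unit_mulconj (rs1 rr).
have lala := unit_mulconj la1; have alal := unit_mulconj al1.
have c0 : s r * (s r)^* * W^`().[r] != 0.
  by rewrite !mulf_neq0 // ?conjC_eq0 ?s0 ?W'r.
apply: (mulfI c0).
have xW' := congr1 Num.conj (xW rr); rewrite !conjE in xW'.
transitivity (r^* * (x r * (s r)^* * (W^`().[r])^*) * ((x r)^* * s r * W^`().[r])); first by ring.
rewrite xW // xW' sE //.
transitivity (r^* * (la * la^*) * (r * r^*) * (Q.[r] * (Q.[r])^*)); first by ring.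
rewrite lala rr1 !mulr1.
have := congr1 Num.conj (BPr rr); rewrite !conjE => e.
transitivity (al * r^* * ((B.[r])^* * P.[r])); last by ring.
rewrite e; transitivity ((al * al^*) * (r^* * (Q.[r] * (Q.[r])^*))); last by ring.
by rewrite alal mul1r.
Qed.

Variables (U X Y : C -> {poly C}).
Hypothesis WU : forall r, r \in rs -> ('X - r%:P) * U r = W.
Hypothesis YE : forall r, r \in rs -> ('X - r%:P) * Y r = s r *: A - x r *: Q.
Hypothesis XE : forall r, X r = s r *: U r.
Hypotheses (sU : forall r, (size (U r) <= n)%N) (sY : forall r, (size (Y r) <= n)%N).

Let sX r : (size (X r) <= n)%N.
Proof. by rewrite XE (leq_trans (size_scale_leq _ _)). Qed.

Let Ur r t : r \in rs -> t \in rs -> t != r -> (U r).[t] = 0.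
Proof.
move=> rr tr tn; have := congr1 (fun f : {poly C} => f.[t]) (WU rr).
rewrite !hornE (rootP (Wrs tr)) => /eqP.
by rewrite mulf_eq0 subr_eq0 (negPf tn) => /eqP.
Qed.
Let Urr r : r \in rs -> (U r).[r] = W^`().[r].
Proof.
move=> rr; rewrite -(WU rr) derivM derivB derivX derivC !hornE.
by rewrite subr0 mul1r subrr mul0r addr0.
Qed.

Let sumU r (F : C -> C) : r \in rs ->
  \sum_(t <- rs) F t * ((U t).[r])^* = F r * (W^`().[r])^*.
Proof.
move=> rr; rewrite (bigD1_seq r) //= big1_seq ?addr0 ?Urr // => t /andP[tr trs].
by rewrite Ur // ?conj0 ?mulr0 // eq_sym.
Qed.

Let szego_root z r (f g : {poly C}) : r \in rs -> ('X - r%:P) * f = g ->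
  (1 - z * r^*) * f.[z] = - r^* * g.[z].
Proof.
move=> rr <-; rewrite !hornE; have rr1 := unit_mulconj (rs1 rr).
transitivity ((r * r^* - z * r^*) * f.[z]); first by rewrite rr1.
by ring.
Qed.

(** [D00], [D10] and [D11] are the coefficients of 1, z2 - la and (z2 - la) conj(w2 - la) in the
    final identity. In this one the sum collapses at w = r, since U t vanishes at all Clark points
    but t. *)
Let D00 z w : P.[z] * (P.[w])^* - (q0 + la *: q1).[z] * ((q0 + la *: q1).[w])^*
  - (1 - z * w^*) * \sum_(r <- rs) (X r).[z] * ((X r).[w])^* = 0.
Proof.
pose k z w := P.[z] * (P.[w])^* - (q0 + la *: q1).[z] * ((q0 + la *: q1).[w])^*
  - (1 - z * w^*) * \sum_(r <- rs) (X r).[z] * ((X r).[w])^*.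
apply: (@sesqui_zero _ k rs) => //; rewrite ?srs.
- have sZ c (f : {poly C}) : (size f <= n.+1)%N -> (size (c *: f) <= n.+1)%N.
    by move=> sf; rewrite (leq_trans (size_scale_leq _ _)).
  have sD (f g : {poly C}) : (size f <= n.+1)%N -> (size g <= n.+1)%N -> (size (f + g)%R <= n.+1)%N.
    by move=> sf sg; rewrite (leq_trans (size_polyD _ _)) // geq_max sf.
  apply: sesquiD; last first.
    apply/sesquiN/sesqui_szego/sesqui_sum => r; exact: sesqui_rank1.
  apply: sesquiD; first by apply: sesqui_rank1; rewrite PE sD // sZ.
  by apply/sesquiN/sesqui_rank1; rewrite q0E q1E sD ?sZ ?size_recip.
- move=> {}z {}w zw; rewrite /k zw subrr mul0r subr0 PE !hornE !conjE.
  rewrite (q0z zw) (q1z zw) (q0w zw) (q1w zw).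
  have zn := zwn zw; have lala := unit_mulconj la1.
  set a1 := p1.[z]; set a2 := p2.[z]; set b1 := (p1.[w])^*; set b2 := (p2.[w])^*.
  transitivity ((1 - z ^+ n * w^* ^+ n) * (a1 * b1 + la * a2 * b1 + la^* * a1 * b2 + a2 * b2) + (la * la^* - 1) * (a2 * b2 - (z ^+ n * w^* ^+ n) * (a1 * b1))).
    by ring.
  by rewrite zn lala !subrr !mul0r addr0.
- move=> {}z r rr; rewrite /k mulr_sumr.
  have -> : \sum_(t <- rs) (1 - z * r^*) * ((X t).[z] * ((X t).[r])^*) =
     \sum_(t <- rs) ((1 - z * r^*) * s t * (s t)^* * (U t).[z]) * ((U t).[r])^*.
    by apply: eq_bigr => t _; rewrite !XE !hornerZ conjM; ring.
  rewrite sumU //.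
  transitivity (P.[z] * (P.[r])^* - (q0 + la *: q1).[z] * ((q0 + la *: q1).[r])^* - (s r * (s r)^* * (W^`().[r])^*) * ((1 - z * r^*) * (U r).[z])); first by ring.
  rewrite sE' // (szego_root z rr (WU rr)).
  have -> : (q0 + la *: q1).[r] = al * P.[r] by rewrite PE !hornE Wroot.
  rewrite conjM; set v := (q0 + la *: q1).[z].
  have -> : W.[z] = v - al * P.[z] by rewrite WE hornerD hornerN hornerZ.
  have rr1 := unit_mulconj (rs1 rr); have alal := unit_mulconj al1.
  transitivity ((P.[r])^* * (P.[z] - al^* * v + (r * r^*) * (al^* * v - (al * al^*) * P.[z]))); first by ring.
  by rewrite rr1 alal; ring.
Qed.

Let D10 z w : p2.[z] * (P.[w])^* - q1.[z] * ((q0 + la *: q1).[w])^*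
  - (1 - z * w^*) * (\sum_(r <- rs) (Y r).[z] * ((X r).[w])^*)
  + la^* * (Q.[z] * (Q.[w])^*) = 0.
Proof.
pose k z w := p2.[z] * (P.[w])^* - q1.[z] * ((q0 + la *: q1).[w])^*
  - (1 - z * w^*) * (\sum_(r <- rs) (Y r).[z] * ((X r).[w])^*)
  + la^* * (Q.[z] * (Q.[w])^*).
apply: (@sesqui_zero _ k rs) => //; rewrite ?srs.
- have sZ c (f : {poly C}) : (size f <= n.+1)%N -> (size (c *: f) <= n.+1)%N.
    by move=> sf; rewrite (leq_trans (size_scale_leq _ _)).
  have sD (f g : {poly C}) : (size f <= n.+1)%N -> (size g <= n.+1)%N -> (size (f + g)%R <= n.+1)%N.
    by move=> sf sg; rewrite (leq_trans (size_polyD _ _)) // geq_max sf.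
  apply: sesquiD; last first.
    have [a b] := @sesqui_rank1 _ n.+1 (la^* *: Q) Q sQ; split=> [z'|w'].
      by have [h sh e] := a z'; exists h => // w'; rewrite mulrA -hornerZ e.
    by have [h e] := b w'; exists h => z'; rewrite mulrA -hornerZ e.
  apply: sesquiD; last first.
    apply/sesquiN/sesqui_szego/sesqui_sum => r; exact: sesqui_rank1.
  apply: sesquiD; first by apply: sesqui_rank1; rewrite PE sD // sZ.
  by apply/sesquiN/sesqui_rank1; rewrite q0E q1E sD ?sZ ?size_recip.
- move=> {}z {}w zw; rewrite /k zw subrr mul0r subr0 PE -(QQ zw) !hornE !conjE.
  rewrite (q1z zw) (q0w zw) (q1w zw).
  have zn := zwn zw.
  set a1 := p1.[z]; set a2 := p2.[z]; set b1 := (p1.[w])^*; set b2 := (p2.[w])^*.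
  transitivity ((1 - z ^+ n * w^* ^+ n) * (a2 * b1 + la^* * a1 * b1)).
    by ring.
  by rewrite zn subrr mul0r.
- move=> {}z r rr; rewrite /k mulr_sumr.
  have -> : \sum_(t <- rs) (1 - z * r^*) * ((Y t).[z] * ((X t).[r])^*) =
     \sum_(t <- rs) ((1 - z * r^*) * (s t)^* * (Y t).[z]) * ((U t).[r])^*.
    by apply: eq_bigr => t _; rewrite !XE !hornerZ conjM; ring.
  rewrite sumU //.
  transitivity (p2.[z] * (P.[r])^* - q1.[z] * ((q0 + la *: q1).[r])^* - ((s r)^* * (W^`().[r])^*) * ((1 - z * r^*) * (Y r).[z]) + la^* * (Q.[z] * (Q.[r])^*)); first by ring.
  rewrite (szego_root z rr (YE rr)).
  have -> : (q0 + la *: q1).[r] = al * P.[r] by rewrite PE !hornE Wroot.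
  have rr1 := unit_mulconj (rs1 rr); have alal := unit_mulconj al1.
  rewrite !hornerD !hornerN !hornerZ conjM.
  transitivity ((P.[r])^* * (p2.[z] - al^* * q1.[z]) + r^* * A.[z] * (s r * (s r)^* * (W^`().[r])^*) - r^* * Q.[z] * (x r * (s r)^* * (W^`().[r])^*) + la^* * (Q.[z] * (Q.[r])^*)); first by ring.
  rewrite sE' // xW // AE !hornE.
  transitivity ((P.[r])^* * (p2.[z] - al^* * q1.[z] + (r * r^*) * (al^* * q1.[z] - (al * al^*) * p2.[z])) + (1 - r * r^*) * la^* * (Q.[z] * (Q.[r])^*)); first by ring.
  by rewrite rr1 alal; ring.
Qed.

(** Auxiliary to [D11]. As p~ - al p = z2 A - B and W = la A - B, the same points serve for the pair
    A, B, with weights |x r|^2. *)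
Let DB z w : B.[z] * (B.[w])^* - A.[z] * (A.[w])^*
  - (1 - z * w^*) * (\sum_(r <- rs) (x r * (x r)^*) * ((U r).[z] * ((U r).[w])^*)) = 0.
Proof.
pose k z w := B.[z] * (B.[w])^* - A.[z] * (A.[w])^*
  - (1 - z * w^*) * (\sum_(r <- rs) (x r * (x r)^*) * ((U r).[z] * ((U r).[w])^*)).
apply: (@sesqui_zero _ k rs) => //; rewrite ?srs.
- have sZ c (f : {poly C}) : (size f <= n.+1)%N -> (size (c *: f) <= n.+1)%N.
    by move=> sf; rewrite (leq_trans (size_scale_leq _ _)).
  have sD (f g : {poly C}) : (size f <= n.+1)%N -> (size g <= n.+1)%N -> (size (f - g)%R <= n.+1)%N.
    by move=> sf sg; rewrite (leq_trans (size_polyD _ _)) // geq_max sf size_polyN.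
  apply: sesquiD; last first.
    apply/sesquiN/sesqui_szego/sesqui_sum => r.
    have [a b] := @sesqui_rank1 _ n (x r * (x r)^* *: U r) (U r) (sU r); split=> [z'|w'].
      by have [h sh e] := a z'; exists h => // w'; rewrite mulrA -hornerZ e.
    by have [h e] := b w'; exists h => z'; rewrite mulrA -hornerZ e.
  apply: sesquiD; first by apply: sesqui_rank1; rewrite BE q0E sD ?sZ ?size_recip.
  by apply/sesquiN/sesqui_rank1; rewrite AE q1E sD ?sZ ?size_recip.
- move=> {}z {}w zw; rewrite /k zw subrr mul0r subr0 AE BE !hornE !conjE.
  rewrite (q0z zw) (q1z zw) (q0w zw) (q1w zw).
  have zn := zwn zw; have alal := unit_mulconj al1.
  set a1 := p1.[z]; set a2 := p2.[z]; set b1 := (p1.[w])^*; set b2 := (p2.[w])^*.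
  transitivity ((al * al^* - z ^+ n * w^* ^+ n) * (a1 * b1 - a2 * b2)).
    by ring.
  by rewrite zn alal subrr mul0r.
- move=> {}z r rr; rewrite /k mulr_sumr.
  have -> : \sum_(t <- rs) (1 - z * r^*) * ((x t * (x t)^*) * ((U t).[z] * ((U t).[r])^*)) =
     \sum_(t <- rs) ((1 - z * r^*) * (x t * (x t)^*) * (U t).[z]) * ((U t).[r])^*.
    by apply: eq_bigr => t _; ring.
  rewrite sumU //.
  transitivity (B.[z] * (B.[r])^* - A.[z] * (A.[r])^* - ((x r * (x r)^*) * (W^`().[r])^*) * ((1 - z * r^*) * (U r).[z])); first by ring.
  rewrite (szego_root z rr (WU rr)).
  transitivity (B.[z] * (B.[r])^* - A.[z] * (A.[r])^* + (r^* * (x r * (x r)^*) * (W^`().[r])^*) * W.[z]); first by ring.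
  rewrite xxW // (BAr rr) conjM.
  have -> : W.[z] = la * A.[z] - B.[z] by rewrite WE PE AE BE !hornE; ring.
  have lala := unit_mulconj la1.
  transitivity ((la * la^* - 1) * (A.[z] * (A.[r])^*)); first by ring.
  by rewrite lala subrr mul0r.
Qed.

(** Here the sum does not collapse at w = r, because Y t need not vanish at the other Clark points.
    After multiplication by W(z) conj(W(w)), the relation W Y = A X - x Q U reduces the claim to
    [D00], [D10], its conjugate and [DB]; the nonzero polynomial W is then cancelled in each
    variable. *)
Let D11 z w : p2.[z] * (p2.[w])^* - q1.[z] * (q1.[w])^*
  - (1 - z * w^*) * (\sum_(r <- rs) (Y r).[z] * ((Y r).[w])^*)
  + Q.[z] * (Q.[w])^* = 0.
Proof.
pose k z w := p2.[z] * (p2.[w])^* - q1.[z] * (q1.[w])^*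
  - (1 - z * w^*) * (\sum_(r <- rs) (Y r).[z] * ((Y r).[w])^*)
  + Q.[z] * (Q.[w])^*.
have kS : sesqui n.+1 k.
  apply: sesquiD; last exact: sesqui_rank1.
  apply: sesquiD; last first.
    apply/sesquiN/sesqui_szego/sesqui_sum => r; exact: sesqui_rank1.
  apply: sesquiD; first exact: sesqui_rank1.
  by apply/sesquiN/sesqui_rank1; rewrite q1E size_recip.
have W0 : W != 0.
  have : (0 < size rs)%N by rewrite srs.
  case E : rs => [//|r rs'] _; apply/eqP => W0.
  by have := @W'r r; rewrite E mem_head W0 deriv0 horner0 eqxx => /(_ isT).
suff WWk z' w' : W.[z'] * (W.[w'])^* * k z' w' = 0.
  have [a b] := kS.
  have k1 w' z' : W.[w'] != 0 -> k z' w' = 0.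
    move=> Ww; have [h e] := b w'; rewrite e.
    suff -> : h = 0 by rewrite horner0.
    have /eqP : W * h = 0.
      apply: poly_zero => y; rewrite hornerM -e.
      have := WWk y w'; rewrite mulrAC => /eqP; rewrite mulf_eq0 conjC_eq0 (negPf Ww) orbF.
      by move/eqP.
    by rewrite mulf_eq0 (negPf W0) => /eqP.
  have [g _ e] := a z; rewrite -/(k z w) e.
  suff -> : g = 0 by rewrite horner0 conj0.
  have /eqP : W * g = 0.
    apply: poly_zero => y; rewrite hornerM.
    have [->|/(k1 _ z)] := eqVneq W.[y] 0; first by rewrite mul0r.
    by rewrite e => /eqP; rewrite conjC_eq0 => /eqP ->; rewrite mulr0.
  by rewrite mulf_eq0 (negPf W0) => /eqP.
move=> {z w}; move: z' w' => z w.
have XY r : r \in rs -> A * X r - W * Y r = x r *: (Q * U r).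
  move=> rr; apply: (mulfI (negbT (polyXsubC_eq0 r))).
  transitivity (s r *: A * (('X - r%:P) * U r) - W * (('X - r%:P) * Y r)).
    by rewrite XE -!mul_polyC; ring.
  rewrite YE // WU //.
  transitivity ((x r)%:P * Q * (('X - r%:P) * U r)); last by rewrite -mul_polyC; ring.
  by rewrite WU // -!mul_polyC; ring.
have SS : (Q.[z] * (Q.[w])^*) * (\sum_(r <- rs) (x r * (x r)^*) * ((U r).[z] * ((U r).[w])^*)) =
   A.[z] * (A.[w])^* * (\sum_(r <- rs) (X r).[z] * ((X r).[w])^*)
   - W.[z] * (A.[w])^* * (\sum_(r <- rs) (Y r).[z] * ((X r).[w])^*)
   - A.[z] * (W.[w])^* * (\sum_(r <- rs) (Y r).[w] * ((X r).[z])^*)^*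
   + W.[z] * (W.[w])^* * (\sum_(r <- rs) (Y r).[z] * ((Y r).[w])^*).
  rewrite conj_sum !mulr_sumr -!sumrB -big_split /=; apply: eq_big_seq => r rr.
  have ez := congr1 (fun f : {poly C} => f.[z]) (XY r rr).
  have ew := congr1 (fun f : {poly C} => (f.[w])^*) (XY r rr).
  rewrite !hornE in ez; rewrite !hornE !conjE in ew.
  transitivity ((x r * (Q.[z] * (U r).[z])) * ((x r)^* * ((Q.[w])^* * ((U r).[w])^*))).
    by ring.
  by rewrite -ez -ew !conjE; ring.
have d00 := D00 z w; have d10 := D10 z w; have d01 := congr1 Num.conj (D10 w z).
have dB := DB z w; rewrite !conjE in d01.
move: SS d00 d10 d01 dB.
set S1 := \sum_(r <- rs) x r * (x r)^* * _; set S2 := \sum_(r <- rs) (X r).[z] * _.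
set S3 := \sum_(r <- rs) (Y r).[z] * ((X r).[w])^*.
set S4 := (\sum_(r <- rs) (Y r).[w] * ((X r).[z])^*)^*.
rewrite /k; set S5 := \sum_(r <- rs) (Y r).[z] * ((Y r).[w])^*.
move=> SS d00 d10 d01 dB.
have [lala alal] := (unit_mulconj la1, unit_mulconj al1).
pose Pt := q0 + la *: q1.
(* The combinations built from p~ and from p differ by the unimodular factor al, so their Hermitian
   squares cancel below. *)
have APW y : A.[y] * Pt.[y] - W.[y] * q1.[y] = al * (A.[y] * P.[y] - W.[y] * p2.[y]).
  by rewrite /Pt WE PE AE !hornE; ring.
have WAB y : W.[y] = la * A.[y] - B.[y] by rewrite WE PE AE BE !hornE; ring.
have c1 := APW z; have c2 := congr1 Num.conj (APW w); rewrite !conjE in c2.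
have WAz := WAB z; have WAw := congr1 Num.conj (WAB w); rewrite !conjE in WAw.
rewrite -/Pt in d00 d10 d01.
move: c1 c2 d00 d10 d01 dB SS WAz WAw.
set a := A.[z]; set b := (A.[w])^*; set Wz := W.[z]; set Ww := (W.[w])^*.
set Bz := B.[z]; set Bw := (B.[w])^*; set Qz := Q.[z]; set Qw := (Q.[w])^*.
set Ptz := Pt.[z]; set Ptw := (Pt.[w])^*; set u := z * w^*.
set Pz := P.[z]; set Pw := (P.[w])^*; set p2z := p2.[z]; set p2w := (p2.[w])^*.
set q1z' := q1.[z]; set q1w' := (q1.[w])^*.
move=> c1 c2 d00 d10 d01 dB SS WAz WAw.
rewrite [w^* * z]mulrC -/u in d01.
(* The weights a b, - Wz b, - a Ww, Wz Ww are those with which S2, ..., S5 enter [SS]. *)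
transitivity (a * b * (Pz * Pw - Ptz * Ptw - (1 - u) * S2)
  - Wz * b * (p2z * Pw - q1z' * Ptw - (1 - u) * S3 + la^* * (Qz * Qw))
  - a * Ww * (p2w * Pz - q1w' * Ptz - (1 - u) * S4 + la * (Qw * Qz))
  + Wz * Ww * (p2z * p2w - q1z' * q1w' - (1 - u) * S5 + Qz * Qw)).
  by rewrite d00 d10 d01; ring.
transitivity ((a * Pz - Wz * p2z) * (b * Pw - Ww * p2w) -
   (a * Ptz - Wz * q1z') * (b * Ptw - Ww * q1w')
   - (1 - u) * (a * b * S2 - Wz * b * S3 - a * Ww * S4 + Wz * Ww * S5)
   + (Wz * Ww - la^* * Wz * b - la * a * Ww) * (Qz * Qw)); first by ring.
rewrite c1 c2 -SS WAz WAw.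
transitivity ((1 - al * al^*) * ((a * Pz - (la * a - Bz) * p2z) * (b * Pw - (la^* * b - Bw) * p2w))
  + Qz * Qw * (Bz * Bw - la * la^* * (a * b) - (1 - u) * S1)); first by ring.
by rewrite alal lala subrr mul0r add0r mul1r dB mulr0.
Qed.

(** Both sides are polynomials of degree one in u = z2 - la and in v = conj(w2 - la), and 1 - z2
    conj(w2) = - conj(la) u - la v - u v; the four coefficients are the identities above. *)
Lemma clark_agler_identity z1 z2 w1 w2 :
    (p1.[z1] + z2 * p2.[z1]) * (p1.[w1] + w2 * p2.[w1])^*
    - (q0.[z1] + z2 * q1.[z1]) * (q0.[w1] + w2 * q1.[w1])^* =
    (1 - z1 * w1^*) * (\sum_(r <- rs) ((X r).[z1] + (z2 - la) * (Y r).[z1])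
        * ((X r).[w1] + (w2 - la) * (Y r).[w1])^*)
    + (1 - z2 * w2^*) * (Q.[z1] * (Q.[w1])^*).
Proof.
have d00 := D00 z1 w1; have d10 := D10 z1 w1; have d01 := congr1 Num.conj (D10 w1 z1).
have d11 := D11 z1 w1; rewrite !conjE in d01.
have -> : \sum_(r <- rs) ((X r).[z1] + (z2 - la) * (Y r).[z1])
        * ((X r).[w1] + (w2 - la) * (Y r).[w1])^* =
   (\sum_(r <- rs) (X r).[z1] * ((X r).[w1])^*)
   + (z2 - la) * (\sum_(r <- rs) (Y r).[z1] * ((X r).[w1])^*)
   + (w2 - la)^* * (\sum_(r <- rs) (Y r).[w1] * ((X r).[z1])^*)^*
   + (z2 - la) * (w2 - la)^* * (\sum_(r <- rs) (Y r).[z1] * ((Y r).[w1])^*).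
  rewrite conj_sum !mulr_sumr -!big_split /=; apply: eq_bigr => r _.
  by rewrite !conjE; ring.
move: d00 d10 d01 d11.
set S2 := \sum_(r <- rs) (X r).[z1] * _.
set S3 := \sum_(r <- rs) (Y r).[z1] * ((X r).[w1])^*.
set S4 := (\sum_(r <- rs) (Y r).[w1] * ((X r).[z1])^*)^*.
set S5 := \sum_(r <- rs) (Y r).[z1] * ((Y r).[w1])^*.
rewrite PE !hornE !conjE => d00 d10 d01 d11.
have lala := unit_mulconj la1.
apply/eqP; rewrite -subr_eq0; apply/eqP.
set u := z2 - la; set v := w2^* - la^*.
have z2E : z2 = la + u by rewrite /u; ring.
have w2E : w2^* = la^* + v by rewrite /v; ring.
transitivity (
  (p1.[z1] + la * p2.[z1]) * ((p1.[w1])^* + la^* * (p2.[w1])^*) -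
     (q0.[z1] + la * q1.[z1]) * ((q0.[w1])^* + la^* * (q1.[w1])^*) - (1 - z1 * w1^*) * S2
  + u * (p2.[z1] * ((p1.[w1])^* + la^* * (p2.[w1])^*) -
      q1.[z1] * ((q0.[w1])^* + la^* * (q1.[w1])^*) - (1 - z1 * w1^*) * S3
      + la^* * (Q.[z1] * (Q.[w1])^*))
  + v * ((p2.[w1])^* * (p1.[z1] + la * p2.[z1]) -
      (q1.[w1])^* * (q0.[z1] + la * q1.[z1]) - (1 - w1^* * z1) * S4
      + la * ((Q.[w1])^* * Q.[z1]))
  + u * v * (p2.[z1] * (p2.[w1])^* - q1.[z1] * (q1.[w1])^* - (1 - z1 * w1^*) * S5
      + Q.[z1] * (Q.[w1])^*)
  - (1 - la * la^*) * (Q.[z1] * (Q.[w1])^*)).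
  by rewrite !z2E !w2E; ring.
by rewrite d00 d10 d01 d11 lala; ring.
Qed.

End Identity.

Let sW : (size W <= n.+1)%N.
Proof.
rewrite WE PE q0E q1E.
have sZ c (f : {poly C}) : (size f <= n.+1)%N -> (size (c *: f) <= n.+1)%N.
  by move=> sf; rewrite (leq_trans (size_scale_leq _ _)).
have sD (f g : {poly C}) : (size f <= n.+1)%N -> (size g <= n.+1)%N -> (size (f + g)%R <= n.+1)%N.
  by move=> sf sg; rewrite (leq_trans (size_polyD _ _)) // geq_max sf.
by rewrite sD ?size_polyN ?sZ // ?sD ?sZ // ?size_recip.
Qed.

Lemma clark_agler : exists (X Y : C -> {poly C}) (x : C -> C),
  (forall r, (size (X r) <= n)%N /\ (size (Y r) <= n)%N) /\
  (forall r, r \in rs -> [/\ ('X - r%:P) * X r = s r *: W,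
     ('X - r%:P) * Y r = s r *: A - x r *: Q & A.[r] = 0 -> Q.[r] = 0 /\ x r = 0]) /\
  (forall z1 z2 w1 w2,
    (p1.[z1] + z2 * p2.[z1]) * (p1.[w1] + w2 * p2.[w1])^*
    - (q0.[z1] + z2 * q1.[z1]) * (q0.[w1] + w2 * q1.[w1])^* =
    (1 - z1 * w1^*) * (\sum_(r <- rs) ((X r).[z1] + (z2 - la) * (Y r).[z1])
        * ((X r).[w1] + (w2 - la) * (Y r).[w1])^*)
    + (1 - z2 * w2^*) * (Q.[z1] * (Q.[w1])^*)).
Proof.
(* Reading [D10] at w = r forces (z - r) Y r = s A - x Q with exactly this coefficient of Q. *)
pose x r := la^* * r * (Q.[r])^* / ((s r)^* * (W^`().[r])^*).
have xW r : r \in rs -> x r * (s r)^* * (W^`().[r])^* = la^* * r * (Q.[r])^*.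
  move=> rr; rewrite /x; field.
  by rewrite !conjC_eq0 (s0 rr) (W'r rr).
pose U r : {poly C} := W %/ ('X - r%:P).
pose Y r : {poly C} := (s r *: A - x r *: Q) %/ ('X - r%:P).
have WU r : r \in rs -> ('X - r%:P) * U r = W.
  by move=> rr; rewrite mulrC divpK // dvdp_XsubCl; exact: Wrs.
have YE r : r \in rs -> ('X - r%:P) * Y r = s r *: A - x r *: Q.
  move=> rr; rewrite mulrC divpK // dvdp_XsubCl; apply/rootP.
  by rewrite !hornE (clark_factor_root xW) // subrr.
have sU r : (size (U r) <= n)%N.
  rewrite /U size_divp ?polyXsubC_eq0 // size_XsubC /=.
  by rewrite leq_subLR add1n.
have sY r : (size (Y r) <= n)%N.
  rewrite /Y size_divp ?polyXsubC_eq0 // size_XsubC /= leq_subLR add1n.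
  rewrite (leq_trans (size_polyD _ _)) // geq_max size_polyN.
  rewrite !(leq_trans (size_scale_leq _ _)) // AE.
  rewrite (leq_trans (size_polyD _ _)) // geq_max size_polyN q1E size_recip.
  by rewrite (leq_trans (size_scale_leq _ _)).
exists (fun r => s r *: U r), Y, x; split=> [r|].
  by rewrite (leq_trans (size_scale_leq _ _)).
split=> [r rr|z1 z2 w1 w2].
  split; [by rewrite -scalerAr WU | exact: YE | move=> Ar].
  have Br : B.[r] = 0 by rewrite BAr // Ar mulr0.
  have := BPr rr; rewrite Br mul0r => /esym/eqP.
  rewrite !mulf_eq0 conjC_eq0 orbb (negPf (unit_neq0 al1)) /= => /eqP Qr.
  by rewrite /x Qr conj0 mulr0 mul0r.
exact: (@clark_agler_identity x xW U (fun r => s r *: U r) Y WU YE (fun r => erefl) sU sY).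
Qed.

End ClarkAgler.

(** * Polynomials without zeros in the bidisk *)

Section ZeroFree.
Local Open Scope ring_scope.
Variable C : numClosedFieldType.
Implicit Types (f g P : {poly C}) (z w a : C).

Lemma poly_zero_disk f : (forall z, `|z| < 1 -> f.[z] = 0) -> f = 0.
Proof.
move=> f0.
apply: (@roots_geq_poly_eq0 _ _ [seq (k.+2)%:R^-1 | k <- iota 0 (size f)]).
- apply/allP => z /mapP[k _ ->]; apply/rootP/f0.
  by rewrite ger0_norm ?invr_ge0 ?ler0n // invf_lt1 ?ltr0n // ltr1n.
- rewrite map_inj_uniq ?iota_uniq // => i j /invr_inj /eqP.
  by rewrite eqr_nat => /eqP[].
- by rewrite size_map size_iota.
Qed.

(* A Harnack-type inequality, read off the factorisation of P: each root a has
   |a| >= 1. *)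
Lemma zero_free_harnack n P z w : (size P <= n.+1)%N ->
  (forall y, `|y| < 1 -> P.[y] != 0) -> `|z| < 1 -> `|w| < 1 ->
  `|P.[w]| * (1 - `|z|) ^+ n <= 2%:R ^+ n * `|P.[z]|.
Proof.
move=> sP P0 z1 w1.
have [rs PE] := closed_field_poly_normal P.
have Pn0 : P != 0.
  by apply/eqP => PE0; have := P0 0; rewrite normr0 ltr01 PE0 horner0 eqxx => /(_ isT).
have lP : lead_coef P != 0 by rewrite lead_coef_eq0.
have srs : (size rs <= n)%N.
  by move: sP; rewrite PE size_scale // size_prod_XsubC.
have z10 : 0 <= 1 - `|z| by rewrite subr_ge0 ltW.
have rs1 a : a \in rs -> 1 <= `|a|.
  move=> ars; rewrite real_leNgt ?real1 ?normr_real //; apply/negP => /P0.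
  rewrite PE hornerZ mulf_eq0 (negPf lP) /=.
  have /rootP -> : root (\prod_(x <- rs) ('X - x%:P)) a by rewrite root_prod_XsubC.
  by rewrite eqxx.
have main : `|(\prod_(a <- rs) ('X - a%:P)).[w]| * (1 - `|z|) ^+ size rs <=
            2%:R ^+ size rs * `|(\prod_(a <- rs) ('X - a%:P)).[z]|.
  elim: (rs) rs1 => [|a s IH] sa; first by rewrite big_nil !hornE mulrC.
  rewrite !big_cons !hornE !normrM /= !exprS.
  have {}IH := IH (fun b bs => sa b (mem_behead (s := a :: s) bs)).
  have a1 := sa a (mem_head _ _).
  (* As |a| >= 1, |w - a| <= 2 |a| and |z - a| >= |a| - |z| >= |a| (1 - |z|). *)
  have h : `|w - a| * (1 - `|z|) <= 2%:R * `|z - a|.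
    have h1 : `|w - a| <= 2%:R * `|a|.
      apply: le_trans (ler_normB _ _) _; rewrite mulr2n mulrDl mul1r lerD2r.
      exact: le_trans (ltW w1) a1.
    have h2 : `|a| - `|z| <= `|z - a| by rewrite distrC lerB_dist.
    apply: (@le_trans _ _ (2%:R * `|a| * (1 - `|z|))); first exact: ler_wpM2r.
    rewrite -mulrA ler_pM2l ?ltr0n //; apply: le_trans h2.
    by rewrite mulrBr mulr1 lerD2l lerN2 ler_peMl.
  rewrite mulrACA [X in _ <= X](_ : _ = (2%:R * `|z - a|) *
    (2%:R ^+ size s * `|(\prod_(j <- s) ('X - j%:P)).[z]|)); last by ring.
  by apply: ler_pM => //; rewrite mulr_ge0 // exprn_ge0.
rewrite PE !hornerZ !normrM -mulrA [X in _ <= X]mulrCA ler_pM2l ?normr_gt0 //.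
have e1 : (1 - `|z|) ^+ n <= (1 - `|z|) ^+ size rs.
  by apply: ler_wiXn2l => //; rewrite gerBl.
have e2 : (2%:R : C) ^+ size rs <= 2%:R ^+ n by apply: ler_weXn2l => //; rewrite ler1n.
apply: (@le_trans _ _ (`|(\prod_(a <- rs) ('X - a%:P)).[w]| * (1 - `|z|) ^+ size rs)).
  exact: ler_wpM2l.
by apply: le_trans main _; apply: ler_wpM2r.
Qed.

Variables (n : nat) (p1 p2 : {poly C}).
Hypotheses (sp1 : (size p1 <= n.+1)%N) (sp2 : (size p2 <= n.+1)%N).
Hypothesis p0 : forall z1 z2, `|z1| < 1 -> `|z2| < 1 -> p1.[z1] + z2 * p2.[z1] != 0.

Lemma size_slice a : (size (p1 + a *: p2)%R <= n.+1)%N.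
Proof.
rewrite (leq_trans (size_polyD _ _)) // geq_max sp1.
by rewrite (leq_trans (size_scale_leq _ _)).
Qed.

(** A Hurwitz argument: the slices at r la, r < 1, have no zero in the disk and satisfy a Harnack
    inequality uniform in r. In the limit a single zero in the disk would make the slice vanish
    identically, against its values on the circle. *)
Lemma slice_zero_free la : `|la| = 1 ->
  (forall z, `|z| = 1 -> p1.[z] + la * p2.[z] != 0) ->
  forall z, `|z| <= 1 -> (p1 + la *: p2).[z] != 0.
Proof.
move=> la1 pT z; rewrite le_eqVlt => /orP[/eqP z1|z1]; first by rewrite !hornE pT.
apply/negP => /eqP Pz.
suff P0 : p1 + la *: p2 = 0.
  by have := pT 1 (normr1 _); rewrite -hornerZ -hornerD P0 horner0 eqxx.
apply: poly_zero_disk => w w1.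
pose f v c : {poly C} := c *: (p1.[v]%:P + p2.[v] *: 'X).
have fE v c x : (f v c).[x] = c * (p1.[v] + x * p2.[v]) by rewrite /f !hornE (mulrC x).
have z10 : 0 < 1 - `|z| by rewrite subr_gt0.
have : `|(f w ((1 - `|z|) ^+ n)).[la]| <= `|(f z (2%:R ^+ n)).[la]|.
  apply: (@radial_le _ _ _ _ 1) => // r; rewrite subrr => r0 r1.
  have rla : `|r * la| < 1 by rewrite normrM la1 mulr1 gtr0_norm.
  have := @zero_free_harnack n (p1 + (r * la) *: p2) z w (size_slice _).
  rewrite !fE !hornE !normrM !normrX (ger0_norm (ltW z10)) normr_nat => h.
  rewrite mulrC; apply: h => // y y1.
  by rewrite !hornE; exact: p0.
rewrite !fE -!hornerZ -!hornerD Pz mulr0 normr0 normr_le0 mulf_eq0.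
by rewrite expf_eq0 gt_eqF //= andbF /= => /eqP.
Qed.

Lemma first_coef_neq0 z : `|z| < 1 -> p1.[z] != 0.
Proof. by move=> z1; have := p0 z1; move=> /(_ 0); rewrite normr0 mul0r addr0; apply. Qed.

Lemma coef_domination_disk z : `|z| < 1 -> `|p2.[z]| <= `|p1.[z]|.
Proof.
move=> z1; rewrite real_leNgt ?normr_real //; apply/negP => lt.
have p2n0 : p2.[z] != 0 by rewrite -normr_gt0 (le_lt_trans (normr_ge0 _) lt).
have := p0 z1; move=> /(_ (- p1.[z] / p2.[z])).
rewrite normrM normrN normfV ltr_pdivrMr ?normr_gt0 // mul1r => /(_ lt).
by rewrite divfK // subrr eqxx.
Qed.

Lemma coef_domination z : `|z| = 1 -> `|p2.[z]| <= `|p1.[z]|.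
Proof.
move=> z1; apply: (@radial_le _ _ _ _ 1) => // r; rewrite subrr => r0 r1.
by apply: coef_domination_disk; rewrite normrM z1 mulr1 gtr0_norm.
Qed.

Lemma spectral_factor : exists2 Q : {poly C}, (size Q <= n.+1)%N &
  p1 * recip n p1 - p2 * recip n p2 = Q * recip n Q.
Proof.
apply: (@fejer_riesz _ n _ [::]).
  rewrite (leq_trans (size_polyD _ _)) // geq_max size_polyN -addnn.
  by rewrite !leq_size_polyM // size_recip.
move=> z z1 _; rewrite hornerD hornerN !hornerM.
rewrite (horner_recip sp1 (unit_mulconj z1)) (horner_recip sp2 (unit_mulconj z1)).
have zz : z^* ^+ n * z ^+ n = 1 by rewrite -exprMn mulrC unit_mulconj // expr1n.
rewrite [X in 0 <= X](_ : _ = (z^* ^+ n * z ^+ n) * (p1.[z] * (p1.[z])^* - p2.[z] * (p2.[z])^*)); last by ring.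
rewrite zz mul1r -!normCK subr_ge0 lerXn2r ?nnegrE //.
exact: coef_domination.
Qed.

End ZeroFree.

(** * Exceptional values and angular derivatives *)

Section Passes.
Local Open Scope ring_scope.
Variable C : numClosedFieldType.
Implicit Types (z w r tau : C).
Variables (n : nat) (p1 p2 : {poly C}) (al la : C).
Hypothesis n0 : (0 < n)%N.
Hypotheses (sp1 : (size p1 <= n.+1)%N) (sp2 : (size p2 <= n.+1)%N).
Hypothesis p0 : forall z1 z2, `|z1| < 1 -> `|z2| < 1 -> p1.[z1] + z2 * p2.[z1] != 0.
Hypotheses (al1 : `|al| = 1) (la1 : `|la| = 1).
Hypothesis pT : forall z, `|z| = 1 -> p1.[z] + la * p2.[z] != 0.
Variables (q0 q1 P W A B : {poly C}).
Hypotheses (q0E : q0 = recip n p2) (q1E : q1 = recip n p1).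
Hypotheses (PE : P = p1 + la *: p2) (WE : W = q0 + la *: q1 - al *: P).
Hypotheses (AE : A = q1 - al *: p2) (BE : B = al *: p1 - q0).

Let PD z : `|z| <= 1 -> P.[z] != 0.
Proof. by rewrite PE; exact: (slice_zero_free sp1 sp2 p0). Qed.

(** The reflection of P is q1 + conj(la) q0, so the slice of p~ is la recip P, and W is the Clark
    polynomial of P with beta = al conj(la). *)
Let WE' : W = la *: (recip n P - (al * la^*) *: P).
Proof.
have lala : la%:P * (la^*)%:P = 1 :> {poly C} by rewrite -polyCM unit_mulconj.
rewrite WE PE recipD recipZ -q0E -q1E -!mul_polyC polyCM.
transitivity (la%:P * (la^*)%:P * q0 + la%:P * q1 -
  al%:P * (la%:P * (la^*)%:P) * (p1 + la%:P * p2)); last by ring.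
by rewrite lala; ring.
Qed.

Lemma clark_data : exists rs : seq C,
  [/\ uniq rs, size rs = n, (forall z, root W z = (z \in rs)) &
  forall r, r \in rs -> `|r| = 1 /\ 0 < W^`().[r] * (P.[r])^* * al^* * r].
Proof.
have sP : (size P <= n.+1)%N by rewrite PE size_slice.
have b1 : `|al * la^*| = 1 by rewrite unit_mul_unit // norm_conjC.
have la0 := unit_neq0 la1.
have [rs [urs srs Wc]] := clark_roots n0 sP PD b1.
set Wc' := recip n P - _ in Wc.
have Wc0 : lead_coef Wc' != 0.
  apply/eqP => l0; rewrite l0 scale0r in Wc.
  have : root Wc' 0 by rewrite Wc root0.
  by move/(clark_root_unit n0 sP PD b1)/eqP; rewrite normr0 eq_sym oner_eq0.
have rE z : root W z = (z \in rs).
  by rewrite WE' rootZ // -/Wc' Wc rootZ // root_prod_XsubC.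
exists rs; split=> // r rr.
have rW : root Wc' r by rewrite Wc rootZ // root_prod_XsubC.
split; first exact: (clark_root_unit n0 sP PD b1).
have := clark_root_positive n0 sP PD b1 rW; rewrite -/Wc' WE' -/Wc' derivZ hornerZ.
by rewrite conjM conjCK !mulrA -[la * _ * _ * _ * _]mulrA; congr (0 < _); ring.
Qed.

Section Decomposition.
Variables (rs : seq C) (s x : C -> C) (X Y : C -> {poly C}) (Q : {poly C}).
Hypothesis urs : uniq rs.
Hypothesis rsW : forall z, root W z = (z \in rs).
Hypothesis rs1 : forall r, r \in rs -> `|r| = 1.
Hypothesis XYE : forall r, r \in rs -> [/\ ('X - r%:P) * X r = s r *: W,
     ('X - r%:P) * Y r = s r *: A - x r *: Q & A.[r] = 0 -> Q.[r] = 0 /\ x r = 0].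
Hypothesis identity : forall z1 z2 w1 w2,
    (p1.[z1] + z2 * p2.[z1]) * (p1.[w1] + w2 * p2.[w1])^*
    - (q0.[z1] + z2 * q1.[z1]) * (q0.[w1] + w2 * q1.[w1])^* =
    (1 - z1 * w1^*) * (\sum_(r <- rs) ((X r).[z1] + (z2 - la) * (Y r).[z1])
        * ((X r).[w1] + (w2 - la) * (Y r).[w1])^*)
    + (1 - z2 * w2^*) * (Q.[z1] * (Q.[w1])^*).

(** At such a point x = 0, so Q drops out and the term is s (p~ - al p) / (z1 - tau). *)
Lemma exceptional_factor tau z1 z2 : tau \in rs -> A.[tau] = 0 ->
  (z1 - tau) * ((X tau).[z1] + (z2 - la) * (Y tau).[z1]) =
  s tau * (q0.[z1] + z2 * q1.[z1] - al * (p1.[z1] + z2 * p2.[z1])).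
Proof.
move=> tr At; have [XW YA /(_ At) [_ x0]] := XYE tr.
have e1 := congr1 (fun f : {poly C} => f.[z1]) XW.
have e2 := congr1 (fun f : {poly C} => f.[z1]) YA.
rewrite x0 scale0r subr0 in e2; rewrite WE PE AE !hornE in e1 e2.
transitivity ((z1 - tau) * (X tau).[z1] + (z2 - la) * ((z1 - tau) * (Y tau).[z1])); first by ring.
by rewrite e1 e2; ring.
Qed.

Lemma W_neq0_point : exists w, W.[w] != 0.
Proof.
have [w w1] := circle_infinite rs; rewrite -rsW /root; by exists w.
Qed.

(** The identity is read at z = (tau, z2) and w = (w1, la). Since A, Q and W vanish at tau, only the
    term of tau survives; cancelling conj(W(w1)) leaves its value on the line over tau. *)
Lemma exceptional_boundary tau z2 : tau \in rs -> A.[tau] = 0 -> B.[tau] = 0 ->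
  al * (p1.[tau] + z2 * p2.[tau]) =
  tau * (s tau)^* * ((X tau).[tau] + (z2 - la) * (Y tau).[tau]).
Proof.
move=> tr At Bt; have [w1 Ww] := W_neq0_point.
have t1 := unit_mulconj (rs1 tr); have alal := unit_mulconj al1.
have [XW YA /(_ At) [Q0 x0]] := XYE tr.
have := identity tau z2 w1 la.
rewrite Q0 mul0r mulr0 addr0.
rewrite (bigD1_seq tau) //= big1_seq ?addr0; last first.
  move=> r /andP[rt rr]; have [XWr YAr _] := XYE rr.
  have rt' : tau - r != 0 by rewrite subr_eq0 eq_sym.
  have e1 := congr1 (fun f : {poly C} => f.[tau]) XWr.
  have e2 := congr1 (fun f : {poly C} => f.[tau]) YAr.
  have W0 : W.[tau] = 0 by apply/rootP; rewrite rsW.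
  rewrite !hornE ?At ?Q0 ?W0 !mulr0 ?subr0 in e1 e2.
  move/eqP: e1; rewrite mulf_eq0 (negPf rt') /= => /eqP ->.
  move/eqP: e2; rewrite mulf_eq0 (negPf rt') /= => /eqP ->.
  by rewrite mulr0 addr0 mul0r.
have ew := exceptional_factor w1 la tr At.
rewrite subrr mul0r addr0 in ew.
have qt : q0.[tau] + z2 * q1.[tau] = al * (p1.[tau] + z2 * p2.[tau]).
  move: At Bt; rewrite AE BE !hornE => /eqP; rewrite subr_eq0 => /eqP ->.
  by move/eqP; rewrite subr_eq0 => /eqP <-; ring.
rewrite qt [la - la]subrr mul0r addr0 => e.
have WwE : W.[w1] = q0.[w1] + la * q1.[w1] - al * (p1.[w1] + la * p2.[w1]).
  by rewrite WE PE !hornE.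
rewrite -WwE in ew.
have ew' := congr1 Num.conj ew; rewrite !conjE in ew'.
have Wc : (W.[w1])^* != 0 by rewrite conjC_eq0.
set u := p1.[tau] + _ in e qt *; set v := (X tau).[tau] + _ in e *.
apply: (mulIf Wc).
transitivity (- (al * al^*) * (u * ((p1.[w1] + la * p2.[w1]))^*) + al * (u * (q0.[w1] + la * q1.[w1])^*) + (1 - al * al^*) * 0).
  have := congr1 Num.conj WwE; rewrite !conjE => ->; rewrite alal.
  rewrite [RHS](_ : _ = al * u * ((q0.[w1])^* + la^* * (q1.[w1])^*) - u * ((p1.[w1])^* + la^* * (p2.[w1])^*)); last by ring.
  transitivity (al * u * ((q0.[w1])^* + la^* * (q1.[w1])^*) - (al * al^*) * (u * ((p1.[w1])^* + la^* * (p2.[w1])^*))); first by ring.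
  by rewrite alal mul1r.
rewrite alal subrr mul0r addr0 mulN1r.
transitivity (- ((1 - tau * w1^*) * (v * ((X tau).[w1])^*))).
  by rewrite -e; ring.
transitivity ((tau * v) * ((s tau)^* * (W.[w1])^*)); last by ring.
rewrite -ew'; transitivity ((tau * w1^* - tau * tau^*) * (v * ((X tau).[w1])^*)); last by ring.
by rewrite t1; ring.
Qed.

(** On the diagonal of the identity, |p~|^2 and all squares but the one of tau are dropped. *)
Lemma exceptional_julia tau z1 z2 : tau \in rs -> A.[tau] = 0 ->
  `|z1| <= 1 -> `|z2| <= 1 ->
  s tau * (s tau)^* * (1 - `|z1| ^+ 2) *
    `|q0.[z1] + z2 * q1.[z1] - al * (p1.[z1] + z2 * p2.[z1])| ^+ 2 <=
  `|z1 - tau| ^+ 2 * `|p1.[z1] + z2 * p2.[z1]| ^+ 2.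
Proof.
move=> tr At z11 z21; have := identity z1 z2 z1 z2; rewrite -!normCK.
set p := p1.[z1] + _; set q := q0.[z1] + _ => e.
pose G r := (X r).[z1] + (z2 - la) * (Y r).[z1].
have s1 : 0 <= 1 - `|z1| ^+ 2 by rewrite subr_ge0 expr_le1.
have s2 : 0 <= 1 - `|z2| ^+ 2 by rewrite subr_ge0 expr_le1.
have h : (1 - `|z1| ^+ 2) * `|G tau| ^+ 2 <= `|p| ^+ 2.
  apply: (@le_trans _ _ (`|p| ^+ 2 - `|q| ^+ 2)); last by rewrite gerBl exprn_ge0.
  rewrite e; apply: ler_wpDr; first by rewrite mulr_ge0 // exprn_ge0.
  apply: ler_wpM2l => //; rewrite (bigD1_seq tau) //= -/(G tau) -normCK.
  by rewrite lerDl; apply: sumr_ge0 => r _; rewrite mul_conjC_ge0.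
have f := exceptional_factor z1 z2 tr At; rewrite -/(G tau) -/p -/q in f.
rewrite mulrAC -exprMn -normrM -f normrM exprMn.
rewrite -mulrA; apply: ler_wpM2l; first by rewrite exprn_ge0.
by rewrite mulrC.
Qed.

End Decomposition.

Let rs_hyps (rs : seq C) (s : C -> C) := [/\ uniq rs, size rs = n,
  (forall z, root W z = (z \in rs)),
  (forall r, r \in rs -> `|r| = 1 /\ 0 < W^`().[r] * (P.[r])^* * al^* * r) &
  (forall r, r \in rs -> s r * (s r)^* * W^`().[r] = al * r^* * P.[r])].

Lemma clark_decomposition (rs : seq C) (s : C -> C) : rs_hyps rs s ->
  exists (X Y : C -> {poly C}) (x : C -> C) (Q : {poly C}),
  [/\ (size Q <= n.+1)%N, (forall r, (size (X r) <= n)%N /\ (size (Y r) <= n)%N),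
  (forall r, r \in rs -> [/\ ('X - r%:P) * X r = s r *: W,
     ('X - r%:P) * Y r = s r *: A - x r *: Q & A.[r] = 0 -> Q.[r] = 0 /\ x r = 0]) &
  (forall z1 z2 w1 w2,
    (p1.[z1] + z2 * p2.[z1]) * (p1.[w1] + w2 * p2.[w1])^*
    - (q0.[z1] + z2 * q1.[z1]) * (q0.[w1] + w2 * q1.[w1])^* =
    (1 - z1 * w1^*) * (\sum_(r <- rs) ((X r).[z1] + (z2 - la) * (Y r).[z1])
        * ((X r).[w1] + (w2 - la) * (Y r).[w1])^*)
    + (1 - z2 * w2^*) * (Q.[z1] * (Q.[w1])^*))].
Proof.
move=> [urs srs rsW rs1 sE].
have [Q sQ QE] := spectral_factor sp1 sp2 p0.
have [|r rr|r rr|r rr|r rr|X [Y [x [sXY [XYE id]]]]] :=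
    @clark_agler _ n p1 p2 Q q0 q1 P W A B al la n0 sp1 sp2 sQ q0E q1E _ al1 la1
      PE WE AE BE rs s urs srs _ _ _ _ sE.
- by rewrite q0E q1E.
- by rewrite rsW.
- by have [] := rs1 r rr.
- by have [r1 _] := rs1 r rr; apply: PD; rewrite r1.
- by have [_] := rs1 r rr; apply: contraTneq => ->; rewrite !mul0r ltxx.
by exists X, Y, x, Q.
Qed.

Lemma clark_weights (rs : seq C) :
  (forall r, r \in rs -> `|r| = 1 /\ 0 < W^`().[r] * (P.[r])^* * al^* * r) ->
  exists s : C -> C, (forall r, r \in rs -> s r != 0) /\
    (forall r, r \in rs -> s r * (s r)^* * W^`().[r] = al * r^* * P.[r]).
Proof.
(* t is the conjugate of al conj(r) P / W' at r, written so that its positivity is the one from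
   [clark_data]; hence it is real and has a square root. *)
move=> rs1; pose t r := W^`().[r] * (P.[r])^* * al^* * r / `|W^`().[r]| ^+ 2.
have W0 r : r \in rs -> W^`().[r] != 0.
  by move=> rr; have [_] := rs1 r rr; apply: contraTneq => ->; rewrite !mul0r ltxx.
have t0 r : r \in rs -> 0 < t r.
  move=> rr; have [_ pos] := rs1 r rr.
  by rewrite divr_gt0 // exprn_gt0 // normr_gt0 W0.
exists (fun r => sqrtC (t r)); split=> [r rr|r rr]; first by rewrite sqrtC_eq0 gt_eqF ?t0.
rewrite [(sqrtC _)^*]conj_Creal ?ger0_real ?sqrtC_ge0 ?ltW ?t0 // -expr2 sqrtCK.
rewrite -[t r](conj_Creal (gtr0_real (t0 r rr))) /t normCK !conjE.
by field; rewrite conjC_eq0 W0.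
Qed.

(** Here t = |s tau|^2. The equation says that the z1-derivative of phi at (tau, z2) is al conj(tau)
    / t wherever p is nonzero, which will identify t with c_j; the inequality is Julia's. *)
Lemma angular_derivative (rs : seq C) tau : uniq rs -> size rs = n ->
  (forall z, root W z = (z \in rs)) ->
  (forall r, r \in rs -> `|r| = 1 /\ 0 < W^`().[r] * (P.[r])^* * al^* * r) ->
  A.[tau] = 0 -> B.[tau] = 0 ->
  exists t, [/\ 0 < t,
    forall z2, t * (z2 * A^`().[tau] - B^`().[tau]) = al * tau^* * (p1.[tau] + z2 * p2.[tau])
  & forall z1 z2, `|z1| <= 1 -> `|z2| <= 1 ->
    t * (1 - `|z1| ^+ 2) *
    `|q0.[z1] + z2 * q1.[z1] - al * (p1.[z1] + z2 * p2.[z1])| ^+ 2 <=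
    `|z1 - tau| ^+ 2 * `|p1.[z1] + z2 * p2.[z1]| ^+ 2].
Proof.
move=> urs srs rsW rs1 At Bt.
have rs1' r (rr : r \in rs) := (rs1 r rr).1.
have WAB : W = la *: A - B by rewrite WE AE BE PE -!mul_polyC; ring.
have tr : tau \in rs by rewrite -rsW; apply/rootP; rewrite WAB !hornE At Bt mulr0 subr0.
have [s [s0 sE]] := clark_weights rs1.
have hyps : rs_hyps rs s by split.
have [X [Y [x [Q [_ _ XYE id]]]]] := clark_decomposition hyps.
exists (s tau * (s tau)^*); split; first by rewrite mul_conjC_gt0 s0.
  move=> z2; have := exceptional_boundary urs rsW rs1' XYE id z2 tr At Bt.
  have [XW YA /(_ At) [_ x0]] := XYE _ tr; rewrite x0 scale0r subr0 in YA.
  have e1 := congr1 (fun f : {poly C} => f^`().[tau]) XW.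
  have e2 := congr1 (fun f : {poly C} => f^`().[tau]) YA.
  rewrite /= !derivM !derivZ derivB derivX derivC !hornE subrr subr0 !mul0r !mul1r !addr0 in e1 e2.
  rewrite e1 e2 => e.
  transitivity (tau^* * (al * (p1.[tau] + z2 * p2.[tau]))); last by ring.
  rewrite e WAB derivB derivZ !hornE.
  have t1 := unit_mulconj (rs1' _ tr).
  transitivity ((tau * tau^*) * (s tau * (s tau)^* * (z2 * A^`().[tau] - B^`().[tau]))); last by ring.
  by rewrite t1 mul1r.
move=> z1 z2 z11 z21; exact: (exceptional_julia urs XYE id tr At z11 z21).
Qed.

Definition pencil (f g : {poly C}) : {poly {poly C}} := f%:P + 'X * g%:P.

(** The Clark points are reordered so that the tau j come first, and the weights there are the given
    e j instead of square roots. Only |e j| is constrained, which leaves free the phase that R_j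
    requires. *)
Lemma prescribed_decomposition (rs : seq C) (l : nat) (tau e : nat -> C) :
  uniq rs -> size rs = n -> (forall z, root W z = (z \in rs)) ->
  (forall r, r \in rs -> `|r| = 1 /\ 0 < W^`().[r] * (P.[r])^* * al^* * r) ->
  (forall j k, (j < l)%N -> (k < l)%N -> tau j = tau k -> j = k) ->
  (forall j, (j < l)%N -> [/\ A.[tau j] = 0, B.[tau j] = 0 &
     e j * (e j)^* * W^`().[tau j] = al * (tau j)^* * P.[tau j]]) ->
  exists (X Y : nat -> {poly C}) (Q : {poly C}),
  [/\ (l <= n)%N, (size Q <= n.+1)%N, (forall j, (size (X j) <= n)%N /\ (size (Y j) <= n)%N),
  (forall j, (j < l)%N ->
     ('X - (tau j)%:P)%:P * pencil (X j) (Y j) =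
       (e j)%:P%:P * (pencil q0 q1 - al%:P%:P * pencil p1 p2) /\
     forall z2, al * (p1.[tau j] + z2 * p2.[tau j]) =
       tau j * (e j)^* * ((X j).[tau j] + z2 * (Y j).[tau j])) &
  (forall z1 z2 w1 w2,
    (p1.[z1] + z2 * p2.[z1]) * (p1.[w1] + w2 * p2.[w1])^*
    - (q0.[z1] + z2 * q1.[z1]) * (q0.[w1] + w2 * q1.[w1])^* =
    (1 - z1 * w1^*) * (\sum_(j < n) ((X j).[z1] + z2 * (Y j).[z1])
        * ((X j).[w1] + w2 * (Y j).[w1])^*)
    + (1 - z2 * w2^*) * (Q.[z1] * (Q.[w1])^*))].
Proof.
move=> urs srs rsW rs1 tau_inj tauE.
have WAB : W = la *: A - B by rewrite WE AE BE PE -!mul_polyC; ring.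
pose ts := [seq tau j | j <- iota 0 l].
have uts : uniq ts.
  rewrite map_inj_in_uniq ?iota_uniq // => j k; rewrite !mem_iota !add0n /=.
  exact: tau_inj.
have tsr r : r \in ts -> r \in rs.
  case/mapP => j; rewrite mem_iota add0n /= => jl ->.
  have [At Bt _] := tauE j jl.
  by rewrite -rsW; apply/rootP; rewrite WAB !hornE At Bt mulr0 subr0.
pose rs' := ts ++ [seq r <- rs | r \notin ts].
have rsm r : (r \in rs') = (r \in rs).
  rewrite mem_cat mem_filter; case: (boolP (r \in ts)) => //= /tsr ->.
  by [].
have urs' : uniq rs'.
  rewrite cat_uniq uts filter_uniq // andbT; apply/hasPn => r.
  by rewrite mem_filter => /andP[].
have srs' : size rs' = n.
  by rewrite -srs; apply/perm_size/uniq_perm.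
have [s0 [_ s0E]] := clark_weights rs1.
pose s r := if r \in ts then e (index r ts) else s0 r.
have tsn j : (j < l)%N -> nth 0 ts j = tau j.
  by move=> jl; rewrite (nth_map 0%N) ?size_iota // nth_iota.
have st j : (j < l)%N -> s (tau j) = e j.
  move=> jl; rewrite /s -(tsn j jl) mem_nth ?size_map ?size_iota //.
  by rewrite index_uniq ?size_map ?size_iota.
have hyps : rs_hyps rs' s.
  split=> // [z|r|r]; rewrite ?rsW ?rsm //; first exact: rs1.
  case: (boolP (r \in ts)) => [/mapP[j]|rt rr]; last by rewrite /s (negPf rt) s0E.
  rewrite mem_iota add0n /= => jl -> _; rewrite st //.
  by have [] := tauE j jl.
have [X [Y [x [Q [sQ sXY XYE id]]]]] := clark_decomposition hyps.
have rsW' z : root W z = (z \in rs') by rewrite rsW rsm.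
have rs1' r : r \in rs' -> `|r| = 1 by rewrite rsm => /rs1[].
have ln : (l <= n)%N.
  by rewrite -srs' size_cat size_map size_iota leq_addr.
have nth_tau j : (j < l)%N -> nth 0 rs' j = tau j.
  by move=> jl; rewrite nth_cat size_map size_iota jl tsn.
(* Passage from powers of z2 - la to powers of z2. *)
exists (fun j => X (nth 0 rs' j) - la *: Y (nth 0 rs' j)), (fun j => Y (nth 0 rs' j)), Q.
have evE r z1 z2 : (X r - la *: Y r).[z1] + z2 * (Y r).[z1] = (X r).[z1] + (z2 - la) * (Y r).[z1].
  by rewrite !hornE; ring.
split=> //.
- move=> j; have [sX sY] := sXY (nth 0 rs' j); split=> //.
  rewrite (leq_trans (size_polyD _ _)) // geq_max sX size_polyN.
  exact: leq_trans (size_scale_leq _ _) sY.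
- move=> j jl; rewrite (nth_tau j jl).
  have [At Bt _] := tauE j jl.
  have tr : tau j \in rs' by rewrite rsm tsr // -(tsn j jl) mem_nth ?size_map ?size_iota.
  split=> [|z2]; last by rewrite evE -(st j jl); exact: (exceptional_boundary urs' rsW' rs1' XYE id).
  have [XW YA /(_ At) [_ x0]] := XYE _ tr; rewrite x0 scale0r subr0 st // in XW YA.
  rewrite /pencil -!mul_polyC.
  transitivity ((('X - (tau j)%:P) * X (tau j) - la%:P * (('X - (tau j)%:P) * Y (tau j)))%:P
     + 'X * (('X - (tau j)%:P) * Y (tau j))%:P).
    by rewrite !polyCM !polyCB !polyCM; ring.
  rewrite XW YA WE PE AE -!mul_polyC !(polyCM, polyCB, polyCD); ring.
move=> z1 z2 w1 w2; rewrite id (big_nth 0) srs' big_mkord.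
by congr (_ * _ + _); apply: eq_bigr => j _; rewrite !evE.
Qed.

End Passes.

(** * Coefficient arrays *)

Section Arrays.
Local Open Scope ring_scope.
Variable C : numClosedFieldType.
Local Notation bipoly := {poly {poly C}}.
Implicit Types (m u v : bipoly) (a b : nat -> nat -> C) (z w c : C) (i k N : nat).

Definition ev m z1 z2 : C := (map_poly (fun q : {poly C} => q.[z1]) m).[z2].

Lemma evE m z1 z2 : ev m z1 z2 = (m.[z2%:P]).[z1].
Proof.
rewrite /ev -[map_poly _ m]/(map_poly (horner_eval z1) m).
by rewrite -{1}[z2](hornerC z2 z1) -[_.[z1] in LHS]/(horner_eval z1 _) horner_map.
Qed.

Definition bic c : bipoly := c%:P%:P.
Definition zz1 : bipoly := 'X%:P.
Definition zz2 : bipoly := 'X.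

Lemma evD m u z1 z2 : ev (m + u) z1 z2 = ev m z1 z2 + ev u z1 z2.
Proof. by rewrite !evE !hornerD. Qed.
Lemma evN m z1 z2 : ev (- m) z1 z2 = - ev m z1 z2.
Proof. by rewrite !evE !hornerN. Qed.
Lemma evM m u z1 z2 : ev (m * u) z1 z2 = ev m z1 z2 * ev u z1 z2.
Proof. by rewrite !evE !hornerM. Qed.
Lemma evC (f : {poly C}) z1 z2 : ev f%:P z1 z2 = f.[z1].
Proof. by rewrite evE hornerC. Qed.
Lemma ev_bic c z1 z2 : ev (bic c) z1 z2 = c.
Proof. by rewrite evC hornerC. Qed.
Lemma ev_zz1 z1 z2 : ev zz1 z1 z2 = z1.
Proof. by rewrite evC hornerX. Qed.
Lemma ev_zz2 z1 z2 : ev zz2 z1 z2 = z2.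
Proof. by rewrite evE hornerX hornerC. Qed.
Lemma ev_sum (I : Type) (r : seq I) (F : I -> bipoly) z1 z2 :
  ev (\sum_(i <- r) F i) z1 z2 = \sum_(i <- r) ev (F i) z1 z2.
Proof. by rewrite evE !horner_sum; apply: eq_bigr => i _; rewrite evE. Qed.

Lemma ev_zero m : (forall z1 z2, ev m z1 z2 = 0) -> m = 0.
Proof.
move=> m0; apply/polyP => k; rewrite coef0; apply: poly_zero => z1.
have : map_poly (horner_eval z1) m = 0 by apply: poly_zero => z2; exact: m0.
by move/(congr1 (fun f : {poly C} => f`_k)); rewrite coef_map coef0.
Qed.

Definition cf m i k : C := m`_k`_i.

Lemma cfD m u i k : cf (m + u) i k = cf m i k + cf u i k.
Proof. by rewrite /cf !coefD. Qed.
Lemma cfN m i k : cf (- m) i k = - cf m i k.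
Proof. by rewrite /cf !coefN. Qed.
Lemma pencil_relation (t e a : C) (r p q : bipoly) :
  ('X - t%:P)%:P * r = e%:P%:P * (q - a%:P%:P * p) ->
  zz1 * r = bic t * r + bic e * q + bic (- (e * a)) * p.
Proof.
rewrite /bic /zz1 polyCB => h.
have -> : 'X%:P * r = ('X%:P - t%:P%:P) * r + t%:P%:P * r by ring.
by rewrite h !polyCN !polyCM; ring.
Qed.

Lemma cf_bic c m i k : cf (bic c * m) i k = c * cf m i k.
Proof. by rewrite /cf /bic !coefCM. Qed.
Lemma cf_zz1 m i k : cf (zz1 * m) i k = if i is i'.+1 then cf m i' k else 0.
Proof. by rewrite /cf /zz1 coefCM coefXM; case: i. Qed.
Lemma cf_zz2 m i k : cf (zz2 * m) i k = if k is k'.+1 then cf m i k' else 0.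
Proof. by rewrite /cf /zz2 coefXM; case: k => //=; rewrite coef0. Qed.

Lemma cfM_local m u v i k :
  (forall i' k', (i' <= i)%N -> (k' <= k)%N -> cf u i' k' = cf v i' k') ->
  cf (m * u) i k = cf (m * v) i k.
Proof.
move=> uv; rewrite /cf !coefM !coef_sum; apply: eq_bigr => t _.
rewrite !coefM; apply: eq_bigr => s _; congr (_ * _).
by apply: uv; apply: leq_subr.
Qed.

Definition trunc N a : bipoly := \poly_(k < N) \poly_(i < N) a i k.

Lemma cf_trunc N a i k : (i < N)%N -> (k < N)%N -> cf (trunc N a) i k = a i k.
Proof. by move=> iN kN; rewrite /cf !coef_poly kN coef_poly iN. Qed.

(* The array of Taylor coefficients of m * g, for g with coefficient array a. *)
Definition act m a i k : C := cf (m * trunc (maxn i k).+1 a) i k.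

Let lt_maxl i k : (i < (maxn i k).+1)%N. Proof. by rewrite ltnS leq_maxl. Qed.
Let lt_maxr i k : (k < (maxn i k).+1)%N. Proof. by rewrite ltnS leq_maxr. Qed.

Lemma actE N m a i k : (i < N)%N -> (k < N)%N -> act m a i k = cf (m * trunc N a) i k.
Proof.
move=> iN kN; apply: cfM_local => i' k' ii kk.
by rewrite !cf_trunc ?ltnS ?leq_max ?ii ?kk ?orbT // (leq_ltn_trans ii, leq_ltn_trans kk).
Qed.

Lemma act_ext m a b i k : (forall i' k', (i' <= i)%N -> (k' <= k)%N -> a i' k' = b i' k') ->
  act m a i k = act m b i k.
Proof.
move=> ab; apply: cfM_local => i' k' ii kk.
by rewrite !cf_trunc ?ltnS ?leq_max ?ii ?kk ?orbT // ab.
Qed.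

Lemma act_comp m u a i k : act m (act u a) i k = act (m * u) a i k.
Proof.
rewrite !(@actE (maxn i k).+1) ?lt_maxl ?lt_maxr // -mulrA.
apply: cfM_local => i' k' ii kk; have hi : (i' < (maxn i k).+1)%N by rewrite ltnS leq_max ii.
have hk : (k' < (maxn i k).+1)%N by rewrite ltnS leq_max kk orbT.
by rewrite cf_trunc // (actE _ _ hi hk).
Qed.

Lemma actD m u a i k : act (m + u) a i k = act m a i k + act u a i k.
Proof. by rewrite /act mulrDl cfD. Qed.
Lemma act_bic c m a i k : act (bic c * m) a i k = c * act m a i k.
Proof. by rewrite /act -mulrA cf_bic. Qed.
Lemma act1 a i k : act 1 a i k = a i k.
Proof. by rewrite /act mul1r cf_trunc ?lt_maxl ?lt_maxr. Qed.
Lemma act0 a i k : act 0 a i k = 0.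
Proof. by rewrite /act mul0r /cf !coef0. Qed.
Lemma act_zz1 m a i k : act (zz1 * m) a i k = if i is i'.+1 then act m a i' k else 0.
Proof.
rewrite (@actE (maxn i k).+1) ?lt_maxl ?lt_maxr // -mulrA cf_zz1.
case: i => // i; rewrite -actE ?lt_maxr //.
by rewrite ltnS (leq_trans _ (leq_maxl _ _)).
Qed.
Lemma act_zz2 m a i k : act (zz2 * m) a i k = if k is k'.+1 then act m a i k' else 0.
Proof.
rewrite (@actE (maxn i k).+1) ?lt_maxl ?lt_maxr // -mulrA cf_zz2.
case: k => // k; rewrite -actE ?lt_maxl //.
by rewrite ltnS (leq_trans _ (leq_maxr _ _)).
Qed.
Definition delta i k : C := ((i == 0%N) && (k == 0%N))%:R.

Lemma act_delta m i k : act m delta i k = cf m i k.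
Proof.
rewrite /act -[in RHS](mulr1 m); apply: cfM_local => i' k' ii kk.
rewrite cf_trunc ?ltnS ?leq_max ?ii ?kk ?orbT // /cf /delta !coefC.
by rewrite andbC; case: k' {kk} => [|k']; rewrite ?coef0 // -polyC1 coefC; case: i' {ii}.
Qed.

(** * The power series of 1/p *)

Section Inverse.
Variable p : bipoly.
Hypothesis p00 : cf p 0 0 != 0.
(** Neumann series: X has no constant term, so X^d has no coefficient of total degree below d, and
    the partial sum [E M] inverts p up to total degree M - 1. *)
Let X : bipoly := 1 - bic (cf p 0 0)^-1 * p.

Let X00 : cf X 0 0 = 0.
Proof. by rewrite /X cfD cfN cf_bic mulVf // /cf !coef1 subrr. Qed.

Let cfX (d : nat) i k : (i + k < d)%N -> cf (X ^+ d) i k = 0.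
Proof.
elim: d i k => // d IH i k ikd; rewrite exprS /cf coefM coef_sum big1 // => t _.
rewrite coefM big1 // => s _.
have [/eqP|st] := posnP (s + t)%N.
  rewrite addn_eq0 => /andP[/eqP -> /eqP ->].
  by rewrite -[X`_0`_0]/(cf X 0 0) X00 mul0r.
rewrite -[(X ^+ d)`_ _`_ _]/(cf (X ^+ d) (i - s) (k - t)) IH ?mulr0 //.
by move: (ltn_ord s) (ltn_ord t); lia.
Qed.

Let E (M : nat) : bipoly := bic (cf p 0 0)^-1 * \sum_(j < M) X ^+ j.

Let pE (M : nat) : p * E M = 1 - X ^+ M.
Proof.
have := subrX1 X M => e; rewrite -[RHS]opprB e /E.
have -> : X - 1 = - (bic (cf p 0 0)^-1 * p) by rewrite /X; ring.
by rewrite mulNr opprK; ring.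
Qed.

(* Taylor coefficients of 1 / p *)
Definition inv_coef i k : C := cf (E (i + k).+1) i k.

Lemma inv_coefE (M : nat) i k : (i + k < M)%N -> inv_coef i k = cf (E M) i k.
Proof.
elim: M => // M IH; rewrite ltnS leq_eqVlt => /orP[/eqP <- //|ikM].
rewrite IH // /E big_ord_recr /= mulrDr cfD !cf_bic cfX ?mulr0 ?addr0 //.
Qed.

Lemma act_inv_coef i k : act p inv_coef i k = delta i k.
Proof.
rewrite /act (@cfM_local _ _ (E (i + k).+1)) => [|i' k' ii kk]; last first.
  rewrite cf_trunc ?ltnS ?leq_max ?ii ?kk ?orbT // (@inv_coefE (i + k).+1) //.
  by rewrite ltnS leq_add.
by rewrite pE cfD cfN cfX // subr0 -act_delta act1.
Qed.

Lemma act_mul_inv_coef m i k : act (m * p) inv_coef i k = cf m i k.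
Proof.
rewrite -act_comp -act_delta; apply: act_ext => i' k' _ _.
exact: act_inv_coef.
Qed.

Lemma act_injective a b i k :
  (forall i' k', (i' <= i)%N -> (k' <= k)%N -> act p a i' k' = act p b i' k') -> a i k = b i k.
Proof.
move=> ab; set M := (i + k).+1.
have inv (c : nat -> nat -> C) : c i k = cf (E M * (p * trunc (maxn i k).+1 c)) i k.
  rewrite mulrA (mulrC (E M)) pE mulrBl mul1r cfD cfN.
  rewrite cf_trunc ?lt_maxl ?lt_maxr //.
  have -> : cf (X ^+ M * trunc (maxn i k).+1 c) i k = 0.
    rewrite /cf coefM coef_sum big1 // => t _.
    rewrite coefM big1 // => s _.
    rewrite -[(X ^+ M)`_ _`_ _]/(cf (X ^+ M) s t) cfX ?mul0r //.
    by move: (ltn_ord s) (ltn_ord t); rewrite /M; lia.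
  by rewrite subr0.
rewrite (inv a) (inv b); apply: cfM_local => i' k' ii kk.
have hi : (i' < (maxn i k).+1)%N by rewrite ltnS leq_max ii.
have hk : (k' < (maxn i k).+1)%N by rewrite ltnS leq_max kk orbT.
by rewrite -!actE // ab.
Qed.

End Inverse.

End Arrays.

(** * Null sequences and square summable arrays *)

Section Null.
Local Open Scope ring_scope.
Variable C : numClosedFieldType.
Local Notation bipoly := {poly {poly C}}.
Implicit Types (m u : bipoly) (a b : nat -> nat -> C) (z w c e x y r : C) (i k N M : nat)
  (s t v : nat -> C).

(* The only form of completeness that is needed; it holds over R[i]. *)
Hypothesis monotone_cauchy : forall (s : nat -> C) (K : C),
  (forall n, s n <= s n.+1) -> (forall n, s n <= K) ->
  forall e, 0 < e -> exists N, forall n, (N <= n)%N -> s n - s N < e.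

Definition null s := forall e, 0 < e -> exists N, forall n, (N <= n)%N -> `|s n| < e.

Lemma null_le s t : (forall n, `|s n| <= `|t n|) -> null t -> null s.
Proof.
move=> st t0 e e0; have [N hN] := t0 e e0; exists N => n /hN.
exact: le_lt_trans.
Qed.

Lemma null_ext s t : (forall n, s n = t n) -> null t -> null s.
Proof. by move=> st; apply: null_le => n; rewrite st. Qed.

Lemma nullD s t : null s -> null t -> null (fun n => s n + t n).
Proof.
move=> s0 t0 e e0; have e2 : 0 < e / 2%:R by rewrite divr_gt0.
have [N hN] := s0 _ e2; have [M hM] := t0 _ e2; exists (maxn N M) => n.
rewrite geq_max => /andP[/hN sn /hM tn].
rewrite (splitr e); apply: le_lt_trans (ler_normD _ _) _; exact: ltrD.
Qed.

Lemma nullZ c s : null s -> null (fun n => c * s n).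
Proof.
move=> s0 e e0; have c1 : 0 < `|c| + 1 by rewrite ltr_wpDl.
have [N hN] := s0 (e / (`|c| + 1)) (divr_gt0 e0 c1); exists N => n /hN sn.
rewrite normrM; apply: (@le_lt_trans _ _ ((`|c| + 1) * `|s n|)).
  by rewrite ler_wpM2r // lerDl.
by rewrite mulrC -ltr_pdivlMr.
Qed.

Lemma nullN s : null s -> null (fun n => - s n).
Proof. by apply: null_le => n; rewrite normrN. Qed.

Lemma null0 : null (fun _ => 0).
Proof. by move=> e e0; exists 0%N => n _; rewrite normr0. Qed.

Lemma null_const c : null (fun _ => c) -> c = 0.
Proof.
move=> c0; apply/eqP; rewrite -normr_eq0; apply/negPn/negP => cn.
have cp : 0 < `|c| by rewrite lt_def cn normr_ge0.
by have [N /(_ N (leqnn N))] := c0 _ cp; rewrite ltxx.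
Qed.

Lemma null_sum n (F : 'I_n -> nat -> C) : (forall j, null (F j)) ->
  null (fun N => \sum_(j < n) F j N).
Proof.
elim: n F => [|n IH] F F0; first by apply: null_ext null0 => N; rewrite big_ord0.
have := nullD (IH (fun j => F (widen_ord (leqnSn n) j)) (fun j => F0 _)) (F0 ord_max).
by apply: null_ext => N; rewrite big_ord_recr.
Qed.

Lemma null_mono_increment s K : (forall n, s n <= s n.+1) -> (forall n, s n <= K) ->
  null (fun n => s n.+1 - s n).
Proof.
move=> s1 sK e e0; have [N hN] := monotone_cauchy s1 sK e0; exists N => n Nn.
have sN : s N <= s n.
  by rewrite -(subnKC Nn); elim: (n - N)%N => [|d IH]; rewrite ?addn0 // addnS (le_trans IH).
rewrite ger0_norm ?subr_ge0 //; apply: le_lt_trans (hN n.+1 (leqW Nn)).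
by rewrite lerD2l lerN2.
Qed.

(** With r = |z|, the sequence - r^n is increasing and bounded, and its increments are (1 - r)
    r^n. *)
Lemma null_geom z : `|z| < 1 -> null (fun n => z ^+ n).
Proof.
move=> z1; set r := `|z| in z1; have r0 : 0 <= r by exact: normr_ge0.
have r1 : 0 < 1 - r by rewrite subr_gt0.
have h1 n : - r ^+ n <= - r ^+ n.+1.
  by rewrite lerN2 exprS ler_piMl ?exprn_ge0 // ltW.
have h2 n : - r ^+ n <= 0 by rewrite oppr_le0 exprn_ge0.
have := nullZ (1 - r)^-1 (@null_mono_increment (fun n => - r ^+ n) 0 h1 h2).
apply: null_le => n; rewrite exprS.
have -> : (1 - r)^-1 * (- (r * r ^+ n) - - r ^+ n) = r ^+ n by field; rewrite gt_eqF.
by rewrite normrX -/r ger0_norm ?exprn_ge0.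
Qed.

Lemma geom_sum_le r N : 0 <= r -> r < 1 -> \sum_(i < N) r ^+ i <= (1 - r)^-1.
Proof.
move=> r0 r1; have r10 : 0 < 1 - r by rewrite subr_gt0.
rewrite -[(1 - r)^-1]mul1r ler_pdivlMr // mulrC.
have := subrX1 r N => /(congr1 -%R); rewrite opprB -mulNr opprB => <-.
by rewrite gerBl exprn_ge0.
Qed.

Definition Sev N a z1 z2 : C := \sum_(i < N) \sum_(k < N) a i k * z1 ^+ i * z2 ^+ k.
Definition nsq N a : C := \sum_(i < N) \sum_(k < N) `|a i k| ^+ 2.
Definition ip N a b : C := \sum_(i < N) \sum_(k < N) a i k * (b i k)^*.
Definition bounded a := exists K, forall i k, `|a i k| <= K.
Definition l2 a := exists K, forall N, nsq N a <= K.

Definition shift1 a i k : C := if i is i'.+1 then a i' k else 0.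
Definition shift2 a i k : C := if k is k'.+1 then a i k' else 0.

Lemma nsq_ext N a b : (forall i k, a i k = b i k) -> nsq N a = nsq N b.
Proof. by move=> ab; apply: eq_bigr => i _; apply: eq_bigr => k _; rewrite ab. Qed.

Lemma nsq_ge0 N a : 0 <= nsq N a.
Proof. by apply: sumr_ge0 => i _; apply: sumr_ge0 => k _; rewrite exprn_ge0. Qed.

Lemma nsqS N a : nsq N.+1 a = nsq N a + \sum_(i < N) `|a i N| ^+ 2 + \sum_(k < N.+1) `|a N k| ^+ 2.
Proof.
rewrite /nsq big_ord_recr /= -big_split /=; congr (_ + _).
by apply: eq_bigr => i _; rewrite big_ord_recr.
Qed.

Lemma nsq_leS N a : nsq N a <= nsq N.+1 a.
Proof.
rewrite nsqS -addrA lerDl addr_ge0 //; apply: sumr_ge0 => i _; exact: exprn_ge0.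
Qed.

Lemma nsq_mono N M a : (N <= M)%N -> nsq N a <= nsq M a.
Proof.
move=> NM; rewrite -(subnKC NM); elim: (M - N)%N => [|d IH]; rewrite ?addn0 // addnS.
exact: le_trans IH (nsq_leS _ _).
Qed.

(** The edge of the square is part of its growth, so for square summable arrays edge terms tend to
    0; they are the error terms of all later telescopings. *)
Lemma nsq_row N a : \sum_(k < N.+1) `|a N k| ^+ 2 <= nsq N.+1 a - nsq N a.
Proof.
rewrite nsqS lerBrDr addrC lerD2r lerDl.
by apply: sumr_ge0 => i _; exact: exprn_ge0.
Qed.

Lemma nsq_col N a : \sum_(i < N.+1) `|a i N| ^+ 2 <= nsq N.+1 a - nsq N a.
Proof.
rewrite nsqS lerBrDr addrC -!addrA lerD2l big_ord_recr /= lerD2l [leRHS]big_ord_recr /= lerDr.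
by apply: sumr_ge0 => i _; exact: exprn_ge0.
Qed.

Lemma nsq_entry N a i k : (i < N)%N -> (k < N)%N -> `|a i k| ^+ 2 <= nsq N a.
Proof.
move=> iN kN; rewrite /nsq (bigD1 (Ordinal iN)) //= (bigD1 (Ordinal kN)) //= -addrA lerDl.
rewrite addr_ge0 //; first by apply: sumr_ge0 => j _; exact: exprn_ge0.
by apply: sumr_ge0 => j _; apply: sumr_ge0 => t _; exact: exprn_ge0.
Qed.

Lemma sqr_le_bound x K : 0 <= x -> x ^+ 2 <= K -> x <= K + 1.
Proof.
move=> x0 xK; have K0 : 0 <= K := le_trans (exprn_ge0 2 x0) xK.
have /orP[x1|x1] := real_leVge (ger0_real x0) (real1 C).
  by apply: le_trans x1 _; rewrite lerDr.
apply: le_trans (le_trans _ xK) _; last by rewrite lerDl.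
by rewrite expr2 ler_peMr.
Qed.

Lemma l2_bounded a : l2 a -> bounded a.
Proof.
move=> [K hK]; exists (K + 1) => i k; apply: sqr_le_bound => //.
apply: le_trans (hK (maxn i k).+1); apply: nsq_entry; rewrite ltnS ?leq_maxl ?leq_maxr //.
Qed.

Lemma l2_increment a : l2 a -> null (fun N => nsq N.+1 a - nsq N a).
Proof.
by move=> [K hK]; exact: (null_mono_increment (fun n => nsq_leS n a) hK).
Qed.

Lemma null_sqr s : null (fun n => `|s n| ^+ 2) -> null s.
Proof.
move=> s0 e e0; have [N hN] := s0 _ (exprn_gt0 2 e0); exists N => n /hN.
by rewrite ger0_norm ?exprn_ge0 // ltr_pXn2r // nnegrE // ltW.
Qed.

Lemma l2_null_row a : l2 a -> null (fun i => a i 0).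
Proof.
move=> a2; apply: null_sqr; apply: null_le (l2_increment a2) => N.
rewrite normrX normr_id [leRHS]ger0_norm ?subr_ge0 ?nsq_leS //.
apply: le_trans _ (nsq_row N a); rewrite big_ord_recl /= lerDl.
by apply: sumr_ge0 => i _; exact: exprn_ge0.
Qed.

Lemma nsq_shift1_le N a : nsq N (shift1 a) <= nsq N a.
Proof.
case: N => [|N]; first by rewrite /nsq !big_ord0.
rewrite /nsq big_ord_recl /= big1 ?add0r => [|k _]; last by rewrite normr0 expr0n.
rewrite [leRHS]big_ord_recr /= lerDl.
by apply: sumr_ge0 => i _; exact: exprn_ge0.
Qed.

Lemma nsq_shift2_le N a : nsq N (shift2 a) <= nsq N a.
Proof.
rewrite /nsq; apply: ler_sum => i _; case: N i => [|N] i; first by rewrite !big_ord0.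
rewrite big_ord_recl /= normr0 expr0n add0r [leRHS]big_ord_recr /= lerDl.
exact: exprn_ge0.
Qed.

Lemma nsq_shift1_ge N a : nsq N a <= nsq N.+1 (shift1 a).
Proof.
rewrite /nsq [leRHS]big_ord_recl /= [X in _ <= X + _]big1 ?add0r => [|k _].
  apply: ler_sum => i _; rewrite [leRHS]big_ord_recr /= lerDl; exact: exprn_ge0.
by rewrite normr0 expr0n.
Qed.

Lemma normD_sqr_le x y : `|x + y| ^+ 2 <= 2%:R * `|x| ^+ 2 + 2%:R * `|y| ^+ 2.
Proof.
rewrite -subr_ge0; have -> : 2%:R * `|x| ^+ 2 + 2%:R * `|y| ^+ 2 - `|x + y| ^+ 2 = `|x - y| ^+ 2.
  by rewrite !normCK !conjE; ring.
exact: exprn_ge0.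
Qed.

Lemma l2D a b : l2 a -> l2 b -> l2 (fun i k => a i k + b i k).
Proof.
move=> [K hK] [L hL]; exists (2%:R * K + 2%:R * L) => N.
apply: (@le_trans _ _ (2%:R * nsq N a + 2%:R * nsq N b)); last first.
  by rewrite lerD // ler_pM2l.
rewrite /nsq !mulr_sumr -big_split /=; apply: ler_sum => i _.
rewrite !mulr_sumr -big_split /=; apply: ler_sum => k _; exact: normD_sqr_le.
Qed.

Lemma l2Z c a : l2 a -> l2 (fun i k => c * a i k).
Proof.
move=> [K hK]; exists (`|c| ^+ 2 * K) => N.
apply: (@le_trans _ _ (`|c| ^+ 2 * nsq N a)); last by rewrite ler_wpM2l // exprn_ge0.
rewrite /nsq mulr_sumr; apply: ler_sum => i _; rewrite mulr_sumr; apply: ler_sum => k _.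
by rewrite normrM exprMn.
Qed.

Lemma bipoly_ind (K : bipoly -> Prop) : K 0 -> (forall m u, K m -> K u -> K (m + u)) ->
  (forall c, K (bic c)) -> (forall m, K m -> K (zz1 C * m)) ->
  (forall m, K m -> K (zz2 C * m)) -> forall m, K m.
Proof.
move=> K0 KD Kc K1 K2; elim/poly_ind => [//|m f Km].
rewrite -[_ * 'X]/(m * zz2 C) mulrC; apply: (KD); first exact: K2.
elim/poly_ind: f => [|f c Kf]; first by rewrite polyC0.
by rewrite polyCD polyCM mulrC; apply: (KD); [exact: K1 | exact: Kc].
Qed.

Lemma l2_act m a : l2 a -> l2 (act m a).
Proof.
move=> a2; elim/bipoly_ind: m => [|m u m2 u2|c|m m2|m m2].
- by exists 0 => N; rewrite /nsq big1 // => i _; rewrite big1 // => k _; rewrite act0 normr0 expr0n.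
- have [K hK] := l2D m2 u2; exists K => N; rewrite (le_trans _ (hK N)) //.
  by rewrite (@nsq_ext _ _ _ (fun i k => actD m u a i k)).
- have [K hK] := l2Z c a2; exists K => N; rewrite (le_trans _ (hK N)) //.
  rewrite (@nsq_ext _ _ (fun i k => c * a i k)) // => i k.
  by rewrite -[bic c]mulr1 act_bic act1.
- have [K hK] := m2; exists K => N; apply: le_trans (hK N).
  by rewrite (@nsq_ext _ _ _ (fun i k => act_zz1 m a i k)) -/(shift1 (act m a)) nsq_shift1_le.
- have [K hK] := m2; exists K => N; apply: le_trans (hK N).
  by rewrite (@nsq_ext _ _ _ (fun i k => act_zz2 m a i k)) -/(shift2 (act m a)) nsq_shift2_le.
Qed.

Lemma bounded_act m a : bounded a -> bounded (act m a).
Proof.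
move=> [Ka hKa]; elim/bipoly_ind: m => [|m u [K hK] [L hL]|c|m [K hK]|m [K hK]].
- by exists 0 => i k; rewrite act0 normr0.
- by exists (K + L) => i k; rewrite actD (le_trans (ler_normD _ _)) // lerD.
- exists (`|c| * Ka) => i k; rewrite -[bic c]mulr1 act_bic act1 normrM.
  by rewrite ler_wpM2l.
- have K0 := le_trans (normr_ge0 _) (hK 0%N 0%N).
  by exists K => i k; rewrite act_zz1; case: i => [|i]; rewrite ?normr0.
- have K0 := le_trans (normr_ge0 _) (hK 0%N 0%N).
  by exists K => i k; rewrite act_zz2; case: k => [|k]; rewrite ?normr0.
Qed.

(** A linear functional that turns multiplication by the variables into scalars is a multiple of a
    point evaluation; here this holds up to null sequences. It serves at interior points and at
    (tau, 0) with |tau| = 1. *)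
Lemma asymptotic_eval (L : nat -> bipoly -> C) z1 z2 :
  (forall N m u, L N (m + u) = L N m + L N u) ->
  (forall N c m, L N (bic c * m) = c * L N m) ->
  (forall m, null (fun N => L N (zz1 C * m) - z1 * L N m)) ->
  (forall m, null (fun N => L N (zz2 C * m) - z2 * L N m)) ->
  forall m, null (fun N => L N m - ev m z1 z2 * L N 1).
Proof.
move=> LD LC L1 L2; elim/bipoly_ind => [|m u m0 u0|c|m m0|m m0].
- have L0 N : L N 0 = 0 by rewrite -[0](mul0r 1) -[0 : bipoly]/(bic 0) LC mul0r.
  by apply: null_ext null0 => N; rewrite L0 evE !horner0 mul0r subr0.
- by apply: null_ext (nullD m0 u0) => N; rewrite LD evD; ring.
- by apply: null_ext null0 => N; rewrite -[bic c]mulr1 LC mulr1 ev_bic subrr.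
- by apply: null_ext (nullD (L1 m) (nullZ z1 m0)) => N; rewrite evM ev_zz1; ring.
- by apply: null_ext (nullD (L2 m) (nullZ z2 m0)) => N; rewrite evM ev_zz2; ring.
Qed.

End Null.

(** * Convergence of double series *)

Section Series.
Local Open Scope ring_scope.
Variable C : numClosedFieldType.
Local Notation bipoly := {poly {poly C}}.
Implicit Types (m u : bipoly) (a b : nat -> nat -> C) (z w c e x y r K : C) (i k N M : nat)
  (s t v : nat -> C).

Hypothesis monotone_cauchy : forall (s : nat -> C) (K : C),
  (forall n, s n <= s n.+1) -> (forall n, s n <= K) ->
  forall e, 0 < e -> exists N, forall n, (N <= n)%N -> s n - s N < e.

Lemma Sev_D N a b z1 z2 :
  Sev N (fun i k => a i k + b i k) z1 z2 = Sev N a z1 z2 + Sev N b z1 z2.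
Proof.
rewrite /Sev -big_split /=; apply: eq_bigr => i _; rewrite -big_split /=.
by apply: eq_bigr => k _; ring.
Qed.

Lemma Sev_Z N c a z1 z2 : Sev N (fun i k => c * a i k) z1 z2 = c * Sev N a z1 z2.
Proof.
rewrite /Sev mulr_sumr; apply: eq_bigr => i _; rewrite mulr_sumr.
by apply: eq_bigr => k _; ring.
Qed.

Lemma Sev_ext N a b z1 z2 : (forall i k, a i k = b i k) -> Sev N a z1 z2 = Sev N b z1 z2.
Proof. by move=> ab; apply: eq_bigr => i _; apply: eq_bigr => k _; rewrite ab. Qed.

Lemma edge_bound K v x N : 0 <= K -> (forall k, `|v k| <= K) -> `|x| < 1 ->
  `|\sum_(k < N) v k * x ^+ k| <= K / (1 - `|x|).
Proof.
move=> K0 vK x1; apply: le_trans (ler_norm_sum _ _ _) _.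
apply: (@le_trans _ _ (K * \sum_(k < N) `|x| ^+ k)).
  by rewrite mulr_sumr; apply: ler_sum => k _; rewrite normrM normrX ler_wpM2r ?exprn_ge0.
by rewrite ler_wpM2l // geom_sum_le.
Qed.

(** The two partial sums differ by one edge row, which carries a high power of z1 and a bounded sum
    in z2. *)
Lemma Sev_shift1 a z1 z2 : bounded a -> `|z1| < 1 -> `|z2| < 1 ->
  null (fun N => Sev N (shift1 a) z1 z2 - z1 * Sev N a z1 z2).
Proof.
move=> [K hK] z11 z21; have K0 : 0 <= K := le_trans (normr_ge0 _) (hK 0%N 0%N).
have h0 : 0 <= K / (1 - `|z2|) by rewrite divr_ge0 // subr_ge0 ltW.
apply: null_le (nullZ (K / (1 - `|z2|)) (null_geom monotone_cauchy z11)) => N.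
case: N => [|N]; first by rewrite /Sev !big_ord0 mulr0 subr0 normr0.
rewrite {1}/Sev big_ord_recl /= big1 ?add0r => [|k _]; last by rewrite !mul0r.
rewrite /Sev big_ord_recr /= mulrDr mulr_sumr.
rewrite (_ : \sum_(i < N) _ = \sum_(i < N) z1 * \sum_(k < N.+1) a i k * z1 ^+ i * z2 ^+ k); last first.
  by apply: eq_bigr => i _; rewrite mulr_sumr; apply: eq_bigr => k _; rewrite exprS; ring.
rewrite opprD addrA subrr add0r normrN mulr_sumr.
rewrite (eq_bigr (fun k : 'I_N.+1 => z1 ^+ N.+1 * (a N k * z2 ^+ k))); last first.
  by move=> k _; rewrite exprS; ring.
rewrite -mulr_sumr normrM [leLHS]mulrC [leRHS]normrM (ger0_norm h0).
apply: ler_wpM2r => //; exact: edge_bound K0 (hK N) z21.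
Qed.

Lemma Sev_swap N a z1 z2 : Sev N a z1 z2 = Sev N (fun i k => a k i) z2 z1.
Proof.
rewrite /Sev exchange_big /=; apply: eq_bigr => i _; apply: eq_bigr => k _; ring.
Qed.

Lemma Sev_shift2 a z1 z2 : bounded a -> `|z1| < 1 -> `|z2| < 1 ->
  null (fun N => Sev N (shift2 a) z1 z2 - z2 * Sev N a z1 z2).
Proof.
move=> [K hK] z11 z21; have h : bounded (fun i k => a k i) by exists K => i k.
by apply: null_ext (Sev_shift1 h z21 z11) => N; rewrite !(Sev_swap N _ z1).
Qed.

Lemma Sev_act m a z1 z2 : bounded a -> `|z1| < 1 -> `|z2| < 1 ->
  null (fun N => Sev N (act m a) z1 z2 - ev m z1 z2 * Sev N a z1 z2).
Proof.
move=> ab z11 z21.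
have := @asymptotic_eval C (fun N m => Sev N (act m a) z1 z2) z1 z2.
move=> h; apply: null_ext (h _ _ _ _ m) => [N|N {}m u|N c {}m|{}m|{}m].
- by congr (_ - _ * _); apply: Sev_ext => i k; rewrite act1.
- by rewrite -Sev_D; apply: Sev_ext => i k; rewrite actD.
- by rewrite -Sev_Z; apply: Sev_ext => i k; rewrite act_bic.
- apply: null_ext (Sev_shift1 (bounded_act m ab) z11 z21) => N.
  by congr (_ - _); apply: Sev_ext => i k; rewrite act_zz1.
- apply: null_ext (Sev_shift2 (bounded_act m ab) z11 z21) => N.
  by congr (_ - _); apply: Sev_ext => i k; rewrite act_zz2.
Qed.

Lemma cf_sum_eval N m z1 z2 : (size m <= N)%N -> (forall k, (size (m`_k)%R <= N)%N) ->
  Sev N (cf m) z1 z2 = ev m z1 z2.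
Proof.
move=> sm smk; rewrite evE (horner_coef_wide _ sm) horner_sum /Sev exchange_big /=.
apply: eq_bigr => k _; rewrite hornerM -polyC_exp hornerC (horner_coef_wide _ (smk k)).
by rewrite mulr_suml.
Qed.

Lemma size_bound m : exists N, (size m <= N)%N /\ forall k, (size (m`_k)%R <= N)%N.
Proof.
exists (maxn (size m) (\max_(i < size m) size (m`_i)%R)); split; first exact: leq_maxl.
move=> k; have [km|km] := leqP (size m) k; first by rewrite nth_default // size_poly0.
by rewrite leq_max (leq_bigmax (Ordinal km)) orbT.
Qed.

Lemma cf_sum_null m z1 z2 : null (fun N => Sev N (cf m) z1 z2 - ev m z1 z2).
Proof.
have [N0 [h1 h2]] := size_bound m => e e0; exists N0 => N NN.
have h3 k : (size (m`_k)%R <= N)%N := leq_trans (h2 k) NN.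
by rewrite cf_sum_eval ?subrr ?normr0 // (leq_trans h1 NN).
Qed.

Lemma quotient_series p m z1 z2 : cf p 0 0 != 0 -> bounded (act m (inv_coef p)) ->
  `|z1| < 1 -> `|z2| < 1 -> ev p z1 z2 != 0 ->
  null (fun N => Sev N (act m (inv_coef p)) z1 z2 - ev m z1 z2 / ev p z1 z2).
Proof.
move=> p00 ab z11 z21 pz.
have h1 := Sev_act p ab z11 z21.
have h2 := cf_sum_null m z1 z2.
apply: null_ext (nullZ (ev p z1 z2)^-1 (nullD h2 (nullN h1))) => N.
rewrite (@Sev_ext _ (act p _) (cf m)); last first.
  by move=> i k; rewrite act_comp (mulrC p) act_mul_inv_coef.
by field.
Qed.

(* Boundary version at (tau, 0): square summability replaces |tau| < 1. *)
Lemma boundary_series p m tau : cf p 0 0 != 0 -> l2 (act m (inv_coef p)) ->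
  `|tau| = 1 -> ev p tau 0 != 0 ->
  null (fun N => \sum_(i < N) act m (inv_coef p) i 0 * tau ^+ i - ev m tau 0 / ev p tau 0).
Proof.
move=> p00 a2 t1 pt.
set a := act m (inv_coef p) in a2 *.
pose L N u := \sum_(i < N) act u a i 0 * tau ^+ i.
have h1 : null (fun N => L N p - ev p tau 0 * L N 1).
  apply: asymptotic_eval => [N u v|N c u|u|u].
  - by rewrite /L -big_split; apply: eq_bigr => i _; rewrite actD mulrDl.
  - by rewrite /L mulr_sumr; apply: eq_bigr => i _; rewrite act_bic mulrA.
  - have u0 := l2_null_row monotone_cauchy (l2_act u a2).
    move=> e e0; have [N hN] := u0 e e0; exists N.+1 => -[//|n] nN.
    rewrite /L big_ord_recl act_zz1 /= mul0r add0r big_ord_recr /= mulrDr mulr_sumr.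
    rewrite opprD addrA -sumrB big1 ?add0r => [|i _].
      by rewrite normrN !normrM normrX t1 expr1n mulr1 mul1r; exact: hN.
    by rewrite act_zz1 /= exprS; ring.
  - apply: null_ext (@null0 C) => N; rewrite mul0r subr0 /L big1 // => i _.
    by rewrite act_zz2 mul0r.
have h2 : null (fun N => L N p - ev m tau 0).
  have [N0 [s1 s2]] := size_bound m => e e0; exists N0.+1 => -[//|N] NN.
  suff -> : L N.+1 p = ev m tau 0 by rewrite subrr normr0.
  rewrite -(@cf_sum_eval N.+1) //; last by move=> k; apply: leq_trans (s2 k) _; exact: ltnW.
    apply: eq_bigr => i _; rewrite big_ord_recl big1 ?addr0 => [|k _]; last first.
      by rewrite expr0n mulr0.
    by rewrite expr0 mulr1 /a act_comp (mulrC p) act_mul_inv_coef.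
  by apply: leq_trans s1 _; exact: ltnW.
apply: null_ext (nullZ (ev p tau 0)^-1 (nullD h2 (nullN h1))) => N.
have -> : \sum_(i < N) a i 0%N * tau ^+ i = L N 1.
  by apply: eq_bigr => i _; rewrite act1.
by field.
Qed.

(* Letting x -> 0 isolates the lowest coefficient that does not vanish. *)
Lemma null_lowest_coef (v : nat -> nat -> C) K d : (forall N j, `|v N j| <= K) ->
  (forall N j, (j < d)%N -> v N j = 0) ->
  (forall x, 0 < x -> x < 1 -> null (fun N => \sum_(j < N) v N j * x ^+ j)) ->
  null (fun N => v N d).
Proof.
move=> vK v0 vn e e0; have K0 : 0 <= K := le_trans (normr_ge0 _) (vK 0%N 0%N).
(* Then x <= 1/2 and x K <= e/4, so the tail, at most x^(d+1) K / (1 - x), is at most x^d e/2. *)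
pose x := e / (4%:R * (e + K)).
have eK : 0 < e + K by rewrite ltr_wpDr.
have eK4 : 0 < 4%:R * (e + K) by rewrite mulr_gt0.
have x0 : 0 < x by rewrite divr_gt0.
have x2 : x <= 1 / 2%:R.
  rewrite /x ler_pdivrMr //.
  have -> : 1 / 2%:R * (4%:R * (e + K)) = e + (e + 2%:R * K) by field.
  by rewrite lerDl addr_ge0 ?mulr_ge0 // ltW.
have x1 : x < 1 by apply: le_lt_trans x2 _; rewrite mul1r invf_lt1 ?ltr0n // ltr1n.
have xd : 0 < x ^+ d by rewrite exprn_gt0.
have [N hN] := vn x x0 x1 _ (divr_gt0 (mulr_gt0 e0 xd) (ltr0n _ 2)).
exists (maxn N d.+1) => n; rewrite geq_max => /andP[/hN h dn].
have split_sum : \sum_(j < n) v n j * x ^+ j = v n d * x ^+ d +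
    x ^+ d.+1 * \sum_(j < n - d.+1) v n (d.+1 + j)%N * x ^+ j.
  rewrite -(big_mkord xpredT (fun j => v n j * x ^+ j)) (big_cat_nat _ dn) //=.
  rewrite big_nat_recr //= big_nat big1 ?add0r => [|j /andP[_ jd]]; last by rewrite v0 // mul0r.
  rewrite -{1}[d.+1]add0n big_addn big_mkord mulr_sumr; congr (_ + _).
  by apply: eq_bigr => j _; rewrite addnC exprD; ring.
have tail : `|x ^+ d.+1 * \sum_(j < n - d.+1) v n (d.+1 + j)%N * x ^+ j| <= x ^+ d * (e / 2%:R).
  have b := @edge_bound K (fun j => v n (d.+1 + j)%N) x (n - d.+1) K0 (fun j => vK _ _).
  rewrite (gtr0_norm x0) in b; have {}b := b x1.
  rewrite normrM normrX (gtr0_norm x0) exprSr -mulrA ler_pM2l //.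
  apply: le_trans (ler_wpM2l (ltW x0) b) _.
  have x12 : 1 / 2%:R <= 1 - x.
    by rewrite lerBrDr -lerBrDl (_ : 1 - 1 / 2%:R = 1 / 2%:R) //; field.
  have x10 : 0 < 1 - x by rewrite subr_gt0.
  rewrite mulrA ler_pdivrMr //; apply: (@le_trans _ _ (e / 2%:R * (1 / 2%:R))); last first.
    by rewrite ler_pM2l ?divr_gt0.
  rewrite /x mulrAC ler_pdivrMr //.
  have -> : e / 2%:R * (1 / 2%:R) * (4%:R * (e + K)) = e * (e + K) by field.
  by rewrite ler_pM2l // lerDr ltW.
have : `|v n d| * x ^+ d < e * x ^+ d.
  have -> : `|v n d| * x ^+ d = `|v n d * x ^+ d| by rewrite normrM normrX (gtr0_norm x0).
  have -> : v n d * x ^+ d = \sum_(j < n) v n j * x ^+ j -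
     x ^+ d.+1 * \sum_(j < n - d.+1) v n (d.+1 + j)%N * x ^+ j by rewrite split_sum addrK.
  apply: le_lt_trans (ler_normB _ _) _.
  have -> : e * x ^+ d = e * x ^+ d / 2%:R + x ^+ d * (e / 2%:R) by field.
  exact: ltr_leD.
by rewrite ltr_pM2r.
Qed.

Lemma series_coef_zero v K : (forall j, `|v j| <= K) ->
  (forall x, 0 < x -> x < 1 -> null (fun N => \sum_(j < N) v j * x ^+ j)) ->
  forall j, v j = 0.
Proof.
move=> vK vn; elim/ltn_ind => d IH; apply: null_const.
exact: (@null_lowest_coef (fun _ => v) K d).
Qed.

(** For fixed z1 = y the square sums are series in z2 whose coefficients, the partial sums over i <
    N, depend on N; this is why [null_lowest_coef] allows such coefficients. *)
Lemma double_series_coef_zero a : bounded a ->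
  (forall z1 z2, `|z1| < 1 -> `|z2| < 1 -> null (fun N => Sev N a z1 z2)) ->
  forall i k, a i k = 0.
Proof.
move=> [K aK] an i k; elim/ltn_ind: k i => k IH i.
have K0 : 0 <= K := le_trans (normr_ge0 _) (aK 0%N 0%N).
apply: (@series_coef_zero (fun i => a i k) K _ _ i) => [j|y y0 y1]; first exact: aK.
have y1' : `|y| < 1 by rewrite gtr0_norm.
refine (@null_lowest_coef (fun N j => \sum_(i < N) a i j * y ^+ i) (K / (1 - `|y|)) k _ _ _) => [N j|N j jk|x x0 x1].
- by apply: (@edge_bound K (fun i => a i j)).
- by rewrite big1 // => t _; rewrite IH // mul0r.
have x1' : `|x| < 1 by rewrite gtr0_norm.
apply: null_ext (an y x y1' x1') => N.
rewrite /Sev exchange_big /=; apply: eq_bigr => t _; rewrite mulr_suml.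
by apply: eq_bigr => j _.
Qed.

Lemma cauchy_schwarz (I : finType) (f g : I -> C) :
  `|\sum_i f i * (g i)^*| ^+ 2 <= (\sum_i `|f i| ^+ 2) * (\sum_i `|g i| ^+ 2).
Proof.
set A := \sum_i `|f i| ^+ 2; set B := \sum_i `|g i| ^+ 2; set S := \sum_i _.
have B0 : 0 <= B by apply: sumr_ge0 => i _; exact: exprn_ge0.
have Bc : B^* = B by rewrite conj_Creal // ger0_real.
(* Division-free projection: this product is the sum of |B f - S g|^2. *)
have key : 0 <= B * (A * B - `|S| ^+ 2).
  have -> : B * (A * B - `|S| ^+ 2) = \sum_i `|B * f i - S * g i| ^+ 2.
    have -> : \sum_i `|B * f i - S * g i| ^+ 2 =
        \sum_i (B * B * `|f i| ^+ 2 - B * S^* * (f i * (g i)^*)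
          - B * S * (f i * (g i)^*)^* + S * S^* * `|g i| ^+ 2).
      by apply: eq_bigr => i _; rewrite !normCK !conjE Bc; ring.
    rewrite big_split /= !sumrB -!mulr_sumr -/A -/B -/S -conj_sum -/S normCK; ring.
  by apply: sumr_ge0 => i _; exact: exprn_ge0.
have [Bz|Bn] := eqVneq B 0; last first.
  by move: key; rewrite pmulr_rge0 ?subr_ge0 // lt_def Bn.
have g0 (i : I) : g i = 0.
  move/eqP: Bz; rewrite /B psumr_eq0; last by move=> j _; exact: exprn_ge0.
  move/allP/(_ i (mem_index_enum i)) => /=.
  by rewrite expf_eq0 normr_eq0 /= => /eqP.
rewrite /S big1 ?normr0 ?expr0n /= => [|i _]; last by rewrite g0 conj0 mulr0.
by rewrite mulr_ge0 //; apply: sumr_ge0 => i _; exact: exprn_ge0.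
Qed.

Lemma ip_cauchy_schwarz N a b : `|ip N a b| ^+ 2 <= nsq N a * nsq N b.
Proof.
rewrite /ip /nsq !pair_bigA /=.
exact: (cauchy_schwarz (fun q : 'I_N * 'I_N => a q.1 q.2) (fun q => b q.1 q.2)).
Qed.

End Series.

(** * Bessel inequality and orthogonality *)

Section Bessel.
Local Open Scope ring_scope.
Variable C : numClosedFieldType.
Local Notation bipoly := {poly {poly C}}.
Implicit Types (m u : bipoly) (a b x : nat -> nat -> C) (z w c e r K : C) (i j k N M s t : nat).

Hypothesis monotone_cauchy : forall (s : nat -> C) (K : C),
  (forall n, s n <= s n.+1) -> (forall n, s n <= K) ->
  forall e, 0 < e -> exists N, forall n, (N <= n)%N -> s n - s N < e.

(** The identity is an equality in the polynomial space tensored with its conjugate, so a linear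
    functional may be applied to both factors. Since evaluations separate polynomials, [ell] can act
    first in z and then in w. *)
Lemma hermitian_transfer (l1 l2 : seq bipoly) (ell : bipoly -> C) :
  (forall z1 z2 w1 w2, \sum_(g <- l1) ev g z1 z2 * (ev g w1 w2)^* =
                       \sum_(g <- l2) ev g z1 z2 * (ev g w1 w2)^*) ->
  (forall m u, ell (m + u) = ell m + ell u) ->
  (forall c m, ell (bic c * m) = c * ell m) ->
  \sum_(g <- l1) `|ell g| ^+ 2 = \sum_(g <- l2) `|ell g| ^+ 2.
Proof.
move=> id ellD ellC.
have ell0 : ell 0 = 0 by rewrite -[0](mul0r 1) -[0 : bipoly]/(bic 0) ellC mul0r.
have ell_sum (l : seq bipoly) (h : bipoly -> C) :
    ell (\sum_(g <- l) bic (h g) * g) = \sum_(g <- l) h g * ell g.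
  elim: l => [|g l IH]; first by rewrite !big_nil.
  by rewrite !big_cons ellD ellC IH.
have ev_lin (l : seq bipoly) (h : bipoly -> C) z1 z2 :
    ev (\sum_(g <- l) bic (h g) * g) z1 z2 = \sum_(g <- l) h g * ev g z1 z2.
  by rewrite ev_sum; apply: eq_bigr => g _; rewrite evM ev_bic.
have step1 w1 w2 : \sum_(g <- l1) (ev g w1 w2)^* * ell g = \sum_(g <- l2) (ev g w1 w2)^* * ell g.
  rewrite -!ell_sum; congr ell; apply/eqP; rewrite -subr_eq0; apply/eqP.
  apply: ev_zero => z1 z2; rewrite evD evN !ev_lin.
  apply/eqP; rewrite subr_eq0; apply/eqP.
  by have := id z1 z2 w1 w2; under eq_bigr do rewrite mulrC;
     under [in RHS]eq_bigr do rewrite mulrC.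
have step2 : \sum_(g <- l1) bic ((ell g)^*) * g = \sum_(g <- l2) bic ((ell g)^*) * g.
  apply/eqP; rewrite -subr_eq0; apply/eqP.
  apply: ev_zero => w1 w2; rewrite evD evN !ev_lin.
  apply/eqP; rewrite subr_eq0; apply/eqP.
  have := congr1 Num.conj (step1 w1 w2); rewrite !conj_sum.
  by under eq_bigr do rewrite conjM conjCK mulrC;
     under [in RHS]eq_bigr do rewrite conjM conjCK mulrC.
have := congr1 ell step2; rewrite !ell_sum.
by under eq_bigr do rewrite mulrC -normCK; under [in RHS]eq_bigr do rewrite mulrC -normCK.
Qed.

(** A discrete divergence formula: F is the flux in the first index, H in the second, and only the
    four edges of the square remain. *)
Lemma telescope_square (D Phi F H : nat -> nat -> C) N :
  (forall s t, D s t + F s.+1 t + H s t.+1 = Phi s t + F s t + H s t) ->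
  \sum_(s < N) \sum_(t < N) Phi s t + \sum_(t < N) (F 0%N t - F N t)
    + \sum_(s < N) (H s 0%N - H s N) = \sum_(s < N) \sum_(t < N) D s t.
Proof.
move=> rel.
have PhiE s t : Phi s t = D s t + (F s.+1 t - F s t) + (H s t.+1 - H s t).
  by have := rel s t => e; rewrite -[LHS](addrK (F s t + H s t)) addrA -e; ring.
have tele (G : nat -> C) : \sum_(s < N) (G s.+1 - G s) = G N - G 0%N.
  by rewrite -(big_mkord xpredT (fun s => G s.+1 - G s)) telescope_sumr.
have PhiS : \sum_(s < N) \sum_(t < N) Phi s t = \sum_(s < N) \sum_(t < N) D s t
    + \sum_(s < N) \sum_(t < N) (F s.+1 t - F s t)
    + \sum_(s < N) \sum_(t < N) (H s t.+1 - H s t).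
  rewrite -!big_split /=; apply: eq_bigr => s _; rewrite -!big_split /=.
  by apply: eq_bigr => t _; rewrite PhiE.
have teleF : \sum_(s < N) \sum_(t < N) (F s.+1 t - F s t) = - \sum_(t < N) (F 0%N t - F N t).
  rewrite exchange_big /= -sumrN; apply: eq_bigr => t _.
  by rewrite (tele (fun s => F s t)) opprB.
have teleH : \sum_(s < N) \sum_(t < N) (H s t.+1 - H s t) = - \sum_(s < N) (H s 0%N - H s N).
  by rewrite -sumrN; apply: eq_bigr => s _; rewrite (tele (H s)) opprB.
by rewrite PhiS teleF teleH; ring.
Qed.

Variables (n : nat) (p q Q : bipoly) (R : nat -> bipoly).
Hypothesis p00 : cf p 0 0 != 0.
Hypothesis identity : forall z1 z2 w1 w2,
  ev p z1 z2 * (ev p w1 w2)^* - ev q z1 z2 * (ev q w1 w2)^* =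
  (1 - z1 * w1^*) * (\sum_(j < n) ev (R j) z1 z2 * (ev (R j) w1 w2)^*)
  + (1 - z2 * w2^*) * (ev Q z1 z2 * (ev Q w1 w2)^*).

Let e0 := inv_coef p.

(** With the negative terms moved across, both sides of the decomposition multiplied by m(z)
    conj(m(w)) are sums of squares, to which a functional can be transferred. *)
Lemma lurking_isometry (ell : bipoly -> C) m :
  (forall m u, ell (m + u) = ell m + ell u) ->
  (forall c m, ell (bic c * m) = c * ell m) ->
  `|ell (m * p)| ^+ 2 + \sum_(j < n) `|ell (zz1 C * m * R j)| ^+ 2 + `|ell (zz2 C * m * Q)| ^+ 2 =
  `|ell (m * q)| ^+ 2 + \sum_(j < n) `|ell (m * R j)| ^+ 2 + `|ell (m * Q)| ^+ 2.
Proof.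
move=> ellD ellC.
pose l1 := m * p :: zz2 C * m * Q :: [seq zz1 C * m * R j | j <- index_iota 0 n].
pose l2 := m * q :: m * Q :: [seq m * R j | j <- index_iota 0 n].
have := @hermitian_transfer l1 l2 ell _ ellD ellC.
rewrite /l1 /l2 !big_cons !big_map !big_mkord => h.
rewrite addrAC -addrA h; first by rewrite addrAC addrA.
move=> z1 z2 w1 w2; rewrite !big_cons !big_map !big_mkord !evM !ev_zz2.
have e1 : \sum_(j < n) ev (zz1 C * m * R j) z1 z2 * (ev (zz1 C * m * R j) w1 w2)^* =
   z1 * w1^* * (ev m z1 z2 * (ev m w1 w2)^*) *
    (\sum_(j < n) ev (R j) z1 z2 * (ev (R j) w1 w2)^*).
  by rewrite mulr_sumr; apply: eq_bigr => j _; rewrite !evM !ev_zz1 !conjE; ring.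
have e2 : \sum_(j < n) ev (m * R j) z1 z2 * (ev (m * R j) w1 w2)^* =
   (ev m z1 z2 * (ev m w1 w2)^*) *
    (\sum_(j < n) ev (R j) z1 z2 * (ev (R j) w1 w2)^*).
  by rewrite mulr_sumr; apply: eq_bigr => j _; rewrite !evM !conjE; ring.
rewrite e1 e2 !conjE; have := identity z1 z2 w1 w2.
set S := \sum_(j < n) _ => id.
apply/eqP; rewrite -subr_eq0; apply/eqP.
transitivity ((ev m z1 z2 * (ev m w1 w2)^*) * (
  (ev p z1 z2 * (ev p w1 w2)^* - ev q z1 z2 * (ev q w1 w2)^*) -
  ((1 - z1 * w1^*) * S + (1 - z2 * w2^*) * (ev Q z1 z2 * (ev Q w1 w2)^*)))); first by ring.
by rewrite id subrr mulr0.
Qed.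

(** The functional u -> <u/p, x> restricted to the square, for an arbitrary array x. *)
Let ell N x u := ip N (act u e0) x.

Let ellD N x m u : ell N x (m + u) = ell N x m + ell N x u.
Proof.
rewrite /ell /ip -big_split /=; apply: eq_bigr => i _; rewrite -big_split /=.
by apply: eq_bigr => k _; rewrite actD mulrDl.
Qed.
Let ellC N x c m : ell N x (bic c * m) = c * ell N x m.
Proof.
rewrite /ell /ip mulr_sumr; apply: eq_bigr => i _; rewrite mulr_sumr.
by apply: eq_bigr => k _; rewrite act_bic mulrA.
Qed.

Definition mon s t : bipoly := zz1 C ^+ s * zz2 C ^+ t.

Lemma act_mon1 s t m a i k : (i < s)%N -> act (mon s t * m) a i k = 0.
Proof.
rewrite /mon -mulrA; move: (_ * m) => u; elim: s i => // s IH i.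
by rewrite exprS -mulrA act_zz1; case: i => // i; exact: IH.
Qed.
Lemma act_mon2 s t m a i k : (k < t)%N -> act (mon s t * m) a i k = 0.
Proof.
rewrite /mon (mulrC (_ ^+ s)) -mulrA; move: (_ * m) => u; elim: t k => // t IH k.
by rewrite exprS -mulrA act_zz2; case: k => // k; exact: IH.
Qed.

Lemma cf_mon s t i k : cf (mon s t) i k = ((i == s) && (k == t))%:R.
Proof.
rewrite /mon; elim: s i => [|s IH] i.
  rewrite expr0 mul1r; elim: t k => [|t IH] k.
    by rewrite expr0 -act_delta act1.
  by rewrite exprS cf_zz2; case: k => [|k]; rewrite ?andbF ?IH.
by rewrite exprS -mulrA cf_zz1; case: i => [|i]; rewrite ?IH.
Qed.

Let ell_mon_p N x s t : (s < N)%N -> (t < N)%N -> ell N x (mon s t * p) = (x s t)^*.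
Proof.
move=> sN tN; rewrite /ell /ip (bigD1 (Ordinal sN)) //= (bigD1 (Ordinal tN)) //=.
rewrite act_mul_inv_coef // cf_mon !eqxx mul1r !big1 ?addr0 // => [i si|k tk].
  apply: big1 => k _; rewrite act_mul_inv_coef // cf_mon.
  by rewrite -val_eqE /= in si; rewrite (negPf si) mul0r.
rewrite act_mul_inv_coef // cf_mon.
by rewrite -val_eqE /= in tk; rewrite (negPf tk) andbF mul0r.
Qed.

Lemma bessel N x :
  \sum_(s < N) \sum_(t < N) `|ell N x (mon s t * q)| ^+ 2
  + \sum_(t < N) \sum_(j < n) `|ell N x (mon 0 t * R j)| ^+ 2
  + \sum_(s < N) `|ell N x (mon s 0 * Q)| ^+ 2 = nsq N x.
Proof.
have := @telescope_square (fun s t => `|ell N x (mon s t * p)| ^+ 2)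
  (fun s t => `|ell N x (mon s t * q)| ^+ 2)
  (fun s t => \sum_(j < n) `|ell N x (mon s t * R j)| ^+ 2)
  (fun s t => `|ell N x (mon s t * Q)| ^+ 2) N.
move=> h; rewrite -[RHS](_ : \sum_(s < N) \sum_(t < N) `|ell N x (mon s t * p)| ^+ 2 = _); last first.
  by apply: eq_bigr => s _; apply: eq_bigr => t _; rewrite ell_mon_p // norm_conjC.
rewrite -h => [|s t]; last first.
  have := lurking_isometry (mon s t) (ellD N x) (ellC N x).
  have -> : zz2 C * mon s t = mon s t.+1 by rewrite /mon exprS; ring.
  have e : zz1 C * mon s t = mon s.+1 t by rewrite /mon exprS; ring.
  by under [X in _ + X + _ = _]eq_bigr do rewrite e.
congr (_ + _ + _); apply: eq_bigr => i _.
  rewrite [X in _ - X]big1 ?subr0 // => j _.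
  rewrite /ell /ip big1 ?normr0 ?expr0n // => i' _; apply: big1 => k' _.
  by rewrite act_mon1 // mul0r.
rewrite [X in _ - X](_ : _ = 0) ?subr0 //.
rewrite /ell /ip big1 ?normr0 ?expr0n // => i' _; apply: big1 => k' _.
by rewrite act_mon2 // mul0r.
Qed.

Let mon00 m : mon 0 0 * m = m.
Proof. by rewrite /mon !expr0 !mul1r. Qed.

Let sq_sum0 (I : finType) (F : I -> C) : 0 <= \sum_i `|F i| ^+ 2.
Proof. by apply: sumr_ge0 => i _; exact: exprn_ge0. Qed.

Lemma bessel_R N x :
  \sum_(s < N) \sum_(t < N) `|ip N (act (mon s t * q) e0) x| ^+ 2
  + \sum_(j < n) `|ip N (act (R j) e0) x| ^+ 2 <= nsq N x.
Proof.
case: N => [|N].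
  rewrite /nsq !big_ord0 add0r big1 // => j _.
  by rewrite /ip big_ord0 normr0 expr0n.
rewrite -bessel -[leRHS]addrA lerD2l.
rewrite -[leLHS]addr0; apply: lerD; last exact: sq_sum0.
rewrite big_ord_recl /=.
under [X in _ <= X + _]eq_bigr do rewrite mon00.
by rewrite lerDl; apply: sumr_ge0 => t _.
Qed.

Lemma bessel_Q N x : `|ip N (act Q e0) x| ^+ 2 <= nsq N x.
Proof.
case: N => [|N].
  by rewrite /nsq /ip !big_ord0 normr0 expr0n.
rewrite -bessel [X in _ + X]big_ord_recl /= mon00.
rewrite [leRHS]addrCA lerDl; apply: addr_ge0; last exact: sq_sum0.
apply: addr_ge0; apply: sumr_ge0 => s _; exact: sq_sum0.
Qed.

(* Testing the Bessel inequality against the truncations of a function itself. *)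
Lemma norm_le1 (a : nat -> nat -> C) : (forall N, `|ip N a a| ^+ 2 <= nsq N a) ->
  forall N, nsq N a <= 1.
Proof.
move=> h N; have := h N.
have -> : ip N a a = nsq N a.
  by apply: eq_bigr => i _; apply: eq_bigr => k _; rewrite normCK.
rewrite ger0_norm ?nsq_ge0 // expr2.
have [->|n0] := eqVneq (nsq N a) 0; first by rewrite ler01.
have np : 0 < nsq N a by rewrite lt_def n0 nsq_ge0.
by rewrite -{3}[nsq N a]mulr1 ler_pM2l.
Qed.

Lemma ip_self N a : ip N a a = nsq N a.
Proof. by apply: eq_bigr => i _; apply: eq_bigr => k _; rewrite normCK. Qed.

Lemma norm_R j N : (j < n)%N -> nsq N (act (R j) e0) <= 1.
Proof.
move=> jn; apply: norm_le1 => {}N.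
apply: le_trans (bessel_R N _); rewrite (bigD1 (Ordinal jn)) //= addrCA lerDl.
apply: addr_ge0; first by apply: sumr_ge0 => s _; exact: sq_sum0.
by apply: sumr_ge0 => i _; exact: exprn_ge0.
Qed.

Lemma norm_Q N : nsq N (act Q e0) <= 1.
Proof. by apply: norm_le1 => {}N; exact: bessel_Q. Qed.

Let l2_R j : (j < n)%N -> l2 (act (R j) e0).
Proof. by move=> jn; exists 1 => N; exact: norm_R. Qed.
Let l2_Q : l2 (act Q e0).
Proof. by exists 1 => N; exact: norm_Q. Qed.

(** The same isometry with the functional u -> coefficient (s, t) of u/p. Now the near edges vanish,
    p/p = 1 contributes the constant 1, and the far edges are the last row of R_j/p and the last
    column of Q/p. *)
Lemma norm_q_formula N : nsq N.+1 (act q e0) =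
  1 - \sum_(k < N.+1) \sum_(j < n) `|act (R j) e0 N k| ^+ 2
    - \sum_(i < N.+1) `|act Q e0 i N| ^+ 2.
Proof.
(* For coefficient functionals multiplication by z1 lowers the index instead of raising it, hence
   the shift and the minus sign. *)
pose F' s t := - \sum_(j < n) `|shift1 (act (R j) e0) s t| ^+ 2.
pose H' s t := - `|shift2 (act Q e0) s t| ^+ 2.
have rel s t : `|act p e0 s t| ^+ 2 + F' s.+1 t + H' s t.+1 = `|act q e0 s t| ^+ 2 + F' s t + H' s t.
  have := @lurking_isometry (fun u => act u e0 s t) 1 (fun m u => actD m u e0 s t)
    (fun c m => act_bic c m e0 s t).
  have -> : \sum_(j < n) `|act (zz1 C * 1 * R j) e0 s t| ^+ 2 = - F' s t.
    by rewrite opprK; apply: eq_bigr => j _; rewrite mulr1 act_zz1.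
  have -> : \sum_(j < n) `|act (1 * R j) e0 s t| ^+ 2 = - F' s.+1 t.
    by rewrite opprK; apply: eq_bigr => j _; rewrite mul1r.
  rewrite !mul1r mulr1 act_zz2 -/(shift2 (act Q e0) s t).
  rewrite -[`|act Q e0 s t| ^+ 2]opprK -[- `|act Q e0 s t| ^+ 2]/(H' s t.+1).
  rewrite -[`|shift2 _ _ _| ^+ 2]opprK -[- `|shift2 _ _ _| ^+ 2]/(H' s t) => h.
  transitivity (`|act p e0 s t| ^+ 2 - F' s t - H' s t + F' s t + H' s t + F' s.+1 t + H' s t.+1).
    by ring.
  by rewrite h; ring.
have := telescope_square N.+1 rel.
have -> : \sum_(s < N.+1) \sum_(t < N.+1) `|act p e0 s t| ^+ 2 = 1.
  rewrite big_ord_recl big_ord_recl /= act_inv_coef // normr1 expr1n.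
  rewrite !big1 ?addr0 // => [i _|k _].
    by apply: big1 => k _; rewrite act_inv_coef // normr0 expr0n.
  by rewrite act_inv_coef // normr0 expr0n.
have -> : \sum_(t < N.+1) (F' 0%N t - F' N.+1 t) =
    \sum_(k < N.+1) \sum_(j < n) `|act (R j) e0 N k| ^+ 2.
  apply: eq_bigr => t _; rewrite /F' /= big1 ?opprK ?oppr0 ?add0r // => j _.
  by rewrite normr0 expr0n.
have -> : \sum_(t < N.+1) (H' t 0%N - H' t N.+1) = \sum_(i < N.+1) `|act Q e0 i N| ^+ 2.
  by apply: eq_bigr => t _; rewrite /H' /= normr0 expr0n oppr0 opprK add0r.
by move=> <-; rewrite -/(nsq N.+1 (act q e0)); ring.
Qed.

Lemma norm_q_le1 N : nsq N (act q e0) <= 1.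
Proof.
apply: le_trans (nsq_leS N _) _; rewrite norm_q_formula -addrA gerDl -opprD oppr_le0.
by apply: addr_ge0 => //; apply: sumr_ge0 => k _; exact: sq_sum0.
Qed.

Lemma null_norm_q : null (fun N => 1 - nsq N (act q e0)).
Proof.
have hR := null_sum (fun j : 'I_n => l2_increment monotone_cauchy (l2_R (ltn_ord j))).
have hQ := l2_increment monotone_cauchy l2_Q.
have h : null (fun N => 1 - nsq N.+1 (act q e0)).
  apply: null_le (nullD hR hQ) => N.
  rewrite norm_q_formula.
  set A := \sum_(k < N.+1) _; set B := \sum_(i < N.+1) _.
  have -> : 1 - (1 - A - B) = A + B by ring.
  have A0 : 0 <= A by apply: sumr_ge0 => k _; exact: sq_sum0.
  have B0 : 0 <= B by exact: sq_sum0.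
  have R0 : 0 <= \sum_(j < n) (nsq N.+1 (act (R j) e0) - nsq N (act (R j) e0)).
    by apply: sumr_ge0 => j _; rewrite subr_ge0 nsq_leS.
  have Q0 : 0 <= nsq N.+1 (act Q e0) - nsq N (act Q e0) by rewrite subr_ge0 nsq_leS.
  rewrite (ger0_norm (addr_ge0 A0 B0)) (ger0_norm (addr_ge0 R0 Q0)).
  apply: lerD; last exact: nsq_col.
  by rewrite /A exchange_big /=; apply: ler_sum => j _; exact: nsq_row.
move=> e e0'; have [N hN] := h e e0'; exists N.+1 => -[//|M] MN; exact: hN.
Qed.

Let act_mon_shift i m a j k : act (mon i.+1 0 * m) a j k = shift1 (act (mon i 0 * m) a) j k.
Proof.
have -> : mon i.+1 0 * m = zz1 C * (mon i 0 * m) by rewrite /mon exprS; ring.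
exact: act_zz1.
Qed.

Lemma nsq_mon_le i m N : nsq N (act (mon i 0 * m) e0) <= nsq N (act m e0).
Proof.
elim: i => [|i IH]; first by rewrite mon00.
apply: le_trans _ IH; rewrite (@nsq_ext _ _ _ (shift1 (act (mon i 0 * m) e0))).
  exact: nsq_shift1_le.
by move=> j k; exact: act_mon_shift.
Qed.

Lemma nsq_mon_ge i m N : nsq N (act m e0) <= nsq (N + i) (act (mon i 0 * m) e0).
Proof.
elim: i => [|i IH]; first by rewrite mon00 addn0.
apply: le_trans IH _; rewrite addnS (@nsq_ext _ _.+1 _ (shift1 (act (mon i 0 * m) e0))).
  exact: nsq_shift1_ge.
by move=> j k; exact: act_mon_shift.
Qed.

(* phi z1^i has norm one, so the Bessel inequality tested against it leaves no
   room for the inner product with R_j / p. *)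
Lemma null_ip_q j i : (j < n)%N ->
  null (fun N => ip N (act (R j) e0) (act (mon i 0 * q) e0)).
Proof.
move=> jn; apply: null_sqr => e e0'.
have [N0 hN] := null_norm_q e0'; exists (maxn (N0 + i) i.+1) => N.
rewrite geq_max => /andP[N0N iN].
set x := act (mon i 0 * q) e0.
have xle : nsq N x <= 1 := le_trans (nsq_mon_le i q N) (norm_q_le1 N).
have iN' : (i <= N)%N := ltnW iN.
have N0N' : (N0 <= N - i)%N by rewrite leq_subRL // addnC.
have xge : nsq (N - i) (act q e0) <= nsq N x.
  by have := nsq_mon_ge i q (N - i); rewrite subnK.
have b : nsq N x ^+ 2 + `|ip N (act (R j) e0) x| ^+ 2 <= nsq N x.
  apply: le_trans (bessel_R N x); apply: lerD.
    rewrite (bigD1 (Ordinal iN)) //= (bigD1 (Ordinal (leq_ltn_trans (leq0n i) iN))) //=.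
    rewrite -/x ip_self ger0_norm ?nsq_ge0 // -addrA lerDl addr_ge0 //.
      by apply: sumr_ge0 => t _; exact: exprn_ge0.
    by apply: sumr_ge0 => s _; exact: sq_sum0.
  rewrite (bigD1 (Ordinal jn)) //= lerDl; apply: sumr_ge0 => k _; exact: exprn_ge0.
rewrite ger0_norm ?exprn_ge0 //.
apply: (@le_lt_trans _ _ (1 - nsq N x)).
  apply: (@le_trans _ _ (nsq N x - nsq N x ^+ 2)); first by rewrite lerBrDl.
  by rewrite expr2 -{1}[nsq N x]mulr1 -mulrBr ler_piMl // subr_ge0.
have := hN _ N0N'; rewrite ger0_norm ?subr_ge0 ?norm_q_le1 //.
by apply: le_lt_trans; rewrite lerD2l lerN2.
Qed.

(** A multiple of z1^I has only rows from I on, so Cauchy-Schwarz sees only the tail of a. *)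
Lemma ip_tail I M a m : (I <= M)%N ->
  `|ip M a (act (mon I 0 * m) e0)| ^+ 2 <=
    (nsq M a - nsq I a) * nsq M (act (mon I 0 * m) e0).
Proof.
move=> IM; pose a1 i k := if (i < I)%N then 0 else a i k.
pose a2 i k := if (i < I)%N then a i k else 0.
have -> : ip M a (act (mon I 0 * m) e0) = ip M a1 (act (mon I 0 * m) e0).
  apply: eq_bigr => i _; apply: eq_bigr => k _; rewrite /a1; case: ifP => // iI.
  by rewrite act_mon1 // conj0 !mulr0.
apply: le_trans (ip_cauchy_schwarz _ _ _) _; apply: ler_wpM2r; first exact: nsq_ge0.
have -> : nsq M a = nsq M a1 + nsq M a2.
  rewrite /nsq -big_split /=; apply: eq_bigr => i _; rewrite -big_split /=.
  apply: eq_bigr => k _; rewrite /a1 /a2; case: ifP => _.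
    by rewrite normr0 expr0n add0r.
  by rewrite normr0 expr0n addr0.
rewrite -addrA lerDl subr_ge0; apply: le_trans (nsq_mono a2 IM).
by rewrite /nsq; apply: ler_sum => i _; rewrite /a2 ltn_ord.
Qed.

Lemma ip_swap N a b : ip N a b = (ip N b a)^*.
Proof.
rewrite /ip conj_sum; apply: eq_bigr => i _; rewrite conj_sum.
by apply: eq_bigr => k _; rewrite conjM conjCK mulrC.
Qed.

(* The relation (z1 - tau) R_j = e (q - al p) telescopes <f, z1^i f> tau^i;
   the boundary term tends to 0 and what remains is the Taylor series of
   f(., 0) at tau. *)
Lemma exceptional_norm j tau e al : (j < n)%N -> `|tau| = 1 ->
  zz1 C * R j = bic tau * R j + bic e * q + bic (- (e * al)) * p ->
  ev p tau 0 != 0 -> e^* * tau * al^* * (ev (R j) tau 0 / ev p tau 0) = 1 ->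
  null (fun N => 1 - nsq N (act (R j) e0)).
Proof.
move=> jn t1 rel pt bd; set f := act (R j) e0.
have tt := unit_mulconj t1.
pose h M u := ip M f (act u e0).
have hE M u : h M u = (ell M f u)^* by rewrite /h ip_swap.
have hD M u v : h M (u + v) = h M u + h M v by rewrite !hE ellD conjD.
have hC M c u : h M (bic c * u) = c^* * h M u by rewrite !hE ellC conjM.
have hp M i : (i < M)%N -> h M (mon i 0 * p) = f i 0%N.
  by move=> iM; rewrite hE ell_mon_p ?conjCK // (leq_ltn_trans _ iM).
have step M i : (i < M)%N -> tau ^+ i.+1 * h M (mon i.+1 0 * R j) =
    tau ^+ i * h M (mon i 0 * R j) + e^* * tau ^+ i.+1 * h M (mon i 0 * q)
    - e^* * tau * al^* * (f i 0%N * tau ^+ i).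
  move=> iM; have -> : mon i.+1 0 * R j = bic tau * (mon i 0 * R j) +
      bic e * (mon i 0 * q) + bic (- (e * al)) * (mon i 0 * p).
    transitivity (mon i 0 * (zz1 C * R j)); first by rewrite /mon exprS; ring.
    by rewrite rel; ring.
  rewrite !hD !hC hp // conjN conjM exprS.
  transitivity ((tau * tau^*) * (tau ^+ i * h M (mon i 0 * R j)) +
    e^* * (tau * tau ^+ i) * h M (mon i 0 * q) - e^* * tau * al^* * (f i 0%N * tau ^+ i)).
    by ring.
  by rewrite tt mul1r.
have tele M I : (I <= M)%N -> nsq M f = tau ^+ I * h M (mon I 0 * R j)
    - \sum_(i < I) e^* * tau ^+ i.+1 * h M (mon i 0 * q)
    + e^* * tau * al^* * \sum_(i < I) f i 0%N * tau ^+ i.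
  elim: I => [|I IH] IM.
    by rewrite !big_ord0 mulr0 addr0 subr0 mul1r mon00 /h ip_self.
  rewrite IH ?(ltnW IM) // !big_ord_recr /= step //; ring.
have f2 : l2 f := l2_R jn.
move=> eps eps0; have eps4 : 0 < eps / 4%:R by rewrite divr_gt0.
have [N0 hN0] := monotone_cauchy (fun N => nsq_leS N f) (fun N => norm_R N jn) (exprn_gt0 2 eps4).
have [N1 hN1] := nullZ (e^* * tau * al^*) (boundary_series monotone_cauchy p00 f2 t1 pt) eps4.
(* I is fixed before M: [null_ip_q] is applied separately to each i < I, so these finitely many
   terms are made small by taking M large afterwards. *)
set I := maxn N0 N1.
have nI : null (fun M => \sum_(i < I) e^* * tau ^+ i.+1 * h M (mon i 0 * q)).
  by apply: null_sum => i; apply: nullZ; exact: null_ip_q.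
have [N2 hN2] := nI _ eps4.
exists (maxn I N2) => M; rewrite geq_max => /andP[IM N2M].
have N0I : (N0 <= I)%N by rewrite leq_maxl.
have N1I : (N1 <= I)%N by rewrite leq_maxr.
have a1 : `|tau ^+ I * h M (mon I 0 * R j)| < eps / 4%:R.
  rewrite normrM normrX t1 expr1n mul1r -(@ltr_pXn2r _ 2) ?nnegrE ?(ltW eps4) //.
  apply: le_lt_trans (hN0 M (leq_trans N0I IM)).
  apply: le_trans (ip_tail f (R j) IM) _.
  apply: (@le_trans _ _ (nsq M f - nsq I f)).
    rewrite ler_piMr ?subr_ge0 ?nsq_mono //.
    exact: le_trans (nsq_mon_le I (R j) M) (norm_R M jn).
  by rewrite lerD2l lerN2 nsq_mono.
have a2 := hN2 M N2M; have a3 := hN1 I N1I; rewrite mulrBr bd -/f in a3.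
rewrite (tele M I IM).
set X := tau ^+ I * _ in a1 *; set Y := \sum_(i < I) _ in a2 *.
set Z := e^* * tau * al^* * _ in a3 *.
have -> : 1 - (X - Y + Z) = - X + Y + - (Z - 1) by ring.
apply: le_lt_trans (ler_normD _ _) _; rewrite normrN.
apply: (@lt_le_trans _ _ (eps / 4%:R + eps / 4%:R + eps / 4%:R)).
  apply: ltrD => //; apply: le_lt_trans (ler_normD _ _) _; rewrite normrN; exact: ltrD.
rewrite [leRHS](_ : eps = eps / 4%:R + eps / 4%:R + eps / 4%:R + eps / 4%:R); last by field.
by rewrite lerDl ltW.
Qed.

Lemma saturated_orthogonal j k : (j < n)%N -> (k < n)%N -> j != k ->
  null (fun N => 1 - nsq N (act (R k) e0)) ->
  null (fun N => ip N (act (R j) e0) (act (R k) e0)).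
Proof.
move=> jn kn jk nk; apply: null_sqr; apply: null_le nk => N.
set x := act (R k) e0.
have xle : nsq N x <= 1 := norm_R N kn.
have b : nsq N x ^+ 2 + `|ip N (act (R j) e0) x| ^+ 2 <= nsq N x.
  apply: le_trans (bessel_R N x); apply: ler_wpDl.
    by apply: sumr_ge0 => s _; exact: sq_sum0.
  rewrite (bigD1 (Ordinal kn)) //= (bigD1 (Ordinal jn)) //=.
  rewrite -/x ip_self (ger0_norm (nsq_ge0 _ _)) addrA lerDl.
  by apply: sumr_ge0 => i _; exact: exprn_ge0.
rewrite ger0_norm ?exprn_ge0 ?normr_ge0 // [leRHS]ger0_norm ?subr_ge0 //.
apply: (@le_trans _ _ (nsq N x - nsq N x ^+ 2)); first by rewrite lerBrDl.
by rewrite expr2 -{1}[nsq N x]mulr1 -mulrBr ler_piMl // subr_ge0.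
Qed.

Lemma trunc_monomials N a : trunc N a = \sum_(s < N) \sum_(t < N) bic (a s t) * mon s t.
Proof.
rewrite exchange_big /= /trunc poly_def; apply: eq_bigr => t _.
rewrite -mul_polyC poly_def rmorph_sum /= mulr_suml; apply: eq_bigr => s _.
by rewrite -mul_polyC polyCM mulrA /mon /zz1 polyC_exp.
Qed.

(** The array b belongs to phi h. The Bessel remainder bounds the square sum of <R_j/p, z1^s z2^t
    phi> by 1 - ||R_j/p||^2, and Cauchy-Schwarz against the coefficients of h does the rest. *)
Lemma saturated_orthogonal_range j hc b : (j < n)%N ->
  null (fun N => 1 - nsq N (act (R j) e0)) -> l2 hc ->
  (forall i k, act p b i k = act q hc i k) ->
  null (fun N => ip N (act (R j) e0) b).
Proof.
move=> jn nj [K hK] pb; apply: null_sqr; apply: null_le (nullZ K nj) => N.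
set f := act (R j) e0.
have fle : nsq N f <= 1 := norm_R N jn.
(* Inside the square the coefficients of phi h depend only on the truncation of h, which is a
   polynomial. *)
have -> : ip N f b = (ell N f (q * trunc N hc))^*.
  rewrite /ell -ip_swap; apply: eq_bigr => i _; apply: eq_bigr => k _; congr (_ * _^*).
  apply: (act_injective p00) => i' k' ii kk.
  have iN : (i' < N)%N by apply: leq_ltn_trans ii _.
  have kN : (k' < N)%N by apply: leq_ltn_trans kk _.
  by rewrite pb act_comp (mulrC p) act_mul_inv_coef // (actE _ _ iN kN).
have ell_sum (I : Type) (r : seq I) (F : I -> bipoly) :
    ell N f (\sum_(i <- r) F i) = \sum_(i <- r) ell N f (F i).
  elim: r => [|i r IH]; last by rewrite !big_cons ellD IH.
  rewrite !big_nil /ell /ip big1 // => i _; apply: big1 => k _.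
  by rewrite act0 mul0r.
rewrite norm_conjC.
have -> : ell N f (q * trunc N hc) = ip N hc (fun s t => (ell N f (mon s t * q))^*).
  rewrite trunc_monomials mulr_sumr ell_sum; apply: eq_bigr => s _.
  rewrite mulr_sumr ell_sum; apply: eq_bigr => t _.
  by rewrite mulrCA ellC conjCK (mulrC q).
rewrite ger0_norm ?exprn_ge0 ?normr_ge0 //.
apply: le_trans (ip_cauchy_schwarz _ _ _) _.
have b1 : nsq N (fun s t => (ell N f (mon s t * q))^*) <= 1 - nsq N f.
  have : nsq N (fun s t => (ell N f (mon s t * q))^*) + nsq N f ^+ 2 <= nsq N f.
    apply: le_trans (bessel_R N f); apply: lerD.
      apply: ler_sum => s _; apply: ler_sum => t _; by rewrite norm_conjC.
    rewrite (bigD1 (Ordinal jn)) //= -/f ip_self (ger0_norm (nsq_ge0 _ _)) lerDl.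
    by apply: sumr_ge0 => i _; exact: exprn_ge0.
  rewrite -lerBrDr => h; apply: le_trans h _.
  by rewrite expr2 -{1}[nsq N f]mulr1 -mulrBr ler_piMl // subr_ge0.
have K0 : 0 <= K := le_trans (nsq_ge0 _ _) (hK N).
rewrite [leRHS]normrM (ger0_norm K0) [X in _ <= _ * X]ger0_norm ?subr_ge0 //.
by apply: ler_pM => //; exact: nsq_ge0.
Qed.

End Bessel.

(** * Common factors and simple roots of one-variable polynomials *)

Section Structure.
Local Open Scope ring_scope.
Variable C : numClosedFieldType.
Implicit Types (f g A B b : {poly C}) (z tau : C).

Lemma coprime_proportional A B b1 b2 : coprimep b1 b2 -> b2 != 0 -> A * b2 = B * b1 ->
  exists g, A = g * b1 /\ B = g * b2.
Proof.
move=> cop b20 AB.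
have : b2 %| B * b1 by rewrite -AB dvdp_mull.
rewrite Gauss_dvdpl ?(coprimep_sym b2) // => /dvdpP[g Bg].
exists g; split=> //; apply: (mulIf b20); rewrite AB Bg; ring.
Qed.

Lemma simple_roots_factor g (ts : seq C) : g != 0 ->
  (forall z, root g z = (z \in ts)) -> (forall z, z \in ts -> g^`().[z] != 0) -> uniq ts ->
  g = lead_coef g *: \prod_(x <- ts) ('X - x%:P).
Proof.
move=> g0 gts g' uts; have [s gE] := closed_field_poly_normal g.
have lg : lead_coef g != 0 by rewrite lead_coef_eq0.
have sts z : (z \in s) = (z \in ts) by rewrite -gts gE rootZ // root_prod_XsubC.
have us : uniq s.
  apply: uniq_simple_roots => r rs.
  have := g' r; rewrite -sts rs => /(_ isT).
  by rewrite {1}gE derivZ hornerZ mulf_eq0 negb_or => /andP[].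
by rewrite {1}gE (perm_big ts) //; exact: uniq_perm.
Qed.

End Structure.

(** * Complex numbers over a real field *)

Section ComplexSetting.
Local Open Scope complex_scope.
Local Open Scope ring_scope.
Variable R : realType.
Implicit Types (z w : R[i]) (f : {poly R[i]}) (P : {poly {poly R[i]}}).

(** Comparable complex numbers have equal imaginary parts, so the claim reduces to the supremum of
    the real parts. *)
Lemma complex_monotone_cauchy (s : nat -> R[i]) (K : R[i]) :
  (forall n, s n <= s n.+1) -> (forall n, s n <= K) ->
  forall e, 0 < e -> exists N, forall n, (N <= n)%N -> s n - s N < e.
Proof.
move=> s1 sK e e0.
have smono i j : (i <= j)%N -> s i <= s j.
  move=> ij; rewrite -(subnKC ij); elim: (j - i)%N => [|d IH]; rewrite ?addn0 // addnS.
  exact: le_trans IH (s1 _).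
pose E : R -> Prop := fun x => exists n, x = complex.Re (s n).
have ReK n : complex.Re (s n) <= complex.Re K by have := sK n; rewrite lecE => /andP[].
have Ehs : has_sup E.
  split; first by exists (complex.Re (s 0%N)); exists 0%N.
  by exists (complex.Re K) => _ [n ->].
have Re0 : 0 < complex.Re e by move: e0; rewrite ltcE => /andP[].
have [_ [N ->] hN] := sup_adherent Re0 Ehs.
exists N => n /smono; rewrite lecE => /andP[/eqP ImE _].
move: e0; rewrite !ltcE => /andP[/eqP Ime _].
have -> : complex.Im (s n - s N) = 0 by case: (s n) (s N) ImE => a b [a' b'] /= ->; rewrite subrr.
rewrite Ime eqxx /=.
have -> : complex.Re (s n - s N) = complex.Re (s n) - complex.Re (s N) by case: (s n) (s N) => a b [].
rewrite ltrBlDr; apply: (@le_lt_trans _ _ (sup E)); last by rewrite -ltrBlDl.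
by apply: sup_upper_bound => //; exists n.
Qed.

Lemma cvgC_null (u : nat -> R[i]) z : cvgC u z <-> null (fun k => u k - z).
Proof.
split=> h e e0; last by apply: h; rewrite ltcR.
have er : (complex.Re e)%:C = e by rewrite RRe_real // gtr0_real.
have [|N hN] := h (complex.Re e); first by rewrite -ltcR er.
by exists N => k /hN; rewrite er.
Qed.

Lemma eval2E P z w : eval2 P z w = ev P z w.
Proof. by []. Qed.

Lemma pencilE P : (size P <= 2)%N -> P = pencil P`_0 P`_1.
Proof.
move=> sP; apply/polyP => -[|[|k]].
- by rewrite /pencil coefD coefC coefXM addr0.
- by rewrite /pencil coefD coefC coefXM coefC add0r.
- rewrite /pencil coefD coefC coefXM coefC addr0 nth_default //.
  exact: leq_trans sP _.
Qed.

Lemma ptildeE n P : ptilde n P = pencil (recip n P`_1) (recip n P`_0).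
Proof.
apply/polyP => -[|[|k]]; rewrite coef_poly /pencil coefD coefC coefXM ?coefC ?addr0 ?add0r //.
Qed.

Lemma ev_pencil (f g : {poly R[i]}) z w : ev (pencil f g) z w = f.[z] + w * g.[z].
Proof. by rewrite evD evM ev_zz2 !evC. Qed.

Lemma dz1_pencil (f g : {poly R[i]}) : dz1 (pencil f g) = pencil f^`() g^`().
Proof.
apply/polyP => k; rewrite coef_map_id0 ?deriv0 // /pencil !coefD derivD !coefC !coefXM.
by case: k => [|[|k]]; rewrite ?coefC ?deriv0.
Qed.

Lemma eval2_R0j (b1 b2 : {poly R[i]}) tau l j z w :
  eval2 (R0j b1 b2 tau l j) z w = (b2.[z] - w * b1.[z]) * (Pj tau l j).[z].
Proof. by rewrite eval2E evM evD evN evM ev_zz2 !evC. Qed.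

Lemma coef_pencil (f g : {poly R[i]}) k :
  (pencil f g)`_k = match k with 0%N => f | 1%N => g | _ => 0 end.
Proof.
rewrite /pencil coefD coefC coefXM; case: k => [|[|k]] //=; rewrite ?coefC ?addr0 ?add0r //.
Qed.

Lemma bideg_pencil k (f g : {poly R[i]}) : (size f <= k.+1)%N -> (size g <= k.+1)%N ->
  bideg_le k 1 (pencil f g).
Proof.
move=> sf sg; split=> [|i]; last by rewrite coef_pencil; case: i => [|[|i]] //; rewrite size_poly0.
by apply/leq_sizeP => -[|[|i]] // _; rewrite coef_pencil.
Qed.

Implicit Types (F h : R[i] -> R[i] -> R[i]) (a b : nat -> nat -> R[i]).

Lemma H2_coef_l2 F a : H2_coef F a -> l2 a.
Proof. by move=> [[M hM] _]; exists M%:C. Qed.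

Lemma H2_coef_null F a z w : H2_coef F a -> `|z| < 1 -> `|w| < 1 ->
  null (fun N => Sev N a z w - F z w).
Proof. by move=> [_ h] z1 w1; exact/cvgC_null/h. Qed.

Lemma Sev_B N a b z w : Sev N (fun i k => a i k - b i k) z w = Sev N a z w - Sev N b z w.
Proof.
rewrite /Sev -sumrB; apply: eq_bigr => i _; rewrite -sumrB.
by apply: eq_bigr => k _; rewrite !mulrBl.
Qed.

Lemma l2_sub_zero a b : bounded a -> bounded b ->
  (forall z w, `|z| < 1 -> `|w| < 1 -> null (fun N => Sev N a z w - Sev N b z w)) ->
  forall i k, a i k = b i k.
Proof.
move=> [K hK] [L hL] h i k; apply/eqP; rewrite -subr_eq0; apply/eqP.
apply: (@double_series_coef_zero _ (fun i k => a i k - b i k)) => [|z w z1 w1].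
  by exists (K + L) => i' k'; rewrite (le_trans (ler_normB _ _)) // lerD.
by apply: null_ext (h z w z1 w1) => N; rewrite Sev_B.
Qed.

Lemma H2_coef_unique F a b : H2_coef F a -> H2_coef F b -> forall i k, a i k = b i k.
Proof.
move=> ha hb; apply: l2_sub_zero => [||z w z1 w1].
- exact: l2_bounded (H2_coef_l2 ha).
- exact: l2_bounded (H2_coef_l2 hb).
apply: null_ext (nullD (H2_coef_null ha z1 w1) (nullN (H2_coef_null hb z1 w1))) => N.
by ring.
Qed.

Lemma H2_coef_quotient P Q : cf P 0 0 != 0 ->
  (forall z w, `|z| < 1 -> `|w| < 1 -> ev P z w != 0) ->
  (forall N, nsq N (act Q (inv_coef P)) <= 1) ->
  H2_coef (fun z w => ev Q z w / ev P z w) (act Q (inv_coef P)).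
Proof.
move=> P00 P0 Q1; split; first by exists 1.
move=> z w z1 w1; apply/cvgC_null; apply: quotient_series => //; last exact: P0.
  exact: complex_monotone_cauchy.
by apply: l2_bounded; exists 1.
Qed.

(** Uniqueness of Taylor coefficients turns P (Q/P) h = Q h into a relation between arrays, which is
    the input of [saturated_orthogonal_range]. *)
Lemma H2_coef_mul P Q h a b : (forall z w, `|z| < 1 -> `|w| < 1 -> ev P z w != 0) ->
  H2_coef h a -> H2_coef (fun z w => ev Q z w / ev P z w * h z w) b ->
  forall i k, act P b i k = act Q a i k.
Proof.
move=> P0 ha hb; have a1 := l2_bounded (H2_coef_l2 ha).
have b1 := l2_bounded (H2_coef_l2 hb).
have mc := complex_monotone_cauchy.
apply: l2_sub_zero => [||z w z1 w1]; try exact: bounded_act.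
have na := nullZ (ev Q z w) (H2_coef_null ha z1 w1).
have nb := nullZ (ev P z w) (H2_coef_null hb z1 w1).
have nP := Sev_act mc P b1 z1 w1; have nQ := Sev_act mc Q a1 z1 w1.
apply: null_ext (nullD (nullD nP nb) (nullN (nullD nQ na))) => N.
by field; exact: P0.
Qed.

End ComplexSetting.

(** * The decomposition with prescribed terms *)

Section Main.
Local Open Scope complex_scope.
Local Open Scope ring_scope.
Variables (R : realType) (n : nat) (p : {poly {poly R[i]}}).
Variables (m l : nat) (tau lam : nat -> R[i]) (alpha : R[i]) (b1 b2 : {poly R[i]}).
Variables (c d : nat -> R).
Hypothesis n0 : (1 <= n)%N.
Hypothesis p_deg : bideg_le n 1 p.
Hypothesis p_disk : forall z1 z2 : R[i], `|z1| < 1 -> `|z2| < 1 -> eval2 p z1 z2 != 0.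
Hypothesis tau_lam : forall k, (k < m)%N ->
  `|tau k| = 1 /\ `|lam k| = 1 /\ eval2 p (tau k) (lam k) = 0.
Hypothesis p_torus : forall z1 z2 : R[i], `|z1| = 1 -> `|z2| = 1 -> eval2 p z1 z2 = 0 ->
  exists2 k, (k < m)%N & z1 = tau k /\ z2 = lam k.
Hypothesis tau_lam_inj : forall j k, (j < m)%N -> (k < m)%N ->
  tau j = tau k -> lam j = lam k -> j = k.
Hypothesis alpha1 : `|alpha| = 1.
Hypothesis lm : (1 <= l <= m)%N.
Hypothesis nt_in : forall k, (k < l)%N -> nt_limit (rif n p) (tau k) (lam k) alpha.
Hypothesis nt_out : forall k, (l <= k < m)%N -> ~ nt_limit (rif n p) (tau k) (lam k) alpha.

Local Notation p1 := (p`_0).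
Local Notation p2 := (p`_1).
Local Notation q0 := (recip n p2).
Local Notation q1 := (recip n p1).
Local Notation A := (q1 - alpha *: p2).
Local Notation B := (alpha *: p1 - q0).

Let sp : (size p <= 2)%N. Proof. by case: p_deg. Qed.
Let sp1 : (size p1 <= n.+1)%N. Proof. by case: p_deg => _ /(_ 0%N). Qed.
Let sp2 : (size p2 <= n.+1)%N. Proof. by case: p_deg => _ /(_ 1%N). Qed.

Let pE z1 z2 : eval2 p z1 z2 = p1.[z1] + z2 * p2.[z1].
Proof. by rewrite eval2E {1}(pencilE sp) ev_pencil. Qed.
Let qE z1 z2 : eval2 (ptilde n p) z1 z2 = q0.[z1] + z2 * q1.[z1].
Proof. by rewrite eval2E ptildeE ev_pencil. Qed.
Let dpE z1 z2 : eval2 (dz1 p) z1 z2 = p1^`().[z1] + z2 * p2^`().[z1].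
Proof. by rewrite eval2E {1}(pencilE sp) dz1_pencil ev_pencil. Qed.
Let dqE z1 z2 : eval2 (dz1 (ptilde n p)) z1 z2 = q0^`().[z1] + z2 * q1^`().[z1].
Proof. by rewrite eval2E ptildeE dz1_pencil ev_pencil. Qed.
Let p0 z1 z2 : `|z1| < 1 -> `|z2| < 1 -> p1.[z1] + z2 * p2.[z1] != 0.
Proof. by move=> z11 z21; rewrite -pE p_disk. Qed.

Variable la : R[i].
Hypothesis la1 : `|la| = 1.
Hypothesis la_lam : forall k, (k < m)%N -> lam k != la.

Local Notation P := (p1 + la *: p2).
Local Notation W := (q0 + la *: q1 - alpha *: P).

Let pT z : `|z| = 1 -> p1.[z] + la * p2.[z] != 0.
Proof.
move=> z1; rewrite -pE; apply/eqP => /(p_torus z1 la1)[k km [_ lk]].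
by have := la_lam km; rewrite -lk eqxx.
Qed.

(** Otherwise p would vanish on the whole line over z1, hence at z2 = la. So a zero on the torus is
    determined by its first coordinate. *)
Let p2_neq0 z1 z2 : `|z1| = 1 -> p1.[z1] + z2 * p2.[z1] = 0 -> p2.[z1] != 0.
Proof.
move=> z11 pz; apply/eqP => p2z; have := pT z11.
by move: pz; rewrite p2z !mulr0 => ->; rewrite eqxx.
Qed.

Let lem k : (k < l)%N -> (k < m)%N.
Proof. by case/andP: lm => _ h /leq_trans; apply. Qed.

Let tau1 k : (k < l)%N -> `|tau k| = 1.
Proof. by move=> /lem/tau_lam[]. Qed.

Let p_tau k : (k < m)%N -> p1.[tau k] + lam k * p2.[tau k] = 0.
Proof. by move=> /tau_lam[_ [_]]; rewrite pE. Qed.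

Lemma tau_injective j k : (j < l)%N -> (k < l)%N -> tau j = tau k -> j = k.
Proof.
move=> jl kl tjk; apply: tau_lam_inj => //; try exact: lem.
have pj := p_tau (lem jl); have pk := p_tau (lem kl).
have p20 := p2_neq0 (tau1 jl) pj; rewrite -tjk in pk.
apply: (mulIf p20); apply: (addrI (p1.[tau j])).
by rewrite pj pk.
Qed.

(* The approach region puts no relation between 1 - |z1| and 1 - |z2|: fixing z2
   and letting z1 -> tau_k already determines the constant phi(tau_k, .). *)
Lemma exceptional_value k : (k < l)%N -> A.[tau k] = 0 /\ B.[tau k] = 0.
Proof.
move=> kl; have km := lem kl; have [t1 [l1 _]] := tau_lam km.
have pk := p_tau km; have p20 := p2_neq0 t1 pk.
set t := tau k in t1 pk p20 *; set mu := lam k in l1 pk *.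
have tt := unit_mulconj t1; have mm := unit_mulconj l1.
(* The constant value of phi on the line over t: there p = p2 (z2 - mu) and p~ = beta p. *)
pose beta := q1.[t] / p2.[t].
have q1t : q1.[t] = beta * p2.[t] by rewrite /beta divfK.
have p1t : p1.[t] = - (mu * p2.[t]) by apply/eqP; rewrite -addr_eq0 pk.
have q0t : q0.[t] = beta * p1.[t].
  rewrite p1t mulrN mulrCA -q1t (horner_recip sp1 tt) (horner_recip sp2 tt) p1t conjN conjM.
  transitivity ((mu * mu^*) * (t ^+ n * (p2.[t])^*)); first by rewrite mm mul1r.
  by ring.
suff ba : beta = alpha.
  by rewrite !hornE q0t q1t ba !subrr.
apply/eqP; rewrite -subr_eq0 -normr_eq0; apply/negPn/negP => ne.
have e0 : 0 < `|beta - alpha| by rewrite lt_def ne normr_ge0.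
have er : (complex.Re `|beta - alpha|)%:C = `|beta - alpha| by rewrite RRe_real // gtr0_real.
set e := complex.Re `|beta - alpha| in er.
have e0' : 0 < e by rewrite -ltcR er.
(* Radial points satisfy |z - t| = 1 - |z|, so aperture 1 admits them; the tolerance |beta - alpha|
   / 2 gives the contradiction. *)
have [dl dl0 hnt] := nt_in kl (@ltr01 R) (divr_gt0 e0' (ltr0n _ 2)).
have [dd [dd0 dd1 ddl]] : exists dd : R, [/\ 0 < dd, dd < 1 & dd < dl].
  have u0 : 0 < Num.min 1 dl by rewrite lt_min ltr01.
  have u1 : Num.min 1 dl <= 1 by rewrite ge_min lexx.
  have udl : Num.min 1 dl <= dl by rewrite ge_min lexx orbT.
  have h2 : Num.min 1 dl / 2%:R < Num.min 1 dl.
    by rewrite ltr_pdivrMr // ltr_pMr // ltr1n.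
  by exists (Num.min 1 dl / 2%:R); rewrite divr_gt0 // (lt_le_trans h2 u1) (lt_le_trans h2 udl).
pose z2 := (1 - dd)%:C * mu.
have dC0 : 0 < dd%:C by rewrite ltcR.
have dC1 : dd%:C < 1 by rewrite ltcR.
have nz2 : `|z2| = 1 - dd%:C.
  by rewrite normrM l1 mulr1 rmorphB rmorph1 ger0_norm // subr_ge0 ltW.
have z2mu : `|z2 - mu| = dd%:C.
  have -> : z2 - mu = - (dd%:C * mu) by rewrite /z2 rmorphB rmorph1; ring.
  by rewrite normrN normrM l1 mulr1 gtr0_norm.
have pz2 : p1.[t] + z2 * p2.[t] = p2.[t] * (z2 - mu) by rewrite p1t; ring.
have pz20 : 0 < `|p1.[t] + z2 * p2.[t]|.
  by rewrite pz2 normrM z2mu mulr_gt0 // normr_gt0.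
have ge : 0 <= (e / 2%:R)%:C by rewrite ler0c divr_ge0 // ltW.
pose f := q0 + z2 *: q1 - alpha *: (p1 + z2 *: p2).
pose g := (e / 2%:R)%:C *: (p1 + z2 *: p2).
have fg : `|f.[t]| <= `|g.[t]|.
  apply: (@radial_le _ _ _ _ dd%:C) => // [|r r0 r1]; first exact: ltW.
  have rp : 0 < r by apply: lt_trans r0; rewrite subr_gt0.
  have nr : `|r * t| = r by rewrite normrM t1 mulr1 gtr0_norm.
  have nrt : `|r * t - t| = 1 - r.
    have -> : r * t - t = - ((1 - r) * t) by ring.
    by rewrite normrN normrM t1 mulr1 gtr0_norm // subr_gt0.
  have := hnt (r * t) z2.
  rewrite nr nrt nz2 z2mu (_ : 1 - (1 - dd%:C) = dd%:C) ?rmorph1 ?mul1r => [h|]; last by ring.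
  have {}h := h r1.
  have z21 : 1 - dd%:C < 1 by rewrite gtrBl.
  have lt1 : 1 - r < dl%:C.
    by apply: (@lt_trans _ _ dd%:C); rewrite ?ltcR // ltrBlDr addrC -ltrBlDr.
  have lt2 : dd%:C < dl%:C by rewrite ltcR.
  have {}h := h z21 (lexx _) (lexx _) lt1 lt2.
  have pn0 : p1.[r * t] + z2 * p2.[r * t] != 0 by rewrite p0 ?nr // nz2.
  rewrite /rif pE qE in h.
  rewrite /f /g !hornE normrM (ger0_norm ge).
  rewrite -ler_pdivrMr ?normr_gt0 // -normfV -normrM mulrBl mulfK //.
  exact: ltW.
have ft : f.[t] = (beta - alpha) * (p1.[t] + z2 * p2.[t]) by rewrite /f !hornE q0t q1t; ring.
rewrite ft /g !hornE !normrM ler_pM2r // -er in fg.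
move: fg; rewrite (ger0_norm ge) lecR.
by rewrite ler_pdivlMr // ger_pMr // lern1.
Qed.

Let WAB : W = la *: A - B.
Proof. by rewrite -!mul_polyC; ring. Qed.

(* Julia's inequality: |phi - alpha|^2 (1 - |z1|^2) w <= |z1 - tau_k|^2, for every z2. *)
Lemma nt_limit_exceptional k : (k < m)%N -> A.[tau k] = 0 -> B.[tau k] = 0 ->
  nt_limit (rif n p) (tau k) (lam k) alpha.
Proof.
move=> km At Bt; have [t1 _] := tau_lam km; set t := tau k in t1 At Bt *.
have [rs [urs srs rsW rs1]] :=
  clark_data n0 sp1 sp2 p0 alpha1 la1 pT (erefl q0) (erefl q1) (erefl P) (erefl W).
have [w [w0 _ julia]] := angular_derivative n0 sp1 sp2 p0 alpha1 la1 pT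
  (erefl q0) (erefl q1) (erefl P) (erefl W) (erefl A) (erefl B) urs srs rsW rs1 At Bt.
have wr : (complex.Re w)%:C = w by rewrite RRe_real // gtr0_real.
set v := complex.Re w in wr.
have v0 : 0 < v by rewrite -ltcR wr.
move=> K K0 e e0.
have eC : 0 < e%:C by rewrite ltcR.
have KC : 0 < K%:C by rewrite ltcR.
(* Julia's inequality and the aperture K give v |phi - alpha|^2 <= K |z1 - t|, which determines this
   radius. *)
exists (v * e ^+ 2 / K) => [|z1 z2 z11 z21 app _ close _].
  by rewrite divr_gt0 // mulr_gt0 // exprn_gt0.
have pn0 : p1.[z1] + z2 * p2.[z1] != 0 := p0 z11 z21.
rewrite /rif pE qE.
have -> : (q0.[z1] + z2 * q1.[z1]) / (p1.[z1] + z2 * p2.[z1]) - alpha =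
  (q0.[z1] + z2 * q1.[z1] - alpha * (p1.[z1] + z2 * p2.[z1])) / (p1.[z1] + z2 * p2.[z1]).
  by field.
have := julia z1 z2 (ltW z11) (ltW z21).
set X := q0.[z1] + _ - _; set Y := p1.[z1] + _ in pn0 *.
have Y0 : 0 < `|Y| by rewrite normr_gt0.
rewrite normrM normfV ltr_pdivrMr // -(@ltr_pXn2r _ 2) ?nnegrE ?mulr_ge0 ?(ltW eC) //.
set u := 1 - `|z1| in app *; have u0 : 0 < u by rewrite subr_gt0.
move=> jul.
have h1 : w * u * `|X| ^+ 2 <= K%:C * u * `|z1 - t| * `|Y| ^+ 2.
  apply: (@le_trans _ _ (w * (1 - `|z1| ^+ 2) * `|X| ^+ 2)).
    rewrite ler_wpM2r ?exprn_ge0 // ler_pM2l // /u lerD2l lerN2 expr2.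
    by rewrite ler_piMl // ltW.
  apply: le_trans jul _; rewrite ler_wpM2r ?exprn_ge0 // expr2 ler_wpM2r //.
have h2 : w * `|X| ^+ 2 <= K%:C * `|z1 - t| * `|Y| ^+ 2.
  rewrite -(ler_pM2l u0); move: h1.
  by rewrite [w * u]mulrC -!mulrA [K%:C * (u * _)]mulrCA.
rewrite -(ltr_pM2l w0); apply: le_lt_trans h2 _.
have -> : w * (e%:C * `|Y|) ^+ 2 = w * e%:C ^+ 2 * `|Y| ^+ 2 by ring.
rewrite ltr_pM2r ?exprn_gt0 //.
rewrite mulrC -ltr_pdivlMr //.
rewrite -wr; apply: lt_le_trans close _.
by rewrite rmorphM rmorphM rmorphXn fmorphV.
Qed.

Variable g : {poly R[i]}.
Hypotheses (Ag : A = g * b1) (Bg : B = g * b2) (b_cop : coprimep b1 b2).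

Let Wg : W = g * (la *: b1 - b2).
Proof. by rewrite WAB Ag Bg -!mul_polyC; ring. Qed.

Let ts := [seq tau k | k <- iota 0 l].

Let tsP z : reflect (exists2 k, (k < l)%N & z = tau k) (z \in ts).
Proof.
apply: (iffP mapP) => -[k]; first by rewrite mem_iota add0n => kl ->; exists k.
by move=> kl ->; exists k; rewrite ?mem_iota ?add0n.
Qed.

Let uts : uniq ts.
Proof.
rewrite map_inj_in_uniq ?iota_uniq // => j k; rewrite !mem_iota !add0n /=.
exact: tau_injective.
Qed.

(** A root of g is a Clark point with |p1| = |p2|, so p vanishes on the torus above it; it is then
    some tau_k, and Julia's inequality excludes k >= l. Conversely A and B vanish at tau_k, while b1
    and b2 have no common root. *)
Lemma root_g z : root g z = (z \in ts).
Proof.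
have [rs [urs srs rsW rs1]] :=
  clark_data n0 sp1 sp2 p0 alpha1 la1 pT (erefl q0) (erefl q1) (erefl P) (erefl W).
apply/idP/idP => [gz|/tsP[k kl ->]].
  have Az : A.[z] = 0 by rewrite Ag hornerM (rootP gz) mul0r.
  have Bz : B.[z] = 0 by rewrite Bg hornerM (rootP gz) mul0r.
  have zrs : z \in rs by rewrite -rsW; apply/rootP; rewrite Wg hornerM (rootP gz) mul0r.
  have [z1 _] := rs1 z zrs; have zz := unit_mulconj z1.
  have e : `|p1.[z]| = `|p2.[z]|.
    move/eqP: Bz; rewrite !hornE subr_eq0 (horner_recip sp2 zz) => /eqP/(congr1 Num.norm).
    by rewrite !normrM normrX alpha1 z1 expr1n !mul1r norm_conjC.
  have p2z : p2.[z] != 0.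
    apply/eqP => p2z; have := pT z1; move/eqP: e; rewrite p2z normr0 normr_eq0 => /eqP ->.
    by rewrite mulr0 addr0 eqxx.
  have l1 : `|- p1.[z] / p2.[z]| = 1.
    by rewrite normrM normrN normfV e divff // normr_eq0.
  have pz : eval2 p z (- p1.[z] / p2.[z]) = 0 by rewrite pE divfK // subrr.
  have [k km [zk lk]] := p_torus z1 l1 pz.
  apply/tsP; exists k => //; rewrite ltnNge; apply/negP => lk'.
  rewrite zk in Az Bz.
  by case: (@nt_out k); rewrite ?lk' ?km //; exact: nt_limit_exceptional.
have [At Bt] := exceptional_value kl.
apply/negPn/negP => gt; move: At Bt; rewrite Ag Bg !hornerM => /eqP.
rewrite mulf_eq0 -/(root g _) (negPf gt) /= => b1t /eqP.
rewrite mulf_eq0 -/(root g _) (negPf gt) /= => b2t.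
by have := coprimep_root b_cop b1t; rewrite b2t.
Qed.

Lemma g_neq0 : g != 0.
Proof.
apply/eqP => g0; have [z _ zts] := circle_infinite ts.
by move: zts; rewrite -root_g g0 root0.
Qed.

Let W'_tau k : (k < l)%N -> W^`().[tau k] = g^`().[tau k] * (la * b1.[tau k] - b2.[tau k]).
Proof.
move=> kl; have : root g (tau k) by rewrite root_g; apply/tsP; exists k.
move/rootP => gt; rewrite Wg derivM hornerD !hornerM gt mul0r addr0.
by rewrite !hornE.
Qed.

Lemma g_simple z : z \in ts -> g^`().[z] != 0.
Proof.
move=> /tsP[k kl ->].
have [rs [urs srs rsW rs1]] :=
  clark_data n0 sp1 sp2 p0 alpha1 la1 pT (erefl q0) (erefl q1) (erefl P) (erefl W).
have [At Bt] := exceptional_value kl.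
have trs : tau k \in rs by rewrite -rsW; apply/rootP; rewrite WAB !hornE in At Bt *; rewrite At Bt mulr0 subrr.
have [_] := rs1 _ trs; rewrite (W'_tau kl).
by apply: contraTneq => ->; rewrite !mul0r ltxx.
Qed.

Let ga := lead_coef g.

Let ga0 : ga != 0. Proof. by rewrite lead_coef_eq0 g_neq0. Qed.

Lemma g_factor k : (k < l)%N -> g = ga *: (('X - (tau k)%:P) * Pj tau l k).
Proof.
move=> kl; rewrite (simple_roots_factor g_neq0 root_g g_simple uts) -/ga; congr (_ *: _).
rewrite big_map (_ : iota 0 l = index_iota 0 l); last by rewrite /index_iota subn0.
by rewrite big_mkord (bigD1 (Ordinal kl)).
Qed.

Hypothesis c_def : forall j, (j < l)%N -> 0 < c j /\
  forall z2 : R[i], `|z2| <= 1 -> z2 != lam j ->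
    (c j)%:C * `|drif_dz1 n p (tau j) z2| = 1.
Hypothesis d_def : forall j, (j < l)%N -> 0 < d j /\
  exists s : R[i],
    H2D_normsq (fun z2 => eval2 (R0j b1 b2 tau l j) (tau j) z2 / eval2 p (tau j) z2) s
    /\ (c j)%:C * ((d j)%:C) ^+ 2 * s = 1.

Let gt j : (j < l)%N -> g.[tau j] = 0.
Proof. by move=> jl; apply/rootP; rewrite root_g; apply/tsP; exists j. Qed.

Let g't j : (j < l)%N -> g^`().[tau j] = ga * (Pj tau l j).[tau j].
Proof.
move=> jl; rewrite {1}(g_factor jl) derivZ derivM derivB derivX derivC !hornE.
by rewrite subr0 mul1r subrr mul0r addr0.
Qed.

Let A't j : (j < l)%N -> A^`().[tau j] = g^`().[tau j] * b1.[tau j].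
Proof. by move=> jl; rewrite Ag derivM hornerD !hornerM gt // mul0r addr0. Qed.
Let B't j : (j < l)%N -> B^`().[tau j] = g^`().[tau j] * b2.[tau j].
Proof. by move=> jl; rewrite Bg derivM hornerD !hornerM gt // mul0r addr0. Qed.

(** The Clark weight is c_j: the derivative of phi is evaluated at z2 = la, which differs from
    lam_j, and has modulus 1/w there. *)
Lemma angular_at_tau j : (j < l)%N -> exists w, [/\ 0 < w,
  forall z2, w * (z2 * A^`().[tau j] - B^`().[tau j]) =
     alpha * (tau j)^* * (p1.[tau j] + z2 * p2.[tau j]) & w = (c j)%:C].
Proof.
move=> jl; have [At Bt] := exceptional_value jl.
have [rs [urs srs rsW rs1]] :=
  clark_data n0 sp1 sp2 p0 alpha1 la1 pT (erefl q0) (erefl q1) (erefl P) (erefl W).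
have [w [w0 wE _]] := angular_derivative n0 sp1 sp2 p0 alpha1 la1 pT
  (erefl q0) (erefl q1) (erefl P) (erefl W) (erefl A) (erefl B) urs srs rsW rs1 At Bt.
exists w; split=> //.
have [c0 cE] := c_def jl.
have t1 := tau1 jl; have pn0 := pT t1.
have := cE la; rewrite la1 lexx eq_sym la_lam ?lem // => /(_ isT isT).
have -> : drif_dz1 n p (tau j) la = (la * A^`().[tau j] - B^`().[tau j]) /
    (p1.[tau j] + la * p2.[tau j]).
  rewrite /drif_dz1 pE qE dpE dqE.
  have e0 : q0.[tau j] = alpha * p1.[tau j].
    by move: Bt; rewrite !hornE => /eqP; rewrite subr_eq0 => /eqP.
  have e1 : q1.[tau j] = alpha * p2.[tau j].
    by move: At; rewrite !hornE => /eqP; rewrite subr_eq0 => /eqP.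
  rewrite e0 e1 !(derivB, derivZ) !hornE.
  by field.
have D0 : la * A^`().[tau j] - B^`().[tau j] != 0.
  apply/eqP => D0; have := wE la; rewrite D0 mulr0 => /esym/eqP.
  by rewrite !mulf_eq0 conjC_eq0 (negPf (unit_neq0 alpha1)) (negPf (unit_neq0 t1)) (negPf pn0).
have nE := congr1 Num.norm (wE la).
rewrite !normrM alpha1 norm_conjC t1 !mul1r (gtr0_norm w0) in nE.
rewrite normrM normfV -nE => cD.
have nD : `|la * A^`().[tau j] - B^`().[tau j]| != 0 by rewrite normr_eq0.
have : (c j)%:C / w = 1.
  by rewrite -cD; field; rewrite nD gt_eqF.
by move=> cw; rewrite -[RHS](divfK (lt0r_neq0 w0)) cw mul1r.
Qed.

Lemma slice_p_neq0 j z2 : (j < l)%N -> `|z2| < 1 -> p1.[tau j] + z2 * p2.[tau j] != 0.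
Proof.
move=> jl z21; have pk := p_tau (lem jl); have p20 := p2_neq0 (tau1 jl) pk.
have -> : p1.[tau j] + z2 * p2.[tau j] = p2.[tau j] * (z2 - lam j).
  transitivity (p1.[tau j] + z2 * p2.[tau j] - (p1.[tau j] + lam j * p2.[tau j])).
    by rewrite pk subr0.
  by ring.
rewrite mulf_neq0 // subr_eq0; apply: contraTneq z21 => ->.
by have [_ [-> _]] := tau_lam (lem jl); rewrite ltxx.
Qed.

(** Serves for (R_j/p)(tau_j, .), which is constant by the equation in [angular_at_tau]. *)
Lemma H2D_normsq_const (h : R[i] -> R[i]) s kap : (forall z, `|z| < 1 -> h z = kap) ->
  H2D_normsq h s -> s = kap * kap^*.
Proof.
move=> hk [a [[[M hM] cv] cs]].
pose v k := a k - (if k is 0%N then kap else 0).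
have ak k : `|a k| <= M%:C + 1.
  apply: sqr_le_bound => //; apply: le_trans (hM k.+1).
  by rewrite big_ord_recr /= lerDr; apply: sumr_ge0 => i _; exact: exprn_ge0.
have v0 : forall k, v k = 0.
  apply: (@series_coef_zero _ v (M%:C + 1 + `|kap|)) => [k|x x0 x1].
    rewrite /v; apply: le_trans (ler_normB _ _) _; apply: lerD => //.
    by case: k => // k; rewrite normr0.
  have x1' : `|x| < 1 by rewrite gtr0_norm.
  have /cvgC_null := cv x x1'; rewrite (hk x x1') => h0 e e0.
  have [N hN] := h0 e e0; exists N.+1 => -[//|k] kN.
  have -> : \sum_(i < k.+1) v i * x ^+ i = \sum_(i < k.+1) a i * x ^+ i - kap; last exact/hN/ltnW.
  rewrite !big_ord_recl /= /v expr0 !mulr1; under eq_bigr do rewrite /= subr0.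
  by rewrite addrAC.
have /cvgC_null cs' := cs.
have : null (fun _ : nat => kap * kap^* - s).
  move=> e e0; have [N hN] := cs' e e0; exists N => _ _.
  have := hN N.+1 (leqnSn N); rewrite big_ord_recl big1 => [|i _].
    by have := v0 0%N; rewrite /v => /eqP; rewrite subr_eq0 => /eqP ->; rewrite addr0 normCK.
  by have := v0 i.+1; rewrite /v subr0 /= => ->; rewrite normr0 expr0n.
by move/null_const/eqP; rewrite subr_eq0 => /eqP.
Qed.

(** Since p~ - alpha p = g (z2 b1 - b2) and g = ga (z1 - tau_j) [Pj], this is the factor with (z1 -
    tau_j) R_j = e_j (p~ - alpha p); the sign comes from b2 - z2 b1. *)
Let e j : R[i] := - ((d j)%:C / ga).

(** With d_j = 1 the constant (R_j/p)(tau_j, .) has modulus 1/(c_j |ga|), so the normalisation says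
    d_j^2 / |ga|^2 = c_j: the prescribed R_j carries exactly the Clark weight. *)
Lemma weight j : (j < l)%N -> e j * (e j)^* * W^`().[tau j] = alpha * (tau j)^* * P.[tau j].
Proof.
move=> jl; have [w [w0 wE wc]] := angular_at_tau jl.
have [d0 [s [hs cds]]] := d_def jl.
have sE : s = (- (alpha * (tau j)^* / (w * ga))) * (- (alpha * (tau j)^* / (w * ga)))^*.
  apply: H2D_normsq_const hs => z2 z21.
  have pn0 := slice_p_neq0 jl z21.
  rewrite eval2_R0j pE; apply: (mulIf pn0); rewrite divfK //.
  apply: (mulfI (mulf_neq0 (lt0r_neq0 w0) ga0)).
  have := wE z2; rewrite (A't jl) (B't jl) (g't jl) => wz.
  transitivity (- (w * (z2 * (ga * (Pj tau l j).[tau j] * b1.[tau j]) -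
    ga * (Pj tau l j).[tau j] * b2.[tau j]))); first by ring.
  by rewrite wz; field; rewrite ga0 gt_eqF.
have wr : w^* = w by rewrite conj_Creal // gtr0_real.
have dr : ((d j)%:C)^* = (d j)%:C by rewrite conj_Creal // ger0_real // ler0c ltW.
have tt := unit_mulconj (tau1 jl); have aa := unit_mulconj alpha1.
have gc0 : ga^* != 0 by rewrite conjC_eq0 ga0.
have wn0 : w != 0 := lt0r_neq0 w0.
have ee : e j * (e j)^* = w.
  rewrite -wc in cds.
  have : (alpha * alpha^*) * (tau j * (tau j)^*) * (d j)%:C ^+ 2 / (w * (ga * ga^*)) = 1.
    rewrite -cds sE !conjE wr; field; by rewrite wn0 gc0 ga0.
  rewrite aa tt !mul1r => h; rewrite /e !conjE dr.
  transitivity (w * ((d j)%:C ^+ 2 / (w * (ga * ga^*)))); last by rewrite h mulr1.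
  by field; rewrite wn0 gc0 ga0.
rewrite ee; have := wE la; rewrite !hornE => <-.
by rewrite WAB derivB derivZ !hornE.
Qed.

Let ev_p z1 z2 : ev p z1 z2 = p1.[z1] + z2 * p2.[z1].
Proof. exact: pE. Qed.

Lemma main_decomposition :
  exists (r : nat -> {poly {poly R[i]}}) (Q : {poly {poly R[i]}}),
    (forall j, (j < l)%N -> r j = ((d j)%:C%:P)%:P * R0j b1 b2 tau l j) /\
    (forall j, (j < n)%N -> bideg_le n.-1 1 (r j)) /\
    bideg_le n 0 Q /\
    (forall z1 z2 w1 w2 : R[i],
        eval2 p z1 z2 * (eval2 p w1 w2)^*
        - eval2 (ptilde n p) z1 z2 * (eval2 (ptilde n p) w1 w2)^*
        = (1 - z1 * w1^*) * \sum_(j < n) eval2 (r j) z1 z2 * (eval2 (r j) w1 w2)^*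
          + (1 - z2 * w2^*) * eval2 Q z1 z2 * (eval2 Q w1 w2)^*) /\
    (forall j, (j < l)%N ->
        in_model_space (rif n p) (fun z1 z2 => eval2 (r j) z1 z2 / eval2 p z1 z2)) /\
    (forall j k, (j < l)%N -> (k < l)%N ->
        H2_inner_is (fun z1 z2 => eval2 (r j) z1 z2 / eval2 p z1 z2)
                    (fun z1 z2 => eval2 (r k) z1 z2 / eval2 p z1 z2)
                    (if j == k then 1 else 0)).
Proof.
have [rs [urs srs rsW rs1]] :=
  clark_data n0 sp1 sp2 p0 alpha1 la1 pT (erefl q0) (erefl q1) (erefl P) (erefl W).
have tauE j : (j < l)%N -> [/\ A.[tau j] = 0, B.[tau j] = 0 &
     e j * (e j)^* * W^`().[tau j] = alpha * (tau j)^* * P.[tau j]].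
  by move=> jl; have [At Bt] := exceptional_value jl; split=> //; exact: weight.
have [X [Y [Q [ln sQ sXY rE id]]]] := prescribed_decomposition n0 sp1 sp2 p0 alpha1 la1 pT
  (erefl q0) (erefl q1) (erefl P) (erefl W) (erefl A) (erefl B) urs srs rsW rs1
  tau_injective tauE.
pose r j := pencil (X j) (Y j); pose q := ptilde n p.
have jn j : (j < l)%N -> (j < n)%N by move=> jl; exact: leq_trans jl ln.
have qp j (jl : (j < l)%N) := (rE j jl).1.
have p00 : cf p 0 0 != 0.
  have := first_coef_neq0 p0 (z := 0); rewrite normr0 ltr01 horner_coef0; exact.
have evp z1 z2 : `|z1| < 1 -> `|z2| < 1 -> ev p z1 z2 != 0 by exact: p_disk.
have id' z1 z2 w1 w2 : ev p z1 z2 * (ev p w1 w2)^* - ev q z1 z2 * (ev q w1 w2)^* =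
    (1 - z1 * w1^*) * (\sum_(j < n) ev (r j) z1 z2 * (ev (r j) w1 w2)^*)
    + (1 - z2 * w2^*) * (ev Q%:P z1 z2 * (ev Q%:P w1 w2)^*).
  rewrite !ev_p !evC -[ev q z1 z2]/(eval2 q z1 z2) -[ev q w1 w2]/(eval2 q w1 w2) !qE id.
  by congr (_ * _ + _); apply: eq_bigr => j _; rewrite !ev_pencil.
have mc := @complex_monotone_cauchy R.
have rel j : (j < l)%N -> zz1 _ * r j = bic (tau j) * r j + bic (e j) * q + bic (- (e j * alpha)) * p.
  by move=> jl; have := qp j jl; rewrite -ptildeE -(pencilE sp); exact: pencil_relation.
have saturated j : (j < l)%N -> null (fun N => 1 - nsq N (act (r j) (inv_coef p))).
  move=> jl; have pt : ev p (tau j) 0 != 0.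
    by rewrite ev_p slice_p_neq0 // normr0 ltr01.
  apply: (exceptional_norm mc p00 id' (jn j jl) (tau1 jl) (rel j jl) pt).
  have := (rE j jl).2 0; rewrite -ev_p -ev_pencil -/(r j) => bd.
  have aa := unit_mulconj alpha1.
  transitivity (alpha^* * (tau j * (e j)^* * ev (r j) (tau j) 0) / ev p (tau j) 0).
    by field.
  by rewrite -bd mulrA (mulrC alpha^*) aa mul1r divff.
have rcoef j : (j < l)%N ->
    H2_coef (fun z1 z2 => eval2 (r j) z1 z2 / eval2 p z1 z2) (act (r j) (inv_coef p)).
  by move=> jl; apply: H2_coef_quotient => // N; exact: (norm_R p00 id' N (jn j jl)).
exists r, Q%:P; split=> [j jl|].
  have := qp j jl; rewrite -/(r j) => h.
  have x0 : ('X - (tau j)%:P)%:P != 0 :> {poly {poly R[i]}}.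
    by rewrite polyC_eq0 polyXsubC_eq0.
  apply: (mulfI x0); rewrite h.
  have -> : pencil q0 q1 - alpha%:P%:P * pencil p1 p2 = g%:P * ('X * b1%:P - b2%:P).
    transitivity ('X * A%:P - B%:P : {poly {poly R[i]}}).
      by rewrite /pencil -!mul_polyC !polyCB !polyCM; ring.
    by rewrite Ag Bg !polyCM; ring.
  rewrite {1}(g_factor jl) -mul_polyC polyCM /R0j /e polyCN polyCN !polyCM.
  have gg : (ga^-1)%:P%:P * ga%:P%:P = 1 :> {poly {poly R[i]}}.
    by rewrite -!polyCM mulVf.
  transitivity ((d j)%:C%:P%:P * ((ga^-1)%:P%:P * ga%:P%:P) * ('X - (tau j)%:P)%:P * (Pj tau l j)%:P * (b2%:P - 'X * b1%:P)).
    by ring.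
  by rewrite gg; ring.
split=> [j jn'|].
  by have [sX sY] := sXY j; apply: bideg_pencil; rewrite prednK.
split.
  split; first by rewrite size_polyC; case: (_ != 0).
  by move=> i; rewrite coefC; case: (i == 0%N); rewrite ?size_poly0.
split=> [z1 z2 w1 w2|].
  rewrite -mulrA; exact: id'.
split=> [j jl|j k jl kl a b ha hb].
  split; first by exists (act (r j) (inv_coef p)); exact: rcoef.
  move=> h [hc hhc] a b ha hb.
  have pb := @H2_coef_mul _ p q h hc b evp hhc hb.
  have nul := saturated_orthogonal_range p00 id' (jn j jl) (saturated j jl) (H2_coef_l2 hhc) pb.
  apply/cvgC_null; apply: null_ext nul => N; rewrite subr0.
  apply: eq_bigr => i _; apply: eq_bigr => k _; congr (_ * _).
  exact: H2_coef_unique ha (rcoef j jl) i k.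
have abE N : \sum_(i < N) \sum_(t < N) a i t * (b i t)^* =
    ip N (act (r j) (inv_coef p)) (act (r k) (inv_coef p)).
  apply: eq_bigr => i _; apply: eq_bigr => t _.
  by rewrite (H2_coef_unique ha (rcoef j jl)) (H2_coef_unique hb (rcoef k kl)).
apply/cvgC_null; have [jk|jk] := eqVneq j k.
  apply: null_ext (nullN (saturated k kl)) => N.
  by rewrite abE jk ip_self opprB.
apply: null_ext (saturated_orthogonal p00 id' (jn j jl) (jn k kl) jk (saturated k kl)) => N.
by rewrite subr0 abE.
Qed.

End Main.

Local Open Scope ring_scope.
Local Open Scope complex_scope.

Theorem theorem4p1 (R : realType) (n : nat) (p : {poly {poly R[i]}})
  (m l : nat) (tau lam : nat -> R[i]) (alpha : R[i]) (b1 b2 : {poly R[i]})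
  (c d : nat -> R) :
  (1 <= n)%N ->
  (* p has degree at most (n,1) and no zeros on D^2 *)
  bideg_le n 1 p ->
  (forall z1 z2 : R[i], `|z1| < 1 -> `|z2| < 1 -> eval2 p z1 z2 != 0) ->
  (* p~ has degree exactly (n,1) *)
  size (ptilde n p) = 2%N ->
  (size (ptilde n p)`_0 = n.+1 \/ size (ptilde n p)`_1 = n.+1) ->
  (* p and p~ have no common (non-constant) factor in C[z1,z2] *)
  (forall g h1 h2 : {poly {poly R[i]}},
      p = g * h1 -> ptilde n p = g * h2 -> exists k : R[i], g = k%:P%:P) ->
  (* the zeros of p on T^2 are the distinct points (tau_k, lam_k), k < m *)
  (forall k, (k < m)%N ->
      `|tau k| = 1 /\ `|lam k| = 1 /\ eval2 p (tau k) (lam k) = 0) ->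
  (forall z1 z2 : R[i], `|z1| = 1 -> `|z2| = 1 -> eval2 p z1 z2 = 0 ->
      exists2 k, (k < m)%N & z1 = tau k /\ z2 = lam k) ->
  (forall j k, (j < m)%N -> (k < m)%N -> tau j = tau k -> lam j = lam k -> j = k) ->
  (* alpha is exceptional, attained exactly at the points with index k < l *)
  `|alpha| = 1 ->
  (1 <= l <= m)%N ->
  (forall k, (k < l)%N -> nt_limit (rif n p) (tau k) (lam k) alpha) ->
  (forall k, (l <= k < m)%N -> ~ nt_limit (rif n p) (tau k) (lam k) alpha) ->
  (* B_alpha = b1/b2 in lowest terms, degree n - l *)
  coprimep b1 b2 -> b2 != 0 ->
  (recip1 n p`_0 - alpha%:P * p`_1) * b2 = (alpha%:P * p`_0 - recip1 n p`_1) * b1 ->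
  (size b1 <= (n - l).+1)%N -> (size b2 <= (n - l).+1)%N ->
  (* c_j = 1 / |d phi/d z1 (tau_j, z2)|  for z2 in closed disk minus lam_j *)
  (forall j, (j < l)%N -> 0 < c j /\
      forall z2 : R[i], `|z2| <= 1 -> z2 != lam j ->
        (c j)%:C * `|drif_dz1 n p (tau j) z2| = 1) ->
  (* normalisation of d_j : c_j ||(R_j/p)(tau_j, .)||^2_{H^2(D)} = 1 *)
  (forall j, (j < l)%N -> 0 < d j /\
      exists s : R[i],
        H2D_normsq (fun z2 => eval2 (R0j b1 b2 tau l j) (tau j) z2
                              / eval2 p (tau j) z2) s
        /\ (c j)%:C * ((d j)%:C) ^+ 2 * s = 1) ->
  exists (r : nat -> {poly {poly R[i]}}) (Q : {poly {poly R[i]}}),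
    (forall j, (j < l)%N -> r j = ((d j)%:C%:P)%:P * R0j b1 b2 tau l j) /\
    (forall j, (j < n)%N -> bideg_le n.-1 1 (r j)) /\
    bideg_le n 0 Q /\
    (forall z1 z2 w1 w2 : R[i],
        eval2 p z1 z2 * (eval2 p w1 w2)^*
        - eval2 (ptilde n p) z1 z2 * (eval2 (ptilde n p) w1 w2)^*
        = (1 - z1 * w1^*) * \sum_(j < n) eval2 (r j) z1 z2 * (eval2 (r j) w1 w2)^*
          + (1 - z2 * w2^*) * eval2 Q z1 z2 * (eval2 Q w1 w2)^*) /\
    (forall j, (j < l)%N ->
        in_model_space (rif n p) (fun z1 z2 => eval2 (r j) z1 z2 / eval2 p z1 z2)) /\
    (forall j k, (j < l)%N -> (k < l)%N ->
        H2_inner_is (fun z1 z2 => eval2 (r j) z1 z2 / eval2 p z1 z2)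
                    (fun z1 z2 => eval2 (r k) z1 z2 / eval2 p z1 z2)
                    (if j == k then 1 else 0)).
Proof.
move=> n0 p_deg p_disk _ _ _ tau_lam p_torus tau_lam_inj alpha1 lm nt_in nt_out b_cop b20 b_eq _ _
  c_def d_def.
(* Only finitely many lam_k are to be avoided on the circle. *)
have [la la1 la_lam] := circle_infinite [seq lam k | k <- iota 0 m].
have lamN k : (k < m)%N -> lam k != la.
  move=> km; apply: contraNneq la_lam => <-; apply: map_f.
  by rewrite mem_iota add0n.
rewrite !mul_polyC in b_eq.
have [g [Ag Bg]] := coprime_proportional b_cop b20 b_eq.
exact: (main_decomposition n0 p_deg p_disk tau_lam p_torus tau_lam_inj alpha1 lm nt_in nt_out
  la1 lamN Ag Bg b_cop c_def d_def).
Qed.
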